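(* There exists a sufficiently small $h_0>0$ such that, for $0<h\le h_0$ and all $t\in[0,T]$, the following bounds hold: $$\Big|\int_{\Gamma^*}\eta^*\phi^*-\int_\Gamma(\eta^*\phi^* )^\Gamma\Big|\le Ch^p\|\eta^*\|_{L^2(\Gamma^* )}\|\phi^*\|_{L^2(\Gamma^* )},$$ $$\Big|\int_{\partial\Gamma^*_0}\eta^*\phi^*-\int_{\partial\Gamma_0}(\phi^*\eta^* )^\Gamma\Big|\le Ch^p\|\eta^*\|_{L^2(\partial\Gamma^* )}\|\phi^*\|_{L^2(\partial\Gamma^* )},$$ $$\Big|\int_{\Gamma^*}\nabla_{\Gamma^*}\eta^*\cdot\nabla_{\Gamma^*}\phi^*-\int_\Gamma\nabla_\Gamma(\eta^* )^\Gamma\cdot\nabla_\Gamma(\phi^* )^\Gamma\Big|\le Ch^p\|\nabla_{\Gamma^*}\eta^*\|_{L^2(\Gamma^* )}\|\nabla_{\Gamma^*}\phi^*\|_{L^2(\Gamma^* )},$$ $$\Big|\int_{\Gamma^*}\mathrm{div}_{\Gamma^*}v^*\,\eta^*\phi^*-\int_\Gamma\mathrm{div}_\Gamma v\,(\eta^*\phi^* )^\Gamma\Big|\le Ch^p\|\eta^*\|_{L^2(\Gamma^* )}\|\phi^*\|_{L^2(\Gamma^* )},$$ $$\Big|\int_{\Gamma^*}\nabla_{\Gamma^*}\eta^*\cdot\mathcal B(v^* )\nabla_{\Gamma^*}\phi^*-\int_\Gamma\nabla_\Gamma(\eta^* )^\Gamma\cdot\mathcal B(v)\nabla_\Gamma(\phi^*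 )^\Gamma\Big|\le Ch^p\|\nabla_{\Gamma^*}\eta^*\|_{L^2(\Gamma^* )}\|\nabla_{\Gamma^*}\phi^*\|_{L^2(\Gamma^* )},$$ for all sufficiently smooth functions $\eta^*,\phi^*$ defined on $\Gamma^*=\Gamma^*(t)$ (not necessarily spline functions), where $\Gamma=\Gamma(t)$. The constants $C$ and $h_0$ depend only on the regularity of $X$ (and possibly on $p$).
   Context: $\Omega=(0,1)^2$, $T>0$. $\Gamma(t)=X(\Omega,t)\subset\mathbb R^3$, $t\in[0,T]$, is a smooth evolving surface, $X(t)=X(\cdot,t)$ a diffeomorphism onto $\Gamma(t)$, with fixed boundary $X(t)|_{\partial\Omega}=X_0|_{\partial\Omega}$, so $\partial\Gamma(t)=\partial\Gamma_0$ (in the paper $\Gamma(t)$ is the exact solution of mean curvature flow with fixed boundary). Standing regularity: $X(t),\partial_tX(t)\in W^{p+1,\infty}(\Omega)$ for all $t\in[0,T]$. The velocity is $v=\partial_tX\circ X^{-1}$. Splines: $p\ge2$, $\ell\ge0$, $h=1/N$; $\mathbb S_h$ is the tensor-product spline space of degree $p$ and smoothness $C^\ell$ on the uniform $N\times N$ mesh of $\Omega$, with B-spline basis $\{B_j\}$. $\mathcal Q:L^1(\Omega)\to\mathbb S_h$ is the standard quasi-interpolant (Schumaker) $\mathcal Q(W)=\sum_j\lambda_j(W)B_j$, $\lambda_j(B_i)=\delta_{ij}$, $\lambda_j(W)=\int_{I_j}W\Phi_j$, applied componentwise; it satisfies $\|U-\mathcal QU\|_{W^{k,q}(\Omega)}\le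 Ch^{l-k}\|U\|_{W^{l,q}(\Omega)}$ for $0\le k\le l\le p+1$, $k\le\ell+1$, and $\partial_t\mathcal QU=\mathcal Q\partial_tU$. $X^*(t)=\mathcal QX(t)$, $\Gamma^*(t)=X^*(\Omega,t)$, $v^*=\partial_tX^*\circ(X^* )^{-1}$. On the boundary, with $X_0^*=\mathcal QX_0$, $\partial\Gamma^*=\partial\Gamma_0^*=X_0^*(\partial\Omega)$ is independent of $t$ and $\|X_0-X_0^*\|_{L^q(\partial\Omega)}+h\|X_0-X_0^*\|_{W^{1,q}(\partial\Omega)}\le Ch^{p+1}$. Lift: for $f$ on $\Gamma^*(t)$, $(f)^\Gamma=f\circ X^*(t)\circ X(t)^{-1}$ on $\Gamma(t)$ (and likewise on boundaries). For a vector field $w$ on a surface $S$: $\mathcal B(w)=(\mathrm{div}_Sw)I_3-(\nabla_Sw+(\nabla_Sw)^T)$, with $\nabla_S w$ having as rows the transposed tangential gradients of the components. *)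

(* Defs.v *)
From HB Require Import structures.
From mathcomp Require Import all_boot all_order all_algebra.
From mathcomp Require Import all_classical all_reals all_analysis.
Set Implicit Arguments.
Unset Strict Implicit.
Unset Printing Implicit Defensive.
Import Order.TTheory GRing.Theory Num.Theory.
Import numFieldNormedType.Exports.
Local Open Scope classical_set_scope.
Local Open Scope ring_scope.

Definition Omega (R : realType) : set (R * R) :=
  [set x | (0 < x.1 < 1) /\ (0 < x.2 < 1)].

Definition cOmega (R : realType) : set (R * R) :=
  [set x | (0 <= x.1 <= 1) /\ (0 <= x.2 <= 1)].

Definition dOmega (R : realType) : set (R * R) := @cOmega R `\` @Omega R.

Definition leb1 (R : realType) := @lebesgue_measure R.

Definition leb2 (R : realType) := (@lebesgue_measure R \x @lebesgue_measure R)%E.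

(** The side of the square with index [k], traversed by [s] in [0, 1]. *)
Definition side (R : realType) (k : 'I_4) (s : R) : R * R :=
  if val k == 0 then (s, 0)
  else if val k == 1 then (s, 1)
  else if val k == 2 then (0, s)
  else (1, s).

Definition dir (R : realType) (i : 'I_2) : R * R :=
  if val i == 0 then (1, 0) else (0, 1).

Definition pd (R : realType) (V : normedModType R) (i : 'I_2) (f : R * R -> V)
  : R * R -> V := fun x => 'D_(dir R i) f x.

Definition pdn (R : realType) (a b : nat) (f : R * R -> R) : R * R -> R :=
  iter a (pd ord0) (iter b (pd ord_max) f).

(** ** Sobolev norms on the square *)

Definition test_function (R : realType) (phi : R * R -> R) : Prop :=
  (forall a b x, differentiable (pdn a b phi) x) /\
  exists K : set (R * R), [/\ compact K, K `<=` @Omega R &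
    forall x, ~ K x -> phi x = 0].

Definition weak_deriv (R : realType) (a b : nat) (f g : R * R -> R) : Prop :=
  forall phi, test_function phi ->
    \int[@leb2 R]_(x in @Omega R) (f x * pdn a b phi x) =
    (-1) ^+ (a + b) * \int[@leb2 R]_(x in @Omega R) (g x * phi x).

Definition Lq_norm (R : realType) (q : \bar R) (f : R * R -> R) : \bar R :=
  ('N[@leb2 R]_q [(EFin \o f) \_ (@Omega R)])%E.

(** [sob_norm k q f] is the sum of the [L^q] norms of the weak derivatives of
    order at most [k].  They are unique almost everywhere, so the infimum is
    over at most one value as soon as it is finite; it is [+oo] exactly when
    [f] is not in [W^(k,q)]. *)
Definition sob_norm (R : realType) (k : nat) (q : \bar R) (f : R * R -> R)
  : \bar R :=
  ereal_inf [set n : \bar R | exists D : nat -> nat -> R * R -> R,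
    [/\ D 0%N 0%N = f,
        forall a b, (a + b <= k)%N ->
          measurable_fun (@Omega R) (D a b) /\ weak_deriv a b f (D a b) &
        n = (\sum_(a < k.+1) \sum_(b < k.+1 | (a + b <= k)%N)
               Lq_norm q (D a b))%E]].

Definition vsob_norm (R : realType) (k : nat) (q : \bar R)
    (f : R * R -> 'rV[R]_3) : \bar R :=
  (\sum_(i < 3) sob_norm k q (fun x => f x ord0 i))%E.

(** ** Tensor-product splines of degree [p] and smoothness [C^ell] *)

(** Open knot vector with [N] uniform cells: the end knots have multiplicity
    [p + 1] and the interior ones multiplicity [p - ell]. *)
Definition knot (R : realType) (p ell N i : nat) : R :=
  if (i <= p)%N then 0
  else (minn N ((i - p.+1) %/ (p - ell)).+1)%:R / N%:R.

Definition nb_splines (p ell N : nat) : nat := (p.+1 + N.-1 * (p - ell))%N.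

(** Cox-de Boor recursion; division by zero gives zero, as the usual
    convention for repeated knots demands.  The last nonempty knot interval is
    closed on the right, so that the splines are continuous up to [x = 1]. *)
Fixpoint bspline1 (R : realType) (t : nat -> R) (d i : nat) (x : R) : R :=
  match d with
  | 0%N => if (t i <= x < t i.+1) || [&& x == 1, t i < 1 & t i.+1 == 1]
           then 1 else 0
  | d'.+1 => (x - t i) / (t (i + d'.+1)%N - t i) * bspline1 t d' i x
     + (t (i + d'.+2)%N - x) / (t (i + d'.+2)%N - t i.+1)
         * bspline1 t d' i.+1 x
  end.

Definition bspline (R : realType) (p ell N i j : nat) (x : R * R) : R :=
  bspline1 (@knot R p ell N) p i x.1 * bspline1 (@knot R p ell N) p j x.2.

Definition qi_functional (R : realType) (I : set (R * R)) (Phi W : R * R -> R)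
  : R := \int[@leb2 R]_(x in I) (W x * Phi x).

Definition qi_sum (R : realType) (p ell : nat)
    (I : nat -> nat -> nat -> set (R * R))
    (Phi : nat -> nat -> nat -> R * R -> R)
    (N : nat) (W : R * R -> R) (x : R * R) : R :=
  \sum_(i < nb_splines p ell N) \sum_(j < nb_splines p ell N)
    qi_functional (I N i j) (Phi N i j) W * bspline p ell N i j x.

(** A family, indexed by the number [N = 1 / h] of cells per direction, of
    quasi-interpolants with integral dual functionals and the standard
    approximation property; the constant of the latter is uniform in the mesh
    size and in the function. *)
Record quasi_interpolant (R : realType) (p ell : nat) := QuasiInterpolant {
  qi_dom : nat -> nat -> nat -> set (R * R) ;
  qi_weight : nat -> nat -> nat -> R * R -> R ;
  qi_dom_measurable : forall N i j,
    measurable (qi_dom N i j) /\ qi_dom N i j `<=` @Omega R ;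
  qi_weight_bounded : forall N i j,
    measurable_fun (qi_dom N i j) (qi_weight N i j) /\
    exists B : R, forall x, qi_dom N i j x -> `|qi_weight N i j x| <= B ;
  qi_dual : forall N i j i' j', (0 < N)%N ->
    (i < nb_splines p ell N)%N -> (j < nb_splines p ell N)%N ->
    (i' < nb_splines p ell N)%N -> (j' < nb_splines p ell N)%N ->
    qi_functional (qi_dom N i j) (qi_weight N i j) (bspline p ell N i' j')
      = ((i == i') && (j == j'))%:R ;
  qi_approx : forall q : \bar R, (1 <= q)%E -> exists C : R,
    forall (N k l : nat) (U : R * R -> R), (0 < N)%N ->
      (k <= l)%N -> (l <= p.+1)%N -> (k <= ell.+1)%N ->
      (sob_norm l q U < +oo)%E ->
      (sob_norm k q (fun x => (U x - qi_sum p ell qi_dom qi_weight N U x)%R)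
        <= (C * (N%:R^-1) ^+ (l - k))%:E * sob_norm l q U)%E
}.

Definition qinterp (R : realType) (p ell : nat) (Q : quasi_interpolant R p ell)
    (N : nat) (W : R * R -> 'rV[R]_3) : R * R -> 'rV[R]_3 :=
  fun x => \row_(k < 3)
    qi_sum p ell (qi_dom Q) (qi_weight Q) N (fun y => W y ord0 k) x.

(** ** Parametrised surfaces

    A surface is given by a parametrisation [Y] of the closed square, and
    functions on it are functions on the ambient space, of which only the
    values on [Y @` cOmega] matter. *)

Definition dot (R : realType) (n : nat) (u v : 'rV[R]_n) : R :=
  (u *m v^T) ord0 ord0.

Definition enorm (R : realType) (n : nat) (u : 'rV[R]_n) : R :=
  Num.sqrt (dot u u).

Definition inv_param (R : realType) (Y : R * R -> 'rV[R]_3)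
  : 'rV[R]_3 -> R * R := 'pinv_(fun=> (0, 0)) (@cOmega R) Y.

Definition jac (R : realType) (Y : R * R -> 'rV[R]_3) (x : R * R)
  : 'M[R]_(2, 3) := \matrix_(i < 2, k < 3) pd i Y x ord0 k.

Definition gram (R : realType) (Y : R * R -> 'rV[R]_3) (x : R * R) : 'M[R]_2 :=
  jac Y x *m (jac Y x)^T.

Definition surf_int (R : realType) (Y : R * R -> 'rV[R]_3)
    (f : 'rV[R]_3 -> R) : R :=
  \int[@leb2 R]_(x in @Omega R) (f (Y x) * Num.sqrt (\det (gram Y x))).

Definition bdry_int (R : realType) (Y : R * R -> 'rV[R]_3)
    (f : 'rV[R]_3 -> R) : R :=
  \sum_(k < 4) \int[@leb1 R]_(s in `[0, 1])
    (f (Y (side k s)) * enorm (derive1 (Y \o side k) s)).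

Definition surf_grad (R : realType) (Y : R * R -> 'rV[R]_3)
    (f : 'rV[R]_3 -> R) (y : 'rV[R]_3) : 'rV[R]_3 :=
  let x := inv_param Y y in
  (\row_(i < 2) pd i (f \o Y) x) *m invmx (gram Y x) *m jac Y x.

Definition surf_jac (R : realType) (Y : R * R -> 'rV[R]_3)
    (w : 'rV[R]_3 -> 'rV[R]_3) (y : 'rV[R]_3) : 'M[R]_3 :=
  \matrix_(k < 3) surf_grad Y (fun z => w z ord0 k) y.

Definition surf_div (R : realType) (Y : R * R -> 'rV[R]_3)
    (w : 'rV[R]_3 -> 'rV[R]_3) (y : 'rV[R]_3) : R := \tr (surf_jac Y w y).

Definition surf_B (R : realType) (Y : R * R -> 'rV[R]_3)
    (w : 'rV[R]_3 -> 'rV[R]_3) (y : 'rV[R]_3) : 'M[R]_3 :=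
  (surf_div Y w y)%:M - (surf_jac Y w y + (surf_jac Y w y)^T).

(** [u . B v] for row vectors [u] and [v]. *)
Definition mdot (R : realType) (n : nat) (u : 'rV[R]_n) (B : 'M[R]_n)
    (v : 'rV[R]_n) : R := (u *m B *m v^T) ord0 ord0.

Definition surf_L2 (R : realType) (Y : R * R -> 'rV[R]_3)
    (f : 'rV[R]_3 -> R) : R := Num.sqrt (surf_int Y (fun y => f y ^+ 2)).

Definition bdry_L2 (R : realType) (Y : R * R -> 'rV[R]_3)
    (f : 'rV[R]_3 -> R) : R := Num.sqrt (bdry_int Y (fun y => f y ^+ 2)).

Definition surf_grad_L2 (R : realType) (Y : R * R -> 'rV[R]_3)
    (f : 'rV[R]_3 -> R) : R :=
  Num.sqrt (surf_int Y (fun y => enorm (surf_grad Y f y) ^+ 2)).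

(** Continuous functions on the surface that are differentiable almost
    everywhere, with square-integrable first derivatives.  Stated on the
    parameter domain, because a spline surface is only piecewise smooth; it
    covers smooth functions on the surface as well as spline functions. *)
Definition smooth_on (R : realType) (Y : R * R -> 'rV[R]_3)
    (f : 'rV[R]_3 -> R) : Prop :=
  [/\ {within @cOmega R, continuous (f \o Y)},
      {ae @leb2 R, forall x, @Omega R x -> differentiable (f \o Y) x} &
      forall i : 'I_2, measurable_fun (@Omega R) (pd i (f \o Y)) /\
        (\int[@leb2 R]_(x in @Omega R) ((pd i (f \o Y) x) ^+ 2)%:E < +oo)%E].

(** ** Evolving surfaces *)

(** Time derivative on [[0, T]], one-sided at the end points. *)
Definition time_quot (R : realType) (X : R -> R * R -> 'rV[R]_3) (t : R)
    (x : R * R) : R -> 'rV[R]_3 := fun s => (s - t)^-1 *: (X s x - X t x).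

Definition time_deriv (R : realType) (T : R) (X : R -> R * R -> 'rV[R]_3)
    (t : R) (x : R * R) : 'rV[R]_3 :=
  lim (time_quot X t x @ within `[0, T] t^').

Definition velocity (R : realType) (T : R) (X : R -> R * R -> 'rV[R]_3) (t : R)
  : 'rV[R]_3 -> 'rV[R]_3 := time_deriv T X t \o inv_param (X t).

Definition surf_lift (R : realType) (Ystar Y : R * R -> 'rV[R]_3)
    (f : 'rV[R]_3 -> R) : 'rV[R]_3 -> R := f \o Ystar \o inv_param Y.

Definition C1_closed (R : realType) (f : R * R -> 'rV[R]_3) : Prop :=
  [/\ {within @cOmega R, continuous f},
      forall x, @Omega R x -> differentiable f x &
      forall i : 'I_2, exists g : R * R -> 'rV[R]_3,
        {within @cOmega R, continuous g} /\
        forall x, @Omega R x -> g x = pd i f x].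

(** Evolving surfaces with fixed boundary.  [M] bounds the [W^(p+1,oo)] norms
    and [kappa] is a Lipschitz constant of the inverse parametrisations, that
    is, a quantitative form of [X t] being a diffeomorphism of the closed
    square onto its image. *)
Record evolving_surface (R : realType) (p : nat) (M kappa T : R)
    (X : R -> R * R -> 'rV[R]_3) : Prop := EvolvingSurface {
  es_smooth : forall t : R, 0 <= t <= T -> C1_closed (X t) ;
  es_derivable : forall (t : R) x, 0 <= t <= T -> @cOmega R x ->
    cvg (time_quot X t x @ within `[0, T] t^') ;
  es_dt_smooth : forall t : R, 0 <= t <= T -> C1_closed (time_deriv T X t) ;
  es_sob : forall t : R, 0 <= t <= T -> (vsob_norm p.+1 +oo (X t) <= M%:E)%E ;
  es_dt_sob : forall t : R, 0 <= t <= T ->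
    (vsob_norm p.+1 +oo (time_deriv T X t) <= M%:E)%E ;
  es_diffeo : forall (t : R) x y, 0 <= t <= T -> @cOmega R x ->
    @cOmega R y -> `|x - y| <= kappa * `|X t x - X t y| ;
  es_boundary : forall (t : R) x, 0 <= t <= T -> @dOmega R x -> X t x = X 0 x
}.

(* Main.v *)
Require Import Defs.
From mathcomp Require Import all_boot all_order all_algebra.
From mathcomp Require Import all_classical all_reals all_analysis.
From mathcomp Require Import measurable_realfun ess_sup_inf.
From mathcomp Require Import ring lra zify.
Import Order.TTheory GRing.Theory Num.Theory.
Import numFieldNormedType.Exports.
Local Open Scope classical_set_scope.
Local Open Scope ring_scope.

Set Implicit Arguments.
Unset Strict Implicit.
Unset Printing Implicit Defensive.

(** Pulled back to the parameter square, both sides of each estimate are integrals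
    of the same functions of [eta] and [phi] against two densities, which are
    rational functions of the Jacobians of the two surfaces and of their
    velocities, times the square root of the Gram determinant.  On the functions
    and their parameter gradients the densities act as bilinear forms.  If the
    Jacobians are bounded, differ by at most [d], and have Gram determinants
    bounded below, then the densities differ by a constant times [d]
    ([kernel_bounds]), and the Cauchy-Schwarz inequality ([form_CS]) gives the
    estimates with that constant times [d] ([mass_estimate],
    [div_mass_estimate], [dirichlet_estimate], [B_estimate]).  The boundary
    integrals are treated in the same way, with the lengths of the tangents as
    densities ([bdry_estimate]).

    It remains to see that [d] is of order [h ^ p].  The approximation property
    with one derivative bounds the interpolation errors of the surface and of
    its velocity in [W^(1,oo)] by a constant times [h ^ p].  For continuous
    functions, such a bound is a Lipschitz bound on the closed square
    ([sob_norm_lip_cOmega]): the weak derivative is tested with a plateau times a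
    bump, so that the definition becomes a comparison of averages near two
    points.  At every point where the errors are differentiable, which is
    everywhere off the mesh lines and off the grid points of the edges, their
    derivatives are then of order [h ^ p] pointwise.  The Lipschitz bound also
    shows that the interpolated surface inherits, for small [h], injectivity
    ([perturbed_inj]) and the lower bound on its Gram determinant
    ([immersed_perturb], [det_gram_ge]) from the diffeomorphism property of the
    exact surface.

    Three facts connect this with the statement.  B-splines whose interior knots
    have multiplicity at most [p] are continuous on the closed interval, since
    their jumps can be computed from the recursion ([bspline1_jump]), and they
    are differentiable off the knots ([is_derive_bspline1]).  The velocity of the
    interpolated surface is the interpolant of the velocity, by dominated
    convergence in the dual functionals ([time_deriv_qinterp]).  And the mesh
    lines may be removed from all integrals, because they form a null set
    ([Rintegral_setD_null]). *)

(** * Null sets and the Cauchy-Schwarz inequality *)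

Import HBNNSimple.

(** The integral of a nonnegative function is a supremum over simple functions
    below it, so a simple function can be cut off on the null set whether or not
    the integrand is measurable.  The integrands of the theorem are known to be
    measurable only off the mesh lines. *)
Lemma ge0_integral_setC_null d (T : measurableType d) (R : realType)
    (mu : {measure set T -> \bar R}) (N : set T) (f : T -> \bar R) :
  measurable N -> mu N = 0%E -> (forall x, (0 <= f x)%E) ->
  (\int[mu]_x (f \_ (~` N)) x = \int[mu]_x f x)%E.
Proof.
move=> mN N0 f0; apply/eqP; rewrite eq_le; apply/andP; split.
  rewrite !ge0_integralTE//; last first.
    by move=> x; rewrite patchE; case: ifP.
  apply: le_ereal_sup => _ [h hf <-]; exists h => // x.
  by apply: (le_trans (hf x)); rewrite patchE; case: ifP.
rewrite ge0_integralTE//; apply: ge_ereal_sup => _ [h hf <-].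
have mNC : measurable (~` N) by exact: measurableC.
rewrite -(integralT_nnsfun mu h).
rewrite (ge0_negligible_integral mN)//; last 2 first.
- exact/measurable_EFinP.
- by move=> x _; rewrite lee_fin fun_ge0.
rewrite setTD integral_mkcond.
have -> : (fun x => (h x)%:E) \_ (~` N) = EFin \o (proj_nnsfun h mNC).
  apply/funext => x; rewrite patchE /= mindicE.
  by case: ifP => _; rewrite ?mulr1 ?mulr0.
rewrite [leRHS]ge0_integralTE; last by move=> x; rewrite patchE; case: ifP.
rewrite -[X in (X <= _)%E]/(\int[mu]_x ((proj_nnsfun h mNC) x)%:E)%E integralT_nnsfun.
apply: ereal_sup_ubound; exists (proj_nnsfun h mNC) => //= x.
by rewrite patchE mindicE; case: ifP => _; rewrite ?mulr1 ?mulr0.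
Qed.

Lemma integral_setD_null d (T : measurableType d) (R : realType)
    (mu : {measure set T -> \bar R}) (D N : set T) (f : T -> \bar R) :
  measurable N -> mu N = 0%E ->
  (\int[mu]_(x in D) f x = \int[mu]_(x in D `\` N) f x)%E.
Proof.
move=> mN N0; rewrite integralE [RHS]integralE.
rewrite !(integral_mkcond D) !(integral_mkcond (D `\` N)).
have E (g : T -> \bar R) : g \_ (D `\` N) = (g \_ D) \_ (~` N).
  by rewrite setDE setIC patch_setI.
rewrite !E !ge0_integral_setC_null// => x; rewrite patchE; case: ifP => //.
Qed.

Lemma Rintegral_setD_null d (T : measurableType d) (R : realType)
    (mu : {measure set T -> \bar R}) (D N : set T) (f : T -> R) :
  measurable N -> mu N = 0%E ->
  \int[mu]_(x in D) f x = \int[mu]_(x in D `\` N) f x.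
Proof. by move=> mN N0; congr fine; exact: integral_setD_null. Qed.

(** The arithmetic-geometric mean inequality with the free weight [s] is optimal
    at [s = sqrt q / sqrt p]; when [p] or [q] vanishes the optimum is attained in
    the limit. *)
Lemma AMGM_opt (R : realType) (a K p q : R) : 0 <= K -> 0 <= p -> 0 <= q ->
  (forall s, 0 < s -> a <= K / 2 * (s * p + s^-1 * q)) ->
  a <= K * Num.sqrt p * Num.sqrt q.
Proof.
move=> K0 p0 q0 H.
have key (u v : R) : 0 <= u -> 0 <= v -> (u = 0 \/ v = 0) ->
    (forall s, 0 < s -> a <= K / 2 * (s * u + s^-1 * v)) -> a <= 0.
  move=> u0 v0 uv {}H; rewrite leNgt; apply/negP => a0.
  case: uv => E; rewrite E in H.
    have s0 : 0 < (K * v + a) / a by rewrite divr_gt0// ltr_wpDl// mulr_ge0.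
    have := H _ s0; rewrite mulr0 add0r invf_div.
    have Kv : 0 <= K * v by rewrite mulr_ge0.
    have -> : K / 2 * (a / (K * v + a) * v) = (K * v / (K * v + a)) * (a / 2).
      by field; rewrite gt_eqF// ltr_wpDl.
    have : (K * v / (K * v + a)) <= 1.
      by rewrite ler_pdivrMr ?mul1r ?lerDl ?ltW// ltr_wpDl.
    set z := _ / _; move=> z1 h.
    have : z * (a / 2) <= 1 * (a / 2) by rewrite ler_wpM2r// ltW// divr_gt0.
    lra.
  have s0 : 0 < a / (K * u + a) by rewrite divr_gt0// ltr_wpDl// mulr_ge0.
  have := H _ s0; rewrite mulr0 addr0.
  have Kv : 0 <= K * u by rewrite mulr_ge0.
  have -> : K / 2 * (a / (K * u + a) * u) = (K * u / (K * u + a)) * (a / 2).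
    by field; rewrite gt_eqF// ltr_wpDl.
  have : (K * u / (K * u + a)) <= 1.
    by rewrite ler_pdivrMr ?mul1r ?lerDl ?ltW// ltr_wpDl.
  set z := _ / _; move=> z1 h.
  have : z * (a / 2) <= 1 * (a / 2) by rewrite ler_wpM2r// ltW// divr_gt0.
  lra.
have [p_gt0|p_le0] := ltP 0 p; last first.
  have pE : p = 0 by apply/eqP; rewrite eq_le p_le0.
  rewrite pE sqrtr0 mulr0 mul0r; apply: (key p q) => //; first by left.
have [q_gt0|q_le0] := ltP 0 q; last first.
  have qE : q = 0 by apply/eqP; rewrite eq_le q_le0.
  rewrite qE sqrtr0 mulr0; apply: (key p q) => //; first by right.
have sp : 0 < Num.sqrt p by rewrite sqrtr_gt0.
have sq : 0 < Num.sqrt q by rewrite sqrtr_gt0.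
have := H _ (divr_gt0 sq sp).
suff -> : K / 2 * (Num.sqrt q / Num.sqrt p * p + (Num.sqrt q / Num.sqrt p)^-1 * q)
   = K * Num.sqrt p * Num.sqrt q by [].
rewrite -[in X in _ / _ * X + _](sqr_sqrtr p0) -[in X in _ + _ * X](sqr_sqrtr q0).
by field; rewrite !gt_eqF.
Qed.

Lemma le_Rintegrable d (T : measurableType d) (R : realType)
    (mu : {measure set T -> \bar R}) (D : set T) (f g : T -> R) :
  measurable D -> measurable_fun D f -> mu.-integrable D (EFin \o g) ->
  (forall x, D x -> `|f x| <= g x) -> mu.-integrable D (EFin \o f).
Proof.
move=> mD mf ig fg; apply: (le_integrable mD _ _ ig).
  exact/measurable_EFinP.
by move=> x Dx /=; rewrite lee_fin; apply: (le_trans (fg x Dx)); exact: ler_norm.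
Qed.

Lemma RintegrableZ d (T : measurableType d) (R : realType)
    (mu : {measure set T -> \bar R}) (D : set T) (f : T -> R) (c : R) :
  measurable D -> mu.-integrable D (EFin \o f) ->
  mu.-integrable D (EFin \o (fun x => c * f x)).
Proof.
move=> mD i; apply: (@eq_integrable _ _ _ _ _ mD (fun x => c%:E * (EFin \o f) x)%E).
  by move=> x _ /=; rewrite EFinM.
exact: integrableZl.
Qed.

Lemma RintegrableD d (T : measurableType d) (R : realType)
    (mu : {measure set T -> \bar R}) (D : set T) (f g : T -> R) :
  measurable D -> mu.-integrable D (EFin \o f) -> mu.-integrable D (EFin \o g) ->
  mu.-integrable D (EFin \o (fun x => f x + g x)).
Proof.
move=> mD i j; apply: (@eq_integrable _ _ _ _ _ mD ((EFin \o f) \+ (EFin \o g))%E).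
  by move=> x _ /=; rewrite EFinD.
exact: integrableD.
Qed.

Lemma RintegrableB d (T : measurableType d) (R : realType)
    (mu : {measure set T -> \bar R}) (D : set T) (f g : T -> R) :
  measurable D -> mu.-integrable D (EFin \o f) -> mu.-integrable D (EFin \o g) ->
  mu.-integrable D (EFin \o (fun x => f x - g x)).
Proof.
move=> mD i j; apply: (@eq_integrable _ _ _ _ _ mD ((EFin \o f) \- (EFin \o g))%E).
  by move=> x _ /=; rewrite EFinB.
exact: integrableB.
Qed.

Lemma Rintegrable_norm d (T : measurableType d) (R : realType)
    (mu : {measure set T -> \bar R}) (D : set T) (f : T -> R) :
  measurable D -> mu.-integrable D (EFin \o f) ->
  mu.-integrable D (EFin \o (fun x => `|f x|)).
Proof. by move=> mD /integrable_abse; apply: eq_integrable. Qed.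

(** Integrating the weighted arithmetic-geometric mean inequality and optimising
    the weight gives the Cauchy-Schwarz inequality for a difference of two
    integrals in one step.  The bounds by [L * (P + Q)] only serve to make [F]
    and [G] integrable. *)
Lemma Rintegral_CS d (T : measurableType d) (R : realType)
    (mu : {measure set T -> \bar R}) (D : set T) (F G P Q : T -> R) (K L : R) :
  measurable D -> measurable_fun D F -> measurable_fun D G ->
  mu.-integrable D (EFin \o P) -> mu.-integrable D (EFin \o Q) ->
  (forall x, D x -> 0 <= P x) -> (forall x, D x -> 0 <= Q x) ->
  (forall x, D x -> `|F x| <= L * (P x + Q x)) ->
  (forall x, D x -> `|G x| <= L * (P x + Q x)) ->
  0 <= K ->
  (forall x, D x -> `|F x - G x| <= K * Num.sqrt (P x) * Num.sqrt (Q x)) ->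
  `| \int[mu]_(x in D) F x - \int[mu]_(x in D) G x | <=
  K * Num.sqrt (\int[mu]_(x in D) P x) * Num.sqrt (\int[mu]_(x in D) Q x).
Proof.
move=> mD mF mG iP iQ P0 Q0 FL GL K0 FG.
have iPQ (a b : R) : mu.-integrable D (EFin \o (fun x => a * P x + b * Q x)).
  by apply: RintegrableD => //; exact: RintegrableZ.
have iF : mu.-integrable D (EFin \o F).
  by apply: (le_Rintegrable mD mF (iPQ L L)) => x Dx; rewrite -mulrDr FL.
have iG : mu.-integrable D (EFin \o G).
  by apply: (le_Rintegrable mD mG (iPQ L L)) => x Dx; rewrite -mulrDr GL.
have iFG : mu.-integrable D (EFin \o (fun x => F x - G x)).
  exact: RintegrableB.
(* [K] and the two norms are fixed; the weight [s] is the parameter. *)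
apply: AMGM_opt => //.
- exact: Rintegral_ge0.
- exact: Rintegral_ge0.
move=> s s0.
rewrite -RintegralB//; apply: le_trans (le_normr_Rintegral _ _) _ => //.
have -> : K / 2 * (s * \int[mu]_(x in D) P x + s^-1 * \int[mu]_(x in D) Q x) =
    \int[mu]_(x in D) (K / 2 * s * P x + K / 2 * s^-1 * Q x).
  rewrite RintegralD//; try exact: RintegrableZ.
  by rewrite !RintegralZl// mulrDr !mulrA.
apply: le_Rintegral => //.
  exact: Rintegrable_norm.
move=> x Dx; apply: (le_trans (FG x Dx)).
have := sqr_ge0 (Num.sqrt s * Num.sqrt (P x) - (Num.sqrt s)^-1 * Num.sqrt (Q x)).
have ss : Num.sqrt s != 0 by rewrite sqrtr_eq0 -ltNge.
rewrite sqrrB !exprMn exprVn !sqr_sqrtr ?P0 ?Q0 ?(ltW s0)//.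
set u := Num.sqrt (P x); set v := Num.sqrt (Q x).
have -> : Num.sqrt s * u * ((Num.sqrt s)^-1 * v) = u * v by field.
rewrite -mulr_natl => h.
have -> : K / 2 * s * P x + K / 2 / s * Q x = K / 2 * (s * P x + s^-1 * Q x).
  by rewrite mulrDr !mulrA.
rewrite -mulrA (_ : K * (u * v) = K / 2 * (2 * (u * v))); last by field.
by apply: ler_wpM2l; [rewrite divr_ge0|lra].
Qed.

(** All five estimates have this shape: two densities, [K * e]-close as quadratic
    forms in [a] and [b], where [a] and [b] are controlled by the densities [P]
    and [Q] of the norms on the right-hand side. *)
Lemma form_CS d (T : measurableType d) (R : realType)
    (mu : {measure set T -> \bar R}) (D : set T) (F G P Q a b : T -> R) (K e : R) :
  measurable D -> measurable_fun D F -> measurable_fun D G ->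
  mu.-integrable D (EFin \o P) -> mu.-integrable D (EFin \o Q) ->
  0 < K -> 0 <= e ->
  (forall x, D x -> 0 <= a x /\ 0 <= b x) ->
  (forall x, D x -> a x ^+ 2 <= K * P x /\ b x ^+ 2 <= K * Q x) ->
  (forall x, D x -> [/\ `|F x| <= K * (a x * b x), `|G x| <= K * (a x * b x) &
     `|F x - G x| <= K * e * (a x * b x)]) ->
  `| \int[mu]_(x in D) F x - \int[mu]_(x in D) G x | <=
  K * K * e * Num.sqrt (\int[mu]_(x in D) P x) * Num.sqrt (\int[mu]_(x in D) Q x).
Proof.
move=> mD mF mG iP iQ K0 e0 ab0 abPQ FG.
have P0 x : D x -> 0 <= P x.
  by move=> Dx; have [h _] := abPQ x Dx; rewrite -(pmulr_rge0 _ K0) (le_trans _ h)// sqr_ge0.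
have Q0 x : D x -> 0 <= Q x.
  by move=> Dx; have [_ h] := abPQ x Dx; rewrite -(pmulr_rge0 _ K0) (le_trans _ h)// sqr_ge0.
have abL x : D x -> K * (a x * b x) <= K * K * (P x + Q x).
  move=> Dx; have [h1 h2] := abPQ x Dx.
  rewrite -mulrA ler_wpM2l ?(ltW K0)//.
  have := sqr_ge0 (a x - b x); rewrite sqrrB => h3.
  have h4 := sqr_ge0 (a x); have h5 := sqr_ge0 (b x).
  rewrite mulrDr; lra.
apply: (Rintegral_CS (L := K * K)) => //.
- by move=> x Dx; have [h _ _] := FG x Dx; apply: (le_trans h); exact: abL.
- by move=> x Dx; have [_ h _] := FG x Dx; apply: (le_trans h); exact: abL.
- by rewrite !mulr_ge0// ltW.
move=> x Dx; have [_ _ h] := FG x Dx; apply: (le_trans h).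
have -> : K * K * e * Num.sqrt (P x) * Num.sqrt (Q x) =
  K * e * ((Num.sqrt K * Num.sqrt (P x)) * (Num.sqrt K * Num.sqrt (Q x))).
  have : Num.sqrt K * Num.sqrt K = K by rewrite -expr2 sqr_sqrtr// ltW.
  by set k := Num.sqrt K => kk; rewrite -{1}kk; ring.
rewrite ler_wpM2l//; first by rewrite mulr_ge0// ltW.
have [a0 b0] := ab0 x Dx; have [h1 h2] := abPQ x Dx.
have rt (u v : R) : 0 <= u -> u ^+ 2 <= K * v -> u <= Num.sqrt K * Num.sqrt v.
  move=> u0 uv; rewrite -sqrtrM ?(ltW K0)//.
  by rewrite -(ger0_norm u0) -sqrtr_sqr ler_wsqrtr.
by apply: ler_pM => //; exact: rt.
Qed.

(** * Measure and continuity on the unit square *)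

(** Instances for [leb2]: the product of Lebesgue measures lives on a measurable
    type that is convertible, but not syntactically equal, to the one inferred
    for [R * R]. *)
Lemma le_leb2_integrable (R : realType) (D : set (R * R)) (f g : R * R -> R) :
  measurable D -> measurable_fun D f -> (@leb2 R).-integrable D (EFin \o g) ->
  (forall x, D x -> `|f x| <= g x) -> (@leb2 R).-integrable D (EFin \o f).
Proof. exact: (@le_Rintegrable _ _ _ (@leb2 R)). Qed.

Lemma leb2_integrable_measurable (R : realType) (D : set (R * R)) (f : R * R -> R) :
  (@leb2 R).-integrable D (EFin \o f) -> measurable_fun D f.
Proof. by move=> /integrableP[/measurable_EFinP]. Qed.

Lemma leb2_form_CS (R : realType) (D : set (R * R)) (F G P Q a b : R * R -> R) (K e : R) :
  measurable D -> measurable_fun D F -> measurable_fun D G ->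
  (@leb2 R).-integrable D (EFin \o P) -> (@leb2 R).-integrable D (EFin \o Q) ->
  0 < K -> 0 <= e ->
  (forall x, D x -> 0 <= a x /\ 0 <= b x) ->
  (forall x, D x -> a x ^+ 2 <= K * P x /\ b x ^+ 2 <= K * Q x) ->
  (forall x, D x -> [/\ `|F x| <= K * (a x * b x), `|G x| <= K * (a x * b x) &
     `|F x - G x| <= K * e * (a x * b x)]) ->
  `| \int[@leb2 R]_(x in D) F x - \int[@leb2 R]_(x in D) G x | <=
  K * K * e * Num.sqrt (\int[@leb2 R]_(x in D) P x) * Num.sqrt (\int[@leb2 R]_(x in D) Q x).
Proof. exact: (@form_CS _ _ _ (@leb2 R)). Qed.

Section PlaneMeasure.
Context {R : realType}.
Implicit Types (U : set (R * R)) (f : R * R -> R).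

(** An open set of the plane is the countable union of the rational boxes that it
    contains. *)
Lemma open_prod_measurable U : open U -> measurable U.
Proof.
move=> oU.
pose box (a b c d : rat) : set (R * R) :=
  `]ratr a, ratr b[%classic `*` `]ratr c, ratr d[%classic.
have -> : U = \bigcup_a \bigcup_b \bigcup_c \bigcup_d
    (if `[< box a b c d `<=` U >] then box a b c d else set0).
  apply/seteqP; split; last first.
    by move=> x [a _ [b _ [c _ [d _]]]]; case: ifP => // /asboolP; exact.
  move=> x Ux; have := oU _ Ux => /nbhs_ballP[e /= e0 eU].
  have itv (z : R) : exists a b : rat, z - e < ratr a < z /\ z < ratr b < z + e.
    have /rat_in_itvoo[a] : z - e < z by rewrite ltrBlDr ltrDl.
    have /rat_in_itvoo[b] : z < z + e by rewrite ltrDl.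
    by rewrite !in_itv/= => ? ?; exists a, b.
  have [a [b [/andP[a1 a2] /andP[b1 b2]]]] := itv x.1.
  have [c [d [/andP[c1 c2] /andP[d1 d2]]]] := itv x.2.
  exists a => //; exists b => //; exists c => //; exists d => //.
  case: asboolP => [_|[]].
    by split; rewrite /= in_itv/= ?a2 ?b1 ?c2 ?d1.
  move=> y [] /=; rewrite !in_itv/= => /andP[ya yb] /andP[yc yd].
  apply: eU; split; rewrite /= /ball/= ltr_norml.
    by apply/andP; split; lra.
  by apply/andP; split; lra.
apply: bigcupT_measurable_rat => a; apply: bigcupT_measurable_rat => b.
apply: bigcupT_measurable_rat => c; apply: bigcupT_measurable_rat => d.
by case: ifP => // _; apply: measurableX; exact: measurable_itv.
Qed.

Lemma open_continuous_prod_measurable_fun U f :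
  open U -> {in U, continuous f} -> measurable_fun U f.
Proof.
move=> oU /(continuous_inP _ oU) cf mU.
apply: (measurability _ (RGenOpens.measurableE R)) => //.
move=> _ [_ [a [b ->] <-]].
by apply: open_prod_measurable; apply: cf; exact: interval_open.
Qed.

Lemma Omega_setX : @Omega R = `]0, 1[%classic `*` `]0, 1[%classic.
Proof. by apply/seteqP; split => x [] /=; rewrite !in_itv. Qed.

Lemma cOmega_setX : @cOmega R = `[0, 1]%classic `*` `[0, 1]%classic.
Proof. by apply/seteqP; split => x [] /=; rewrite !in_itv. Qed.

Lemma open_Omega : open (@Omega R).
Proof.
rewrite Omega_setX (_ : _ `*` _ = fst @^-1` `]0, 1[ `&` snd @^-1` `]0, 1[)//.
apply: openI; apply: open_comp; try exact: interval_open.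
  by move=> x _; exact: cvg_fst.
by move=> x _; exact: cvg_snd.
Qed.

Lemma measurable_Omega : measurable (@Omega R).
Proof. exact: open_prod_measurable open_Omega. Qed.

Lemma compact_cOmega : compact (@cOmega R).
Proof. by rewrite cOmega_setX; apply: compact_setX; exact: segment_compact. Qed.

Lemma sub_Omega : @Omega R `<=` @cOmega R.
Proof. by move=> x [/andP[a b] /andP[c d]]; split; rewrite !ltW. Qed.

Lemma leb2_Omega : leb2 (@Omega R) = 1%E.
Proof.
rewrite Omega_setX /leb2 product_measure1E; try exact: measurable_itv.
have E : lebesgue_measure (`]0%R, 1%R[%classic : set R) = 1%E.
  by rewrite lebesgue_measure_itv/= lte_fin ltr01 oppr0 adde0.
by rewrite [X in (X * _)%E]E [X in (_ * X)%E]E mule1.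
Qed.

Lemma Omega_finite : (leb2 (@Omega R) < +oo)%E.
Proof. by rewrite leb2_Omega ltry. Qed.

Lemma cOmega_continuous_in f : {within @cOmega R, continuous f} ->
  {in @Omega R, continuous f}.
Proof.
move=> cf; rewrite -continuous_open_subspace; last exact: open_Omega.
exact: continuous_subspaceW sub_Omega cf.
Qed.

Lemma cOmega_measurable f : {within @cOmega R, continuous f} ->
  measurable_fun (@Omega R) f.
Proof.
by move=> /cOmega_continuous_in; apply: open_continuous_prod_measurable_fun open_Omega.
Qed.

Lemma cOmega_bounded f : {within @cOmega R, continuous f} ->
  exists B : R, 0 <= B /\ forall x, @cOmega R x -> `|f x| <= B.
Proof.
move=> cf; have /compact_bounded[M [_ h]] := continuous_compact cf compact_cOmega.
exists (`|M| + 1); split; first by rewrite addr_ge0.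
move=> x Ox; apply: (h (`|M| + 1)); last by exists x.
by apply: (le_lt_trans (ler_norm M)); rewrite ltrDl.
Qed.

Lemma bounded_Omega_integrable (D : set (R * R)) f (B : R) :
  measurable D -> D `<=` @Omega R -> measurable_fun D f ->
  (forall x, D x -> `|f x| <= B) -> (@leb2 R).-integrable D (EFin \o f).
Proof.
move=> mD DO mf fB; apply: measurable_bounded_integrable => //.
  apply: le_lt_trans Omega_finite; apply: le_measure; rewrite ?inE//.
  exact: measurable_Omega.
exists B; split; first exact: num_real.
by move=> r Br x Dx; apply: (le_trans (fB x Dx)); exact: ltW.
Qed.

Lemma fst_measurable (D : set (R * R)) : measurable_fun D fst.
Proof. exact: measurable_funTS measurable_fst. Qed.

Lemma snd_measurable (D : set (R * R)) : measurable_fun D snd.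
Proof. exact: measurable_funTS measurable_snd. Qed.

Lemma ge0_integral_tensor (al be : R -> R) :
  measurable_fun setT al -> measurable_fun setT be ->
  (forall x, 0 <= al x) -> (forall x, 0 <= be x) ->
  (\int[@leb2 R]_x (al x.1 * be x.2)%:E =
  (\int[@leb1 R]_x (al x)%:E) * (\int[@leb1 R]_x (be x)%:E))%E.
Proof.
move=> ma mb a0 b0; rewrite /leb2 fubini_tonelli1; last 2 first.
- apply/measurable_EFinP; apply: measurable_funM.
    by apply: measurableT_comp ma _; exact: measurable_fst.
  by apply: measurableT_comp mb _; exact: measurable_snd.
- by move=> x; rewrite lee_fin mulr_ge0.
rewrite -ge0_integralZr//; last 3 first.
- exact/measurable_EFinP.
- by move=> x _; rewrite lee_fin.
- by apply: integral_ge0 => x _; rewrite lee_fin.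
apply: eq_integral => x _; rewrite /fubini_F /=.
under eq_integral do rewrite EFinM.
rewrite ge0_integralZl_EFin//; first by move=> y _; rewrite lee_fin.
exact/measurable_EFinP.
Qed.

(** Tonelli's theorem on the open square; for the one-dimensional integrals the
    end points are a null set. *)
Lemma Rintegral_tensor (al be : R -> R) :
  continuous al -> continuous be ->
  (forall x, 0 <= al x) -> (forall x, 0 <= be x) ->
  \int[@leb2 R]_(x in @Omega R) (al x.1 * be x.2) =
  (\int[@leb1 R]_(x in `[0, 1]) al x) * (\int[@leb1 R]_(x in `[0, 1]) be x).
Proof.
move=> ca cb a0 b0.
have iE (f : R -> R) : continuous f ->
    lebesgue_measure.-integrable `[0%R, 1%R] (EFin \o f).
  move=> cf; apply: continuous_compact_integrable; first exact: segment_compact.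
  exact: continuous_subspaceT.
have E (f : R -> R) : continuous f ->
    \int[@leb1 R]_(x in `[0, 1]) f x = \int[@leb1 R]_(x in `]0, 1[) f x.
  move=> cf; rewrite -Rintegral_itv_bndo_bndc; last first.
    apply: integrableS (iE _ cf) => //; apply: subset_itvl.
    by rewrite bnd_simp.
  rewrite -Rintegral_itv_obnd_cbnd//.
  by apply: integrableS (iE _ cf) => //; exact: subset_itv_oo_cc.
have fE (f : R -> R) : continuous f -> (\int[@leb1 R]_(x in `]0%R, 1%R[) (f x)%:E)%E
    \is a fin_num.
  move=> cf; apply: integrable_fin_num => //.
  by apply: integrableS (iE _ cf) => //; exact: subset_itv_oo_cc.
rewrite !E// /Rintegral -fineM//; try exact: fE.
congr fine; rewrite integral_mkcond [X in (X * _)%E]integral_mkcond.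
rewrite [X in (_ * X)%E]integral_mkcond !restrict_EFin.
rewrite -ge0_integral_tensor; last 4 first.
- apply/(measurable_restrictT _ _).1 => //.
  exact: measurable_funTS (continuous_measurable_fun ca).
- apply/(measurable_restrictT _ _).1 => //.
  exact: measurable_funTS (continuous_measurable_fun cb).
- by move=> x; rewrite patchE; case: ifP.
- by move=> x; rewrite patchE; case: ifP.
apply: eq_integral => x _ /=; rewrite !patchE Omega_setX in_setX.
by case: (x.1 \in _); case: (x.2 \in _); rewrite /= ?mulr0 ?mul0r.
Qed.

Lemma leb1_itvcc (a b : R) : a <= b ->
  leb1 (`[a, b]%classic : set R) = (b - a)%:E.
Proof.
move=> ab.
have E : lebesgue_measure (`[a, b]%classic : set R) = (b - a)%:E.
  rewrite lebesgue_measure_itv/= lte_fin; case: ltgtP ab => //.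
  by move=> ->; rewrite subrr.
exact: E.
Qed.

Lemma Rintegral_le_support (al : R -> R) (a b : R) : continuous al ->
  0 <= a -> a <= b -> b <= 1 -> (forall t, al t <= 1) ->
  (forall t, ~~ (a <= t <= b) -> al t = 0) ->
  \int[@leb1 R]_(t in `[0, 1]) al t <= b - a.
Proof.
move=> ca a0 ab b1 al1 al0.
have cal : (@leb1 R).-integrable `[0, 1] (EFin \o al).
  apply: continuous_compact_integrable; first exact: segment_compact.
  exact: continuous_subspaceT.
have bnd : [bounded (\1_(`[a, b]%classic) : R -> R) t | t in `[0, 1]].
  exists 1; split; first exact: num_real.
  move=> t t1 u _ /=; rewrite indicE ger0_norm ?ler0n//.
  by apply: le_trans (ltW t1); rewrite lern1 leq_b1.
have iind : (@leb1 R).-integrable `[0, 1] (EFin \o \1_(`[a, b]%classic)).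
  apply: measurable_bounded_integrable; [by []| | exact: measurable_indic | exact: bnd].
  by rewrite [X in (X < _)%E]leb1_itvcc ?ltry.
have -> : b - a = \int[@leb1 R]_(t in `[0, 1]) (\1_(`[a, b]%classic) t).
  rewrite /Rintegral integral_indic// (_ : `[a, b]%classic `&` `[0, 1]%classic = `[a, b]%classic).
    by rewrite [X in fine X]leb1_itvcc.
  apply/setIidl => t /=; rewrite !in_itv/= => /andP[h1 h2].
  by rewrite (le_trans a0 h1) (le_trans h2 b1).
apply: le_Rintegral => // t _; rewrite indicE; case: (boolP (t \in _)) => h; first exact: al1.
by rewrite al0//; apply: contra h => h; rewrite inE/= in_itv.
Qed.

End PlaneMeasure.

(** * A smooth step function *)

Section SmoothStep.
Context {R : realType}.
Implicit Types (f g : R -> R).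

Fixpoint smooth_upto (n : nat) f : Prop :=
  if n is m.+1 then (forall x, derivable f x 1) /\ smooth_upto m (derive1 f)
  else True.

(** Smoothness by induction on the order, so that products, inverses and
    compositions need only their first-order rule. *)
Definition smooth f := forall n, smooth_upto n f.

Lemma smooth_uptoW n f : smooth_upto n.+1 f -> smooth_upto n f.
Proof. by elim: n f => // n IH f [df] /IH. Qed.

Lemma smooth_derivable f : smooth f -> forall x, derivable f x 1.
Proof. by move=> /(_ 1%N)[]. Qed.

Lemma smooth_derive f : smooth f -> smooth (derive1 f).
Proof. by move=> sf n; have [] := sf n.+1. Qed.

Lemma smooth_derive1n f n : smooth f -> smooth (derive1n n f).
Proof. by elim: n f => [|n IH] f sf; rewrite ?derive1Sn //; apply/IH/smooth_derive. Qed.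

Lemma smooth_continuous f : smooth f -> continuous f.
Proof.
by move=> /smooth_derivable df x; apply/differentiable_continuous/derivable1_diffP.
Qed.

Lemma smooth_upto_cst n (c : R) : smooth_upto n (fun=> c).
Proof.
elim: n c => // n IH c; split; first by move=> x; exact: derivable_cst.
by rewrite (_ : derive1 _ = fun=> 0)//; apply/funext => x; rewrite derive1_cst.
Qed.

Lemma smooth_uptoD n f g : smooth_upto n f -> smooth_upto n g ->
  smooth_upto n (fun x => f x + g x).
Proof.
elim: n f g => // n IH f g [df sf] [dg sg]; split.
  by move=> x; exact: derivableD.
rewrite (_ : derive1 _ = fun x => derive1 f x + derive1 g x); first exact: IH.
by apply/funext => x; rewrite !derive1E deriveD.
Qed.

Lemma smooth_uptoM n f g : smooth_upto n f -> smooth_upto n g ->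
  smooth_upto n (fun x => f x * g x).
Proof.
elim: n f g => // n IH f g fS gS.
have [df sf] := fS; have [dg sg] := gS; split.
  by move=> x; exact: derivableM.
rewrite (_ : derive1 _ = fun x => f x * derive1 g x + g x * derive1 f x).
  by apply: smooth_uptoD; apply: IH => //; exact: smooth_uptoW.
by apply/funext => x; rewrite !derive1E deriveM.
Qed.

Lemma smooth_uptoV n f : (forall x, f x != 0) -> smooth_upto n f ->
  smooth_upto n (fun x => (f x)^-1).
Proof.
move=> f0; elim: n => // n IH fS; have [df sf] := fS; split.
  by move=> x; exact: derivableV.
have {}IH := IH (smooth_uptoW fS).
rewrite (_ : derive1 _ = fun x => (-1) * (((f x)^-1 * (f x)^-1) * derive1 f x)).
  apply: smooth_uptoM; first exact: smooth_upto_cst.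
  by apply: smooth_uptoM => //; exact: smooth_uptoM.
apply/funext => x; rewrite !derive1E deriveV//.
by rewrite mulN1r -exprVn expr2 scaleNr.
Qed.

Lemma smooth_upto_affine n f (a b : R) : smooth_upto n f ->
  smooth_upto n (fun x => f (a * x + b)).
Proof.
elim: n f => // n IH f [df sf].
have dA (x : R) : is_derive x 1 (fun x => f (a * x + b)) (a * derive1 f (a * x + b)).
  have dl : is_derive x 1 (fun x : R => a * x + b) a.
    apply: is_derive_eq; by rewrite addr0 /GRing.scale/= mulr1.
  have dff : is_derive (a * x + b) 1 f (derive1 f (a * x + b)).
    by rewrite derive1E; apply: derivableP.
  by rewrite mulrC; exact: (@is_derive1_comp _ f (fun x : R => a * x + b)).
split; first by move=> x; have [] := dA x.
rewrite (_ : derive1 _ = fun x => a * derive1 f (a * x + b)).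
  by apply: smooth_uptoM; [exact: smooth_upto_cst|exact: IH].
by apply/funext => x; rewrite derive1E; apply: derive_val.
Qed.

(** The functions [x ^ (- n) * exp (- 1 / x)], extended by zero: the span of this
    family is closed under differentiation, also at zero. *)
Definition flat_exp (n : nat) (x : R) : R :=
  if 0 < x then x^-1 ^+ n * expR (- x^-1) else 0.

Lemma flat_exp_ge0 n x : 0 <= flat_exp n x.
Proof.
by rewrite /flat_exp; case: ltP => // x0; rewrite mulr_ge0 ?expR_ge0// exprn_ge0// invr_ge0 ltW.
Qed.

(** Quadratic flatness at zero, from [exp y >= (y / m) ^ m] with [m = n + 2].  It
    gives the vanishing derivative at zero. *)
Lemma flat_exp_bound n x : `|flat_exp n x| <= (n.+2%:R ^+ n.+2) * x ^+ 2.
Proof.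
rewrite ger0_norm ?flat_exp_ge0// /flat_exp; case: ltP => x0; last first.
  by rewrite mulr_ge0 ?sqr_ge0// exprn_ge0.
set m := n.+2.
have mx : 0 < (m%:R * x)^-1 by rewrite invr_gt0 mulr_gt0.
have h : (m%:R * x)^-1 ^+ m <= expR x^-1.
  have -> : x^-1 = m%:R * (m%:R * x)^-1.
    by rewrite invfM mulrA divff ?mul1r ?pnatr_eq0.
  rewrite mulr_natl expRM_natl; apply: lerXn2r; rewrite ?nnegrE ?expR_ge0//.
    by rewrite invr_ge0 mulrn_wge0// ltW.
  by apply: le_trans (expR_ge1Dx _); rewrite lerDr.
rewrite expRN ler_pdivrMr ?expR_gt0//.
rewrite -ler_pdivrMl; last by rewrite mulr_gt0 ?exprn_gt0.
apply: le_trans h; rewrite [leRHS]exprVn exprMn exprVn -invfM -mulrA -exprD.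
by rewrite add2n.
Qed.

Lemma is_derive_flat_exp n (x : R) :
  is_derive x 1 (flat_exp n) (flat_exp n.+2 x - n%:R * flat_exp n.+1 x).
Proof.
have [x0|x0|x0] := ltrgtP x 0.
- have E : \forall y \near x, 0 = flat_exp n y.
    near=> y; rewrite /flat_exp ltNge ltW//.
    by near: y; exact: lt_nbhsl.
  apply: (near_eq_is_derive E).
  rewrite /flat_exp !ltNge (ltW x0)/= mulr0 subrr.
  exact: is_derive_cst.
- have E : \forall y \near x, y^-1 ^+ n * expR (- y^-1) = flat_exp n y.
    near=> y; rewrite /flat_exp ifT//.
    by near: y; exact: lt_nbhsr.
  apply: (near_eq_is_derive E).
  rewrite /flat_exp x0.
  have xn0 : x != 0 by rewrite gt_eqF.
  have dV : is_derive x 1 (fun y : R => y^-1) (- x ^- 2).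
    have := @is_deriveV R (@id R) x 1 1 xn0 (is_derive_id _ _).
    by rewrite /GRing.scale /= mulr1.
  have dE : is_derive x 1 (fun y : R => expR (- y^-1)) (x ^- 2 * expR (- x^-1)).
    have dN : is_derive x 1 (fun y : R => - y^-1) (x ^- 2).
      by rewrite -[x ^- 2]opprK; apply: is_deriveN.
    by rewrite mulrC; apply: (@is_derive1_comp _ expR (fun y : R => - y^-1)).
  have dX : is_derive x 1 (fun y : R => y^-1 ^+ n) (n%:R * x^-1 ^+ n.-1 * (- x ^- 2)).
    have := @is_deriveX _ _ (fun y : R => y^-1) n x 1 _ dV; rewrite /GRing.scale/=.
    rewrite [in X in X -> _](_ : (fun y : R => y^-1) ^+ n = fun y : R => y^-1 ^+ n)//.
    by apply/funext => y; rewrite exprfctE.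
  have := @is_deriveM _ _ _ _ x 1 _ _ dX dE.
  move=> h; apply: (is_derive_eq h); rewrite /GRing.scale/= {h}.
  case: n E dX => [|n] E dX /=; rewrite ?expr0 ?mul0r; first by rewrite -exprVn !mulr0 mul1r addr0 subr0.
  by rewrite -!exprVn !exprS; ring.
- have -> : flat_exp n.+2 x - n%:R * flat_exp n.+1 x = 0.
    by rewrite /flat_exp x0 ltxx mulr0 subrr.
  rewrite x0.
  have f0 : flat_exp n 0 = 0 by rewrite /flat_exp ltxx.
  set C : R := n.+2%:R ^+ n.+2.
  have C0 : 0 < C by rewrite exprn_gt0.
  have h : (fun h => h^-1 *: (flat_exp n (h *: 1 + 0) - flat_exp n 0)) @ 0^' --> 0.
    apply/cvgrPdist_le => e e0; near=> h.
    rewrite f0 subr0 addr0 sub0r normrN /GRing.scale/= mulr1 normrM normfV.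
    have hn0 : h != 0 by near: h; exact: nbhs_dnbhs_neq.
    rewrite ler_pdivrMl ?normr_gt0//.
    apply: (le_trans (flat_exp_bound _ _)).
    rewrite -/C -normr_id -real_normK ?num_real// normr_id expr2 mulrCA ler_wpM2l//.
    rewrite -ler_pdivlMl// mulrC.
    near: h; apply: dnbhs0_le; by rewrite divr_gt0.
  apply: DeriveDef; first by apply/cvg_ex; exists 0.
  by rewrite /derive; apply/cvg_lim.
Unshelve. all: by end_near. Qed.

Lemma smooth_flat_exp n : smooth (flat_exp n).
Proof.
move=> m; elim: m n => // m IH n; split; first by move=> x; have [] := is_derive_flat_exp n x.
rewrite (_ : derive1 _ = fun x => flat_exp n.+2 x + (- n%:R) * flat_exp n.+1 x).
  by apply: smooth_uptoD => //; apply: smooth_uptoM => //; exact: smooth_upto_cst.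
apply/funext => x; rewrite derive1E mulNr; apply: derive_val.
exact: is_derive_flat_exp.
Qed.

Definition step (x : R) : R :=
  flat_exp 0 x / (flat_exp 0 x + flat_exp 0 (1 - x)).

Lemma step_den_gt0 x : 0 < flat_exp 0 x + flat_exp 0 (1 - x).
Proof.
have gt0 y : 0 < y -> 0 < flat_exp 0 y by rewrite /flat_exp => ->; rewrite expr0 mul1r expR_gt0.
have [x0|x0] := ltP 0 x.
  by rewrite ltr_pwDl ?gt0 ?flat_exp_ge0.
by rewrite ltr_wpDl ?flat_exp_ge0// gt0// subr_gt0 (le_lt_trans x0).
Qed.

Lemma smooth_step : smooth step.
Proof.
have sN n : smooth_upto n (fun x => flat_exp 0 (1 - x)).
  rewrite (_ : (fun x => _) = fun x => flat_exp 0 (-1 * x + 1)).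
    by apply: smooth_upto_affine; exact: smooth_flat_exp.
  by apply/funext => x; rewrite mulN1r addrC.
move=> n; apply: smooth_uptoM; first exact: smooth_flat_exp.
apply: smooth_uptoV; first by move=> x; rewrite gt_eqF// step_den_gt0.
by apply: smooth_uptoD => //; exact: smooth_flat_exp.
Qed.

Lemma step_left x : x <= 0 -> step x = 0.
Proof. by move=> x0; rewrite /step /flat_exp [0 < x]ltNge x0/= mul0r. Qed.

Lemma step_right x : 1 <= x -> step x = 1.
Proof.
move=> x1; have := step_den_gt0 x; rewrite /step /flat_exp subr_gt0 [x < 1]ltNge x1/= addr0.
by move=> h; rewrite divff// gt_eqF.
Qed.

Lemma step_ge0 x : 0 <= step x.
Proof. by rewrite /step divr_ge0 ?flat_exp_ge0// ltW// step_den_gt0. Qed.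

Lemma step_le1 x : step x <= 1.
Proof. by rewrite /step ler_pdivrMr ?step_den_gt0// mul1r lerDl flat_exp_ge0. Qed.

(** The quotient rule; the formula shows that [step] is nondecreasing and flat
    outside the unit interval. *)
Lemma step_derivE (x : R) : derive1 step x =
  (flat_exp 2 x * flat_exp 0 (1 - x) + flat_exp 0 x * flat_exp 2 (1 - x)) /
  (flat_exp 0 x + flat_exp 0 (1 - x)) ^+ 2.
Proof.
have d0 := is_derive_flat_exp 0 x; rewrite mul0r subr0 in d0.
have d1 : is_derive x 1 (fun x => flat_exp 0 (1 - x)) (- flat_exp 2 (1 - x)).
  have dl : is_derive x 1 (fun x : R => 1 - x) (-1).
    by have := is_deriveB (is_derive_cst (1 : R) x 1) (is_derive_id x 1); rewrite sub0r.
  have de := is_derive_flat_exp 0 (1 - x); rewrite mul0r subr0 in de.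
  rewrite -mulN1r mulrC.
  by apply: (@is_derive1_comp _ (flat_exp 0) (fun x : R => 1 - x)).
have dn : flat_exp 0 x + flat_exp 0 (1 - x) != 0 by rewrite gt_eqF// step_den_gt0.
have dD := is_deriveD d0 d1.
have dV := @is_deriveV R (flat_exp 0 \+ (fun x => flat_exp 0 (1 - x))) x _ 1 dn dD.
have dM := is_deriveM d0 dV.
rewrite derive1E; have := @derive_val _ _ _ _ _ _ _ dM.
rewrite (_ : flat_exp 0 * _ = step); last by apply/funext.
move=> ->; rewrite /GRing.scale/=.
set p := flat_exp 0 x; set q := flat_exp 0 (1 - x); rewrite -/p -/q in dn *.
by rewrite -/p -/q; field.
Qed.

Lemma step_deriv_ge0 x : 0 <= derive1 step x.
Proof.
rewrite step_derivE divr_ge0 ?sqr_ge0//.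
by rewrite addr_ge0// mulr_ge0// flat_exp_ge0.
Qed.

Lemma step_deriv0 x : ~~ (0 < x < 1) -> derive1 step x = 0.
Proof.
rewrite negb_and -!leNgt step_derivE => /orP[x0|x1].
  by rewrite /flat_exp [0 < x]ltNge x0/= !mul0r addr0 mul0r.
by rewrite /flat_exp subr_gt0 [x < 1]ltNge x1/= !mulr0 addr0 mul0r.
Qed.

Lemma step_homo x y : x <= y -> step x <= step y.
Proof.
move=> xy; have := @ger0_derive1_le_cc R step x y.
apply => //; rewrite ?in_itv/= ?lexx ?xy//.
- by move=> z _; apply: smooth_derivable; exact: smooth_step.
- by move=> z _; exact: step_deriv_ge0.
- by apply: continuous_subspaceT; exact: smooth_continuous smooth_step.
Qed.

End SmoothStep.

(** * Sobolev bounds of order infinity are Lipschitz bounds *)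

Section PartialDerivatives.
Context {R : realType}.
Implicit Types (x : R * R).

(** Both partial derivatives are handled at once by exchanging coordinates. *)
Definition flip (s : bool) (x : R * R) : R * R := if s then (x.2, x.1) else x.

Lemma flipK s : involutive (flip s).
Proof. by case: s => -[]. Qed.

Lemma Omega_flip s x : @Omega R (flip s x) <-> @Omega R x.
Proof. by case: s => //=; split => -[]. Qed.

Definition axis (s : bool) : 'I_2 := if s then ord_max else ord0.

Lemma axis_cases (i : 'I_2) : exists s, i = axis s.
Proof.
case: i => -[|[|//]] h; [exists false|exists true]; exact: val_inj.
Qed.

(** A difference quotient in the plane along an axis is a difference quotient of a
    function of one variable. *)
Lemma line_quotient (V : normedModType R) s (f : R * R -> V) x (h : R) :
  f (h *: dir R (axis s) + x) - f x =
  (fun r => f (flip s (r, (flip s x).2))) (h *: 1 + (flip s x).1) -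
  (fun r => f (flip s (r, (flip s x).2))) (flip s x).1.
Proof.
have E : x = flip s ((flip s x).1, (flip s x).2) by rewrite -surjective_pairing flipK.
rewrite -E; congr (f _ - _).
case: s {E} => /=; rewrite [LHS]surjective_pairing /=; congr pair;
  by rewrite /GRing.scale/= ?mulr0 ?add0r ?mulr1.
Qed.

Lemma derivable_line (V : normedModType R) s (f : R * R -> V) x :
  derivable f x (dir R (axis s)) =
  derivable (fun r => f (flip s (r, (flip s x).2))) (flip s x).1 1.
Proof.
rewrite /derivable; set u := (X in cvg (X @ _)).
set v := (X in _ = cvg (X @ _)); have -> : u = v; last by [].
by apply/funext => h; rewrite /u /v /= line_quotient.
Qed.

Lemma pd_line (V : normedModType R) s (f : R * R -> V) x :
  pd (axis s) f x = derive1 (fun r => f (flip s (r, (flip s x).2))) (flip s x).1.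
Proof.
rewrite derive1E /pd /derive; set u := (X in lim (X @ _)).
set v := (X in _ = lim (X @ _)); have -> : u = v; last by [].
by apply/funext => h; rewrite /u /v /= line_quotient.
Qed.

End PartialDerivatives.

Lemma differentiable_fst (R : realType) (x : R * R) : differentiable (@fst R R) x.
Proof.
by apply: (@linear_differentiable _ _ _ (@fst R R : {linear (R * R)%type -> R})) => y; exact: cvg_fst.
Qed.

Lemma differentiable_snd (R : realType) (x : R * R) : differentiable (@snd R R) x.
Proof.
by apply: (@linear_differentiable _ _ _ (@snd R R : {linear (R * R)%type -> R})) => y; exact: cvg_snd.
Qed.

Section SobolevLipschitz.
Context {R : realType}.
Implicit Types (f g : R * R -> R) (al be : R -> R) (x : R * R).

Definition tensor al be x := al x.1 * be x.2.

Lemma pdn_tensor i j al be : smooth al -> smooth be ->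
  pdn i j (tensor al be) = tensor (derive1n i al) (derive1n j be).
Proof.
move=> sa sb; rewrite /pdn.
have -> : iter j (pd ord_max) (tensor al be) = tensor al (derive1n j be).
  elim: j => // j IH; rewrite iterS IH; apply/funext => x.
  rewrite (pd_line true) /tensor/= derive1Ml//.
  by apply: smooth_derivable; exact: smooth_derive1n.
elim: i => // i IH; rewrite iterS IH; apply/funext => x.
rewrite (pd_line false) /tensor/= derive1Mr ?derive1nS//.
by apply: smooth_derivable; exact: smooth_derive1n.
Qed.

Lemma differentiable_tensor al be x : smooth al -> smooth be ->
  differentiable (tensor al be) x.
Proof.
move=> sa sb; apply: differentiableM.
  apply: (@differentiable_comp _ _ _ _ fst al); first exact: differentiable_fst.
  exact/derivable1_diffP/smooth_derivable.
apply: (@differentiable_comp _ _ _ _ snd be); first exact: differentiable_snd.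
exact/derivable1_diffP/smooth_derivable.
Qed.

Lemma test_function_tensor al be (a b c d : R) : smooth al -> smooth be ->
  0 < a -> b < 1 -> 0 < c -> d < 1 ->
  (forall s, ~~ (a <= s <= b) -> al s = 0) ->
  (forall s, ~~ (c <= s <= d) -> be s = 0) ->
  test_function (tensor al be).
Proof.
move=> sa sb a0 b1 c0 d1 al0 be0; split.
  by move=> i j x; rewrite pdn_tensor//; apply: differentiable_tensor; exact: smooth_derive1n.
exists (`[a, b]%classic `*` `[c, d]%classic); split.
- by apply: compact_setX; exact: segment_compact.
- move=> x [] /=; rewrite !in_itv/= => /andP[h1 h2] /andP[h3 h4]; split.
    by rewrite (lt_le_trans a0)// (le_lt_trans h2).
  by rewrite (lt_le_trans c0)// (le_lt_trans h4).
move=> x h; rewrite /tensor.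
have [h1|h1] := boolP (a <= x.1 <= b); last by rewrite al0// mul0r.
have [h2|h2] := boolP (c <= x.2 <= d); last by rewrite be0// mulr0.
by exfalso; apply: h; split; rewrite /= in_itv.
Qed.

Definition ramp (c r s : R) : R := step (r^-1 * s + - (r^-1 * c)).

(** As the derivative of a ramp from 0 to 1 it has unit mass, and a difference of
    two ramps is a primitive of a difference of two bumps. *)
Definition bump (c r : R) : R -> R := derive1 (ramp c r).

Lemma ramp_arg (c r s : R) : r^-1 * s + - (r^-1 * c) = r^-1 * (s - c).
Proof. by rewrite mulrBr. Qed.

Lemma smooth_ramp c r : smooth (ramp c r).
Proof. by move=> n; apply: smooth_upto_affine; exact: smooth_step. Qed.

Lemma smooth_bump c r : smooth (bump c r).
Proof. exact/smooth_derive/smooth_ramp. Qed.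

Lemma bumpE c r s : bump c r s = r^-1 * derive1 step (r^-1 * (s - c)).
Proof.
rewrite /bump derive1E.
have dl : is_derive s 1 (fun x : R => r^-1 * x + - (r^-1 * c)) r^-1.
  by apply: is_derive_eq; rewrite subr0 /GRing.scale/= mulr1.
have ds : is_derive (r^-1 * s + - (r^-1 * c)) 1 step
    (derive1 step (r^-1 * s + - (r^-1 * c))).
  by rewrite derive1E; apply: derivableP; apply: smooth_derivable; exact: smooth_step.
have := @is_derive1_comp _ step (fun x : R => r^-1 * x + - (r^-1 * c)) _ _ _ ds dl.
by move=> [_ h]; rewrite -ramp_arg mulrC.
Qed.

Lemma bump_ge0 c r s : 0 < r -> 0 <= bump c r s.
Proof. by move=> r0; rewrite bumpE mulr_ge0 ?step_deriv_ge0// invr_ge0 ltW. Qed.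

Lemma bump0 c r s : 0 < r -> ~~ (c <= s <= c + r) -> bump c r s = 0.
Proof.
move=> r0 h; rewrite bumpE step_deriv0 ?mulr0//; apply: contra h.
rewrite ltr_pdivlMl// mulr0 ltr_pdivrMl// mulr1 subr_gt0 ltrBlDl.
by move=> /andP[/ltW -> /ltW].
Qed.

Lemma ramp0 c r s : 0 < r -> s <= c -> ramp c r s = 0.
Proof.
by move=> r0 h; rewrite /ramp ramp_arg step_left// mulr_ge0_le0 ?subr_le0// invr_ge0 ltW.
Qed.

Lemma ramp1 c r s : 0 < r -> c + r <= s -> ramp c r s = 1.
Proof.
by move=> r0 h; rewrite /ramp ramp_arg step_right// ler_pdivlMl// mulr1 lerBrDl.
Qed.

Lemma ramp_anti a b r s : 0 < r -> a <= b -> ramp b r s <= ramp a r s.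
Proof.
move=> r0 ab; apply: step_homo; rewrite lerD2l lerN2 ler_wpM2l// invr_ge0 ltW//.
Qed.

Lemma ramp_ge0 c r s : 0 <= ramp c r s.
Proof. exact: step_ge0. Qed.

Lemma ramp_le1 c r s : ramp c r s <= 1.
Proof. exact: step_le1. Qed.

Lemma int_bump c r : 0 < r -> 0 <= c -> c + r <= 1 ->
  \int[@leb1 R]_(s in `[0, 1]) bump c r s = 1.
Proof.
move=> r0 c0 cr; rewrite /Rintegral (@continuous_FTC2 _ _ (ramp c r))//.
- by rewrite ramp1// ramp0// sube0.
- by apply: continuous_subspaceT; exact: smooth_continuous (smooth_bump _ _).
- have cr' := smooth_continuous (smooth_ramp c r).
  split.
  + by move=> x _; apply: smooth_derivable; exact: smooth_ramp.
  + by apply: cvg_at_right_filter; exact: cr'.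
  + by apply: cvg_at_left_filter; exact: cr'.
Qed.

Lemma bump_derive1 c r : bump c r = derive1 (ramp c r).
Proof. by []. Qed.

Opaque ramp bump.

Definition kern (r : R) (p : R * R) := tensor (bump p.1 r) (bump p.2 r).

Lemma kern_ge0 r p x : 0 < r -> 0 <= kern r p x.
Proof. by move=> r0; rewrite mulr_ge0 ?bump_ge0. Qed.

Lemma continuous_tensor al be : smooth al -> smooth be -> continuous (tensor al be).
Proof.
by move=> sa sb x; apply: differentiable_continuous; exact: differentiable_tensor.
Qed.

Lemma integrable_tensor al be : smooth al -> smooth be ->
  (@leb2 R).-integrable (@Omega R) (EFin \o tensor al be).
Proof.
move=> sa sb; have ct := continuous_tensor sa sb.
have cw : {within @cOmega R, continuous (tensor al be)} by exact: continuous_subspaceT.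
have [B [B0 hB]] := cOmega_bounded cw.
apply: (bounded_Omega_integrable (B := B)) => //.
- exact: measurable_Omega.
- exact: cOmega_measurable.
- by move=> x /sub_Omega; exact: hB.
Qed.

Lemma int_kern r p : 0 < r -> 0 <= p.1 -> p.1 + r <= 1 -> 0 <= p.2 -> p.2 + r <= 1 ->
  \int[@leb2 R]_(x in @Omega R) kern r p x = 1.
Proof.
move=> r0 *; rewrite /kern /tensor Rintegral_tensor ?int_bump ?mulr1//.
- exact/smooth_continuous/smooth_bump.
- exact/smooth_continuous/smooth_bump.
- by move=> s; exact: bump_ge0.
- by move=> s; exact: bump_ge0.
Qed.

Lemma average_kern r p f (e : R) : 0 < r ->
  0 <= p.1 -> p.1 + r <= 1 -> 0 <= p.2 -> p.2 + r <= 1 ->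
  measurable_fun (@Omega R) f ->
  (forall x, p.1 <= x.1 <= p.1 + r -> p.2 <= x.2 <= p.2 + r -> `|f x - f p| <= e) ->
  (@leb2 R).-integrable (@Omega R) (EFin \o (fun x => f x * kern r p x)) /\
  `| \int[@leb2 R]_(x in @Omega R) (f x * kern r p x) - f p | <= e.
Proof.
move=> r0 p10 p11 p20 p21 mf fe.
have mO := @measurable_Omega R.
have ik := integrable_tensor (smooth_bump p.1 r) (smooth_bump p.2 r).
have mk : measurable_fun (@Omega R) (kern r p).
  by have /integrableP[/measurable_EFinP] := ik.
have dk x : `|(f x - f p) * kern r p x| <= e * kern r p x.
  rewrite normrM [X in _ * X]ger0_norm ?kern_ge0//.
  have [h1|h1] := boolP (p.1 <= x.1 <= p.1 + r); last first.
    by rewrite /kern /tensor bump0// mul0r !mulr0.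
  have [h2|h2] := boolP (p.2 <= x.2 <= p.2 + r); last first.
    by rewrite /kern /tensor (bump0 (c := p.2))// !mulr0.
  by rewrite ler_wpM2r ?kern_ge0// fe.
have iek (c : R) : (@leb2 R).-integrable (@Omega R) (EFin \o (fun x => c * kern r p x)).
  exact: RintegrableZ.
have idk : (@leb2 R).-integrable (@Omega R) (EFin \o (fun x => (f x - f p) * kern r p x)).
  have mfk : measurable_fun (@Omega R) (fun x => (f x - f p) * kern r p x).
    by apply: measurable_funM => //; apply: measurable_funB.
  by apply: (le_leb2_integrable mO mfk (iek e)) => x _.
have E : (fun x => f x * kern r p x) =
    (fun x => (f x - f p) * kern r p x + f p * kern r p x).
  by apply/funext => x; rewrite -mulrDl subrK.
split.
  by rewrite E; exact: RintegrableD.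
rewrite E RintegralD// RintegralZl// int_kern// mulr1 addrK.
apply: (le_trans (le_normr_Rintegral _ _)) => //.
rewrite -[leRHS]mulr1 -(@int_kern r p)// -RintegralZl//.
apply: le_Rintegral => //.
exact: Rintegrable_norm.
Qed.

(** Since the norm is an infimum, a bound [B] provides weak derivatives bounded by
    [B + e] only; [e] goes to zero in the pointwise consequences. *)
Lemma sob_norm_witness k (B e : R) i j f : 0 < e -> (i + j <= k)%N ->
  (sob_norm k +oo f <= B%:E)%E ->
  exists g, [/\ measurable_fun (@Omega R) g, weak_deriv i j f g,
    (i = 0%N -> j = 0%N -> g = f), 0 <= B + e &
    {ae @leb2 R, forall x, @Omega R x -> `|g x| <= B + e}].
Proof.
move=> e0 ijk sB.
have sBe : (sob_norm k +oo f < (B + e)%:E)%E.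
  by apply: (le_lt_trans sB); rewrite lte_fin ltrDl.
have := ereal_inf_lt sBe => -[_ [D [D00 Dw ->]] nD].
have [mg wg] := Dw i j ijk.
exists (D i j).
have L0 h : (0 <= Lq_norm +oo h)%E by exact: Lnorm_ge0.
have leD : (Lq_norm +oo (D i j) <= (B + e)%:E)%E.
  apply: le_trans (ltW nD).
  have ik : (i < k.+1)%N by rewrite ltnS (leq_trans _ ijk)// leq_addr.
  have jk : (j < k.+1)%N by rewrite ltnS (leq_trans _ ijk)// leq_addl.
  rewrite (bigD1 (Ordinal ik))//= (bigD1 (Ordinal jk))//= -addeA leeDl//.
  apply: adde_ge0; first by apply: sume_ge0 => i0 _; exact: L0.
  by apply: sume_ge0 => i0 _; apply: sume_ge0 => j0 _; exact: L0.
split=> //.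
- by move=> -> ->.
- by rewrite -lee_fin; apply: le_trans leD; exact: L0.
move: leD; rewrite /Lq_norm unlock.
case: ifPn => [_ /ess_supP|].
  apply: filterS => x /= h Ox; move: h.
  by rewrite patchE mem_set//= lee_fin.
rewrite -leNgt => h; exfalso; move: h; apply/negP; rewrite -ltNge.
apply: (@lt_le_trans _ _ (leb2 (@Omega R))); first by rewrite leb2_Omega.
by apply: le_measure; rewrite ?inE//; exact: measurable_Omega.
Qed.

(** On a box with corner [p] and small side, a continuous function differs
    little from its value at [p]; the kernels [kern r p] live on such boxes. *)
Lemma near_box f (p : R * R) (e : R) : 0 < e -> @Omega R p ->
  {in @Omega R, continuous f} ->
  exists r0 : R, 0 < r0 /\ forall r, 0 < r -> r < r0 ->
    [/\ p.1 + r < 1, p.2 + r < 1 & forall x, p.1 <= x.1 <= p.1 + r ->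
      p.2 <= x.2 <= p.2 + r -> `|f x - f p| <= e].
Proof.
move=> e0 Op cf.
have /cvgrPdist_le/(_ _ e0) := cf p (mem_set Op).
move=> /nbhs_ballP[d /= d0 dP].
have [/andP[a1 a2] /andP[b1 b2]] := Op.
exists (Num.min d (Num.min (1 - p.1) (1 - p.2))); split.
  by rewrite !lt_min d0 !subr_gt0 a2 b2.
move=> r r0; rewrite !lt_min => /andP[rd /andP[r1 r2]].
split; [lra|lra|move=> x /andP[x1 x2] /andP[y1 y2]].
rewrite distrC; apply: dP; split; rewrite /= /ball/= ltr_norml.
  by apply/andP; split; lra.
by apply/andP; split; lra.
Qed.

Lemma plateau (a b c r : R) : 0 < r -> a < b ->
  0 < a -> b + r < 1 -> 0 < c -> c + r < 1 ->
  exists al, [/\ smooth al, (forall t, 0 <= al t),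
    (forall t, ~~ (a <= t <= b + r) -> al t = 0),
    derive1 al = (fun t => bump a r t - bump b r t) &
    \int[@leb1 R]_(t in `[0, 1]) al t <= b + r - a].
Proof.
move=> r0 ab a0 br1 c0 cr1.
have sal : smooth (fun t => ramp a r t - ramp b r t).
  move=> n; rewrite (_ : (fun t => _) = fun t => ramp a r t + (-1) * ramp b r t); last first.
    by apply/funext => t; rewrite mulN1r.
  apply: smooth_uptoD; first exact: smooth_ramp.
  by apply: smooth_uptoM; [exact: smooth_upto_cst|exact: smooth_ramp].
have al0 t : ~~ (a <= t <= b + r) -> ramp a r t - ramp b r t = 0.
  rewrite negb_and -!ltNge => /orP[ta|tb].
    by rewrite !ramp0 ?subrr// ltW// (lt_trans ta).
  by rewrite !ramp1 ?subrr// ltW// (le_lt_trans _ tb)// lerD2r ltW.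
exists (fun t => ramp a r t - ramp b r t); split => //.
- by move=> t; rewrite subr_ge0 ramp_anti// ltW.
- apply/funext => t; rewrite !bump_derive1 !derive1E deriveB//.
    by apply: smooth_derivable; exact: smooth_ramp.
  by apply: smooth_derivable; exact: smooth_ramp.
- apply: Rintegral_le_support.
  + exact: smooth_continuous sal.
  + exact: ltW a0.
  + by rewrite ler_wpDr ?(ltW r0)// ltW.
  + exact: ltW br1.
  + by move=> t; rewrite lerBlDr (le_trans (ramp_le1 _ _ _))// lerDl ramp_ge0.
  + exact: al0.
Qed.

(** The weak derivative is tested with a plateau along the first (flipped)
    coordinate times a bump across it: its derivative is the difference of
    two unit masses, located at the points to be compared. *)
Lemma plateau_test_function s (a b c r : R) : 0 < r -> a < b ->
  0 < a -> b + r < 1 -> 0 < c -> c + r < 1 ->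
  exists phi, [/\ test_function phi,
    (forall x, pdn (if s then 0 else 1) (if s then 1 else 0) phi x =
      kern r (flip s (a, c)) x - kern r (flip s (b, c)) x),
    (forall x, 0 <= phi x),
    (@leb2 R).-integrable (@Omega R) (EFin \o phi) &
    \int[@leb2 R]_(x in @Omega R) phi x <= b + r - a].
Proof.
move=> r0 ab a0 br1 c0 cr1.
have [al [sal al_ge0 al0 dal Ial]] := plateau r0 ab a0 br1 c0 cr1.
have sbe := smooth_bump c r.
have be0 t : ~~ (c <= t <= c + r) -> bump c r t = 0 by exact: bump0 r0.
have be_ge0 t : 0 <= bump c r t by exact: bump_ge0 r0.
have Ibe := int_bump r0 (ltW c0) (ltW cr1).
have cal := smooth_continuous sal; have cbe := smooth_continuous sbe.
case: s.
  exists (tensor (bump c r) al); split.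
  - exact: (test_function_tensor sbe sal c0 cr1 a0 br1 be0 al0).
  - move=> x; rewrite (pdn_tensor _ _ sbe sal) /kern /tensor /= dal mulrBr.
    by [].
  - by move=> x; rewrite /tensor mulr_ge0.
  - exact: integrable_tensor.
  - by rewrite /tensor (Rintegral_tensor cbe cal be_ge0 al_ge0) Ibe mul1r.
exists (tensor al (bump c r)); split.
- exact: (test_function_tensor sal sbe a0 br1 c0 cr1 al0 be0).
- move=> x; rewrite (pdn_tensor _ _ sal sbe) /kern /tensor /= dal mulrBl.
  by [].
- by move=> x; rewrite /tensor mulr_ge0.
- exact: integrable_tensor.
- by rewrite /tensor (Rintegral_tensor cal cbe al_ge0 be_ge0) Ibe mulr1.
Qed.

Lemma Rintegral_ae_bound g phi (B : R) : 0 <= B ->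
  measurable_fun (@Omega R) g ->
  {ae @leb2 R, forall x, @Omega R x -> `|g x| <= B} ->
  (forall x, 0 <= phi x) -> (@leb2 R).-integrable (@Omega R) (EFin \o phi) ->
  `|\int[@leb2 R]_(x in @Omega R) (g x * phi x)| <=
  B * \int[@leb2 R]_(x in @Omega R) phi x.
Proof.
move=> B0 mg [N [mN N0 subN]] phi0 iphi.
have mO := @measurable_Omega R.
have mD : measurable (@Omega R `\` N) by exact: measurableD.
have gN x : (@Omega R `\` N) x -> `|g x * phi x| <= B * phi x.
  move=> [Ox Nx]; rewrite normrM [X in _ * X]ger0_norm// ler_wpM2r//.
  by apply: contrapT => h; apply: Nx; apply: subN => /= /(_ Ox).
have iphiN : (@leb2 R).-integrable (@Omega R `\` N) (EFin \o phi).
  by apply: integrableS iphi => //; exact: subDsetl.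
have mgphi : measurable_fun (@Omega R `\` N) (fun x => g x * phi x).
  apply: measurable_funM.
    by apply: measurable_funS mg => //; exact: subDsetl.
  exact: leb2_integrable_measurable iphiN.
have iN := le_leb2_integrable mD mgphi (RintegrableZ (mu := @leb2 R) B mD iphiN) gN.
rewrite (Rintegral_setD_null _ _ mN N0).
apply: (le_trans (le_normr_Rintegral (mu := @leb2 R) mD iN)).
apply: (@le_trans _ _ (\int[@leb2 R]_(x in @Omega R `\` N) (B * phi x))).
  apply: le_Rintegral => //; last exact: RintegrableZ.
  exact: Rintegrable_norm.
rewrite RintegralZl// ler_wpM2l//.
by rewrite -Rintegral_setD_null.
Qed.

(** The book-keeping of the two averages [I1] and [I2] near the end points, of the
    integral [I3] of the weak derivative and of the mass [I4] of the test
    function. *)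
Lemma compare_averages (B a b r e I1 I2 I3 I4 fa fb : R) : 0 <= B -> 0 < e ->
  r < e -> `|I1 - fa| <= e -> `|I2 - fb| <= e -> `|I3| <= B * I4 ->
  I4 <= b + r - a -> I1 - I2 = - I3 ->
  `|fb - fa| <= B * (b - a) + (3 + B) * e.
Proof.
move=> B0 e0 re Ia Ib gphi Iphi E.
have BI : B * I4 <= B * (b + r - a) by rewrite ler_wpM2l.
have Br : B * r <= B * e by rewrite ler_wpM2l// ltW.
have -> : fb - fa = (fb - I2) + (I1 - fa) + I3.
  by rewrite (_ : I3 = I2 - I1); [ring|rewrite -[LHS]opprK -E opprB].
apply: (le_trans (ler_normD _ _)).
apply: (le_trans (lerD (ler_normD _ _) (lexx _))).
rewrite [X in X + _ + _ <= _]distrC.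
apply: (le_trans (lerD (lerD Ib Ia) gphi)).
apply: (le_trans (lerD (lexx _) BI)).
move: e0 Br; clear; rewrite !mulrDr !mulrDl mulrN; lra.
Qed.

(** Testing the weak derivative with a plateau test function compares the averages
    of [f] near the two end points; the integral on the other side is at most
    [B] times the mass of the test function, which tends to [b - a]. *)
Lemma weak_deriv_increment s f g (B : R) (a b c : R) : a < b ->
  {in @Omega R, continuous f} -> 0 <= B ->
  measurable_fun (@Omega R) g ->
  weak_deriv (if s then 0 else 1) (if s then 1 else 0) f g ->
  {ae @leb2 R, forall x, @Omega R x -> `|g x| <= B} ->
  @Omega R (flip s (a, c)) -> @Omega R (flip s (b, c)) ->
  `|f (flip s (b, c)) - f (flip s (a, c))| <= B * (b - a).
Proof.
move=> ab cf B0 mg wg gB Oa Ob; apply/ler_addgt0Pr => e e0.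
have [e' [e'0 e'E]] : exists e', 0 < e' /\ e = (3 + B) * e'.
  have B3 : 0 < 3 + B by rewrite ltr_wpDr.
  (* [3 + B] collects the errors in [compare_averages]. *)
  by exists (e / (3 + B)); rewrite divr_gt0// mulrC divfK// gt_eqF.
have [ra [ra0 Ha]] := near_box e'0 Oa cf.
have [rb [rb0 Hb]] := near_box e'0 Ob cf.
have [r [r0 re rra rrb]] : exists r, [/\ 0 < r, r < e', r < ra & r < rb].
  have m0 : 0 < Num.min e' (Num.min ra rb) by rewrite !lt_min e'0 ra0 rb0.
  exists (Num.min e' (Num.min ra rb) / 2).
  have : Num.min e' (Num.min ra rb) / 2 < Num.min e' (Num.min ra rb).
    by rewrite ltr_pdivrMr// ltr_pMr ?ltr1n.
  by rewrite divr_gt0//; set z := _ / _; rewrite !lt_min => /andP[? /andP[]].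
have {Ha}[a1 a2 Ha] := Ha r r0 rra.
have {Hb}[b1 b2 Hb] := Hb r r0 rrb.
have mO := @measurable_Omega R.
have mf : measurable_fun (@Omega R) f.
  exact: open_continuous_prod_measurable_fun (@open_Omega R) cf.
have O0 p : @Omega R p -> 0 <= p.1 /\ 0 <= p.2.
  by move=> [/andP[/ltW ? _] /andP[/ltW]].
have [pa1 pa2] := O0 _ Oa; have [pb1 pb2] := O0 _ Ob.
have [ia Ia] := average_kern r0 pa1 (ltW a1) pa2 (ltW a2) mf Ha.
have [ib Ib] := average_kern r0 pb1 (ltW b1) pb2 (ltW b2) mf Hb.
have [Oac [br1 [c0 cr1]]] : 0 < a /\ b + r < 1 /\ 0 < c /\ c + r < 1.
  move: Oa Ob a1 a2 b1 b2; rewrite /flip; clear; case: s => /=.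
    by move=> [/= /andP[? ?] /andP[? ?]] [/= /andP[? ?] /andP[? ?]].
  by move=> [/= /andP[? ?] /andP[? ?]] [/= /andP[? ?] /andP[? ?]].
have [phi [tphi dphi phi_ge0 iphi Iphi]] := plateau_test_function s r0 ab Oac br1 c0 cr1.
have gphi := Rintegral_ae_bound B0 mg gB phi_ge0 iphi.
have E := wg phi tphi.
have {E} : \int[@leb2 R]_(x in @Omega R) (f x * kern r (flip s (a, c)) x) -
  \int[@leb2 R]_(x in @Omega R) (f x * kern r (flip s (b, c)) x) =
  - \int[@leb2 R]_(x in @Omega R) (g x * phi x).
  rewrite -(RintegralB (mu := @leb2 R) mO ia ib).
  transitivity ((-1) ^+ ((if s then 0 else 1) + (if s then 1 else 0))%N *
    \int[leb2 (R:=R)]_(x in Omega (R:=R)) (g x * phi x)).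
    by rewrite -E; apply: eq_Rintegral => x _; rewrite -mulrBr dphi.
  by case: (s); rewrite /= ?addn0 ?add0n expr1 mulN1r.
rewrite e'E => IE.
exact: (compare_averages B0 e'0 re Ia Ib gphi Iphi IE).
Qed.

(** A continuous function is the limit of its averages, which an essential bound
    controls. *)
Lemma sob_norm_value k f (B : R) x : {in @Omega R, continuous f} ->
  (sob_norm k +oo f <= B%:E)%E -> @Omega R x -> `|f x| <= B.
Proof.
move=> cf sB Ox; apply/ler_addgt0Pr => e e0.
have e2 : 0 < e / 2 by rewrite divr_gt0.
have [g [mg _ /(_ erefl erefl) gf B0 gB]] := @sob_norm_witness k B (e / 2) 0 0 f e2 (leq0n _) sB.
rewrite {g}gf in mg gB.
have [r0 [r00 H]] := near_box e2 Ox cf.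
have r1 : 0 < r0 / 2 by rewrite divr_gt0.
have r2 : r0 / 2 < r0 by rewrite ltr_pdivrMr// ltr_pMr// ltr1n.
have {H}[a1 a2 H] := H _ r1 r2.
have [/andP[/ltW x1 _] /andP[/ltW x2 _]] := Ox.
have [ik Ik] := average_kern r1 x1 (ltW a1) x2 (ltW a2) mg H.
have I1 := int_kern r1 x1 (ltW a1) x2 (ltW a2).
have ikk := integrable_tensor (smooth_bump x.1 (r0 / 2)) (smooth_bump x.2 (r0 / 2)).
have mO := @measurable_Omega R.
have h : `|\int[@leb2 R]_(y in @Omega R) (f y * kern (r0 / 2) x y)| <= B + e / 2.
  have kx y : 0 <= kern (r0 / 2) x y by exact: kern_ge0 r1.
  by have := Rintegral_ae_bound B0 mg gB kx ikk; rewrite I1 mulr1.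
have -> : f x = \int[@leb2 R]_(y in @Omega R) (f y * kern (r0 / 2) x y) -
  (\int[@leb2 R]_(y in @Omega R) (f y * kern (r0 / 2) x y) - f x) by ring.
apply: (le_trans (ler_normB _ _)).
apply: (le_trans (lerD h Ik)).
by rewrite -addrA -splitr.
Qed.

(** For continuous functions a bound in [W^(1,oo)] is a Lipschitz bound along the
    axes, with the same constant. *)
Lemma sob_norm_lipschitz k f (B : R) s a b c : (0 < k)%N ->
  {in @Omega R, continuous f} -> (sob_norm k +oo f <= B%:E)%E ->
  @Omega R (flip s (a, c)) -> @Omega R (flip s (b, c)) ->
  `|f (flip s (b, c)) - f (flip s (a, c))| <= B * `|b - a|.
Proof.
move=> k0 cf sB.
wlog ab : a b / a < b.
  move=> H Oa Ob; have [ab|ab|->] := ltgtP a b; last by rewrite !subrr !normr0 mulr0.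
    exact: H.
  by rewrite distrC [`|b - a|]distrC; exact: H.
move=> Oa Ob; rewrite [X in _ * X]gtr0_norm ?subr_gt0//.
apply/ler_addgt0Pr => e e0.
have e'0 : 0 < e / (b - a) by rewrite divr_gt0// subr_gt0.
have kk : ((if s then 0 else 1) + (if s then 1 else 0) <= k)%N by case: (s).
have [g [mg wg _ B0 gB]] := sob_norm_witness e'0 kk sB.
have := weak_deriv_increment ab cf B0 mg wg gB Oa Ob.
by rewrite mulrDl divfK// subr_eq0 gt_eqF.
Qed.

End SobolevLipschitz.

(** * Univariate B-splines *)

Section UnivariateSplines.
Context {R : realType}.
Implicit Types (t : nat -> R) (x y : R).

(** The left-continuous variant of the B-splines. *)
Fixpoint bspline1L t (d i : nat) (x : R) : R :=
  match d with
  | 0%N => if t i < x <= t i.+1 then 1 else 0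
  | d'.+1 => (x - t i) / (t (i + d'.+1)%N - t i) * bspline1L t d' i x
     + (t (i + d'.+2)%N - x) / (t (i + d'.+2)%N - t i.+1)
         * bspline1L t d' i.+1 x
  end.

Lemma cvg_affine_at (F : set_system R) x (a b : R) : Filter F -> F --> x ->
  (fun y => (y - a) / b) @ F --> (x - a) / b.
Proof.
move=> FF Fx; apply: cvgMl; apply: cvgB => //; exact: cvg_cst.
Qed.

Lemma cvg_affineN_at (F : set_system R) x (a b : R) : Filter F -> F --> x ->
  (fun y => (a - y) / b) @ F --> (a - x) / b.
Proof.
move=> FF Fx; apply: cvgMl; apply: cvgB => //; exact: cvg_cst.
Qed.

Lemma bspline1_cvg_right t d i x : x < 1 ->
  bspline1 t d i y @[y --> x^'+] --> bspline1 t d i x.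
Proof.
move=> x1; elim: d i => [|d IH] i /=; last first.
  have xx : (fun y : R => y) @ x^'+ --> x by apply: cvg_within.
  apply: cvgD; apply: cvgM; try exact: IH.
    exact: cvg_affine_at.
  exact: cvg_affineN_at.
rewrite (lt_eqF x1) /= orbF.
have y1 : \forall y \near x^'+, y < 1 by apply: nbhs_right_lt.
have xy : \forall y \near x^'+, x < y by exact: nbhs_right_gt.
apply: cvg_near_cst; case: ifPn => [/andP[h1 h2]|].
  near=> y; rewrite ifT//; apply/orP; left; apply/andP; split.
    by rewrite (le_trans h1)// ltW//; near: y.
  by near: y; exact: nbhs_right_lt.
rewrite negb_and -ltNge -leNgt => /orP[h|h].
  near=> y; rewrite ifF//; apply/negbTE; rewrite negb_or !negb_and -ltNge.
  have -> : y < t i by near: y; exact: nbhs_right_lt.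
  by rewrite /= lt_eqF//; near: y.
near=> y; rewrite ifF//; apply/negbTE; rewrite negb_or !negb_and -leNgt.
have -> : t i.+1 <= y by rewrite (le_trans h)// ltW//; near: y.
by rewrite orbT/= lt_eqF//; near: y.
Unshelve. all: by end_near. Qed.

Lemma bspline1_cvg_left t d i x : x <= 1 ->
  bspline1 t d i y @[y --> x^'-] --> bspline1L t d i x.
Proof.
move=> x1; elim: d i => [|d IH] i /=; last first.
  have xx : (fun y : R => y) @ x^'- --> x by apply: cvg_within.
  apply: cvgD; apply: cvgM; try exact: IH.
    exact: cvg_affine_at.
  exact: cvg_affineN_at.
have yx : \forall y \near x^'-, y < x by exact: nbhs_left_lt.
apply: cvg_near_cst; case: ifPn => [/andP[h1 h2]|].
  near=> y; rewrite ifT//; apply/orP; left; apply/andP; split.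
    by apply: ltW; near: y; exact: nbhs_left_gt.
  by rewrite (lt_le_trans _ h2)//; near: y.
rewrite negb_and -leNgt -ltNge => /orP[h|h].
  near=> y; rewrite ifF//; apply/negbTE; rewrite negb_or !negb_and -ltNge.
  have yx' : y < x by near: y.
  by rewrite (lt_le_trans yx' h)/= lt_eqF// (lt_le_trans yx').
near=> y; rewrite ifF//; apply/negbTE; rewrite negb_or !negb_and -leNgt.
have yx' : y < x by near: y.
have -> : t i.+1 <= y by apply: ltW; near: y; exact: nbhs_left_gt.
by rewrite orbT/= lt_eqF// (lt_le_trans yx').
Unshelve. all: by end_near. Qed.

Definition coalesced t (i n : nat) x : bool := all (fun k => t k == x) (iota i n).

Lemma coalescedSl t i n x :
  coalesced t i n.+1 x = (t i == x) && coalesced t i.+1 n x.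
Proof. by []. Qed.

Lemma coalescedSr t i n x :
  coalesced t i n.+1 x = coalesced t i n x && (t (i + n)%N == x).
Proof. by rewrite /coalesced -addn1 iotaD all_cat /= andbT. Qed.

(** The jump of a B-spline of degree [d] at [x]: only [d + 1] coalescing knots
    produce one.  Multiplying the jumps in degree [d] by the weights of the
    recursion kills those whose first (last) knot is [x], because the weight
    vanishes there, and keeps the others, because the weight is one there. *)
Lemma bspline1_jump t d i x : (forall j, t j <= t j.+1) -> x != 1 ->
  bspline1 t d i x - bspline1L t d i x =
  (coalesced t i d.+1 x)%:R - (coalesced t i.+1 d.+1 x)%:R.
Proof.
move=> tinc x1; elim: d i => [|d IH] i.
  rewrite /= (negbTE x1)/= orbF /coalesced/= !andbT.
  have := tinc i.
  have [h1|h1|h1] := ltgtP (t i) x; have [h2|h2|h2] := ltgtP (t i.+1) x => //=;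
    rewrite ?subrr ?subr0 ?sub0r//; try lra.
rewrite /=; move: (IH i) (IH i.+1).
set B1 := bspline1 t d i x; set B2 := bspline1 t d i.+1 x.
set L1 := bspline1L t d i x; set L2 := bspline1L t d i.+1 x.
move=> E1 E2.
set w1 := (x - t i) / _; set w2 := (_ - x) / _.
have -> : w1 * B1 + w2 * B2 - (w1 * L1 + w2 * L2) = w1 * (B1 - L1) + w2 * (B2 - L2).
  by ring.
rewrite E1 E2.
rewrite (coalescedSl t i d.+1) (coalescedSr t i.+1 d.+1).
rewrite [coalesced t i d.+1 x]coalescedSl [coalesced t i.+2 d.+1 x]coalescedSr.
rewrite (_ : (i.+2 + d)%N = (i + d.+2)%N); last by rewrite !addSn !addnS.
rewrite (_ : (i.+1 + d.+1)%N = (i + d.+2)%N); last by rewrite !addSn !addnS.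
set c := coalesced t i.+1 d.+1 x.
have W1 : w1 * (t i == x)%:R = 0.
  by rewrite /w1; case: eqP => [->|_]; rewrite ?subrr ?mul0r// mulr0.
have W2 : w2 * (t (i + d.+2)%N == x)%:R = 0.
  by rewrite /w2; case: eqP => [->|_]; rewrite ?subrr ?mul0r// mulr0.
have W1c : w1 * c%:R = (~~ (t i == x) && c)%:R.
  have [cT|cF] := boolP c; last by rewrite mulr0 andbF.
  have tx : t (i + d.+1)%N = x.
    move: cT; rewrite /c coalescedSr => /andP[_ /eqP].
    by rewrite addSn addnS.
  rewrite andbT mulr1 /w1 tx; case: eqP => [->|/eqP h]; first by rewrite subrr mul0r.
  by rewrite divff// subr_eq0 eq_sym.
have W2c : w2 * c%:R = (c && ~~ (t (i + d.+2)%N == x))%:R.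
  have [cT|cF] := boolP c; last by rewrite mulr0.
  have tx : t i.+1 = x by move: cT; rewrite /c coalescedSl => /andP[/eqP].
  rewrite /= mulr1 /w2 tx; case: eqP => [->|/eqP h]; first by rewrite subrr mul0r.
  by rewrite divff// subr_eq0.
move: W1c W2c; move: c => c W1c W2c.
rewrite -!mulnb !natrM.
rewrite !mulrBr [w1 * (_ * _)]mulrA W1 mul0r [w2 * (_ * _)]mulrCA W2 mulr0 W1c W2c.
by case: (t i == x); case: (c); case: (_ == x); rewrite /=; ring.
Qed.

Lemma bspline1_at1 t d i : (forall j, t j <= 1) ->
  bspline1 t d i 1 = bspline1L t d i 1.
Proof.
move=> t1; elim: d i => [|d IH] i /=; last by rewrite !IH.
have := t1 i.+1; rewrite le_eqVlt => /orP[/eqP ->|h].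
  rewrite eqxx lexx ltxx !andbF/= andbT.
  by have := t1 i; case: ltgtP.
have F1 : (1 < t i.+1) = false by rewrite ltNge (ltW h).
have F2 : (1 <= t i.+1) = false by rewrite leNgt h.
by rewrite F1 F2 (lt_eqF h) !andbF.
Qed.

(** Right limits agree with the B-spline and left limits with its left-continuous
    variant; inside the unit interval the two differ by the jump, which vanishes
    when no [d + 1] consecutive knots coalesce.  At the right end point the
    convention on the last knot interval makes the two agree. *)
Lemma bspline1_continuous t d i : (forall j, t j <= t j.+1) -> (forall j, t j <= 1) ->
  (forall x j, 0 < x < 1 -> ~~ coalesced t j d.+1 x) ->
  {within `[0, 1], continuous (bspline1 t d i)}.
Proof.
move=> tinc t1 tc; apply/continuous_within_itvP; first exact: ltr01.
split.
- move=> x; rewrite in_itv/= => /andP[x0 x1].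
  apply/left_right_continuousP; split; last exact: bspline1_cvg_right.
  have -> : bspline1 t d i x = bspline1L t d i x.
    have xn1 : x != 1 by rewrite lt_eqF.
    apply/eqP; rewrite -subr_eq0 (bspline1_jump _ _ tinc xn1).
    have tcx j : coalesced t j d.+1 x = false by apply/negbTE/tc; rewrite x0 x1.
    by rewrite !tcx subrr.
  exact/bspline1_cvg_left/ltW.
- by apply: bspline1_cvg_right; exact: ltr01.
- by rewrite bspline1_at1//; exact: bspline1_cvg_left.
Qed.

(** The recursion differentiated formally: the B-splines of degree zero are
    locally constant off the knots. *)
Fixpoint dbspline1 t (d i : nat) (x : R) : R :=
  match d with
  | 0%N => 0
  | d'.+1 =>
     ((x - t i) / (t (i + d'.+1)%N - t i) * dbspline1 t d' i x
      + bspline1 t d' i x / (t (i + d'.+1)%N - t i))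
     + ((t (i + d'.+2)%N - x) / (t (i + d'.+2)%N - t i.+1) * dbspline1 t d' i.+1 x
        - bspline1 t d' i.+1 x / (t (i + d'.+2)%N - t i.+1))
  end.

Lemma is_derive_bspline1 t d i x : x != 1 -> (forall j, t j != x) ->
  is_derive x 1 (bspline1 t d i) (dbspline1 t d i x).
Proof.
move=> x1 tx; elim: d i => [|d IH] i /=.
  apply: (near_eq_is_derive (f := fun=> bspline1 t 0 i x) _ (is_derive_cst _ _ _)).
  have nx1 : \forall y \near x, (y == 1) = (x == 1).
    have [h|h|h] := ltgtP x 1; last by move: x1; rewrite h eqxx.
      by near=> y; apply: lt_eqF; near: y; exact: lt_nbhsl.
    by near=> y; apply: gt_eqF; near: y; exact: lt_nbhsr.
  have nj j : \forall y \near x, (t j <= y) = (t j <= x).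
    have [h|h|h] := ltgtP (t j) x; last by move: (tx j); rewrite h eqxx.
      by near=> y; apply: ltW; near: y; exact: lt_nbhsr.
    by near=> y; apply/negbTE; rewrite -ltNge; near: y; exact: lt_nbhsl.
  near=> y; rewrite /=.
  have -> : (y == 1) = (x == 1) by near: y.
  have -> : (t i <= y) = (t i <= x) by near: y; exact: nj.
  by rewrite !ltNge; have -> : (t i.+1 <= y) = (t i.+1 <= x) by near: y; exact: nj.
have dl (a b : R) : is_derive x 1 (fun y => (y - a) / b) (b^-1).
  have := is_deriveZ b^-1 (is_deriveB (is_derive_id x 1) (is_derive_cst a x 1)).
  rewrite subr0 /GRing.scale/= mulr1 => h.
  by rewrite (_ : (fun y => _) = b^-1 \*: (id - cst a))//; apply/funext => y /=; rewrite mulrC.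
have dr (a b : R) : is_derive x 1 (fun y => (a - y) / b) (- b^-1).
  have := is_deriveZ b^-1 (is_deriveB (is_derive_cst a x 1) (is_derive_id x 1)).
  rewrite sub0r /GRing.scale/= mulrN1 => h.
  by rewrite (_ : (fun y => _) = b^-1 \*: (cst a - id))//; apply/funext => y /=; rewrite mulrC.
have := is_deriveD (is_deriveM (dl (t i) (t (i + d.+1)%N - t i)) (IH i))
  (is_deriveM (dr (t (i + d.+2)%N) (t (i + d.+2)%N - t i.+1)) (IH i.+1)).
rewrite /GRing.scale/= mulrN => h.
exact: h.
Unshelve. all: by end_near. Qed.

Lemma measurable_bspline1 t d i : measurable_fun setT (bspline1 t d i).
Proof.
elim: d i => [|d IH] i /=.
  rewrite (_ : (fun x => _) = fun x => \1_(`[t i, t i.+1[%classic `|`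
      (if (t i < 1) && (t i.+1 == 1) then [set 1] else set0)) x).
    apply: measurable_indic; apply: measurableU => //.
    by case: ifP.
  apply/funext => x; rewrite indicE in_setU.
  rewrite (_ : (x \in `[t i, t i.+1[%classic) = (t i <= x < t i.+1)); last first.
    by apply/idP/idP; rewrite inE/= in_itv.
  rewrite (_ : (x \in _) = [&& x == 1, t i < 1 & t i.+1 == 1]); first by case: ifP.
  case: ((t i < 1) && _); rewrite ?andbT ?andbF; last by rewrite in_set0.
  by apply/idP/eqP => [/set_mem|->]//; exact/mem_set.
by apply: measurable_funD; apply: measurable_funM => //;
  apply: measurable_funM => //; apply: measurable_funB.
Qed.

Lemma measurable_dbspline1 t d i : measurable_fun setT (dbspline1 t d i).
Proof.
elim: d i => [|d IH] i /=; first exact: measurable_cst.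
have ml (a b : R) : measurable_fun setT (fun x : R => (x - a) / b).
  by apply: measurable_funM => //; apply: measurable_funB.
have mr (a b : R) : measurable_fun setT (fun x : R => (a - x) / b).
  by apply: measurable_funM => //; apply: measurable_funB.
have mB j (b : R) : measurable_fun setT (fun x : R => bspline1 t d j x / b).
  by apply: measurable_funM => //; exact: measurable_bspline1.
apply: measurable_funD; first by apply: measurable_funD => //; exact: measurable_funM.
by apply: measurable_funB => //; exact: measurable_funM.
Qed.

End UnivariateSplines.

Section Knots.
Context {R : realType}.
Variables (p ell N : nat).
Hypotheses (ellp : (ell < p)%N) (N0 : (0 < N)%N).
Notation t := (@knot R p ell N).

Lemma knot_le j : t j <= t j.+1.
Proof.
rewrite /knot; case: ifP => [_|/negbT]; first by case: ifP => // _; rewrite divr_ge0.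
rewrite -ltnNge => pj; rewrite ifF; last by apply/negbTE; rewrite -ltnNge ltnW.
rewrite ler_wpM2r ?invr_ge0// ler_nat leq_min geq_minl/=.
rewrite (leq_trans (geq_minr _ _))// ltnS leq_div2r// leq_sub2r//.
Qed.

Lemma knot_le1 j : t j <= 1.
Proof.
rewrite /knot; case: ifP => // _.
by rewrite ler_pdivrMr ?ltr0n// mul1r ler_nat geq_minl.
Qed.

Lemma knot_grid j : exists k : nat, t j = k%:R / N%:R.
Proof.
by rewrite /knot; case: ifP => _; [exists 0%N; rewrite mul0r|eexists].
Qed.

(** The interior knots have multiplicity [p - ell], at most [p]. *)
Lemma knot_coalesced (x : R) j : 0 < x < 1 -> ~~ coalesced t j p.+1 x.
Proof.
move=> /andP[x0 x1]; apply/negP; rewrite coalescedSr => /andP[cp /eqP tjp].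
have p0 : (0 < p)%N by exact: leq_trans ellp.
have tj : t j = x by move: cp; rewrite -(prednK p0) coalescedSl => /andP[/eqP].
have jp : (p < j)%N.
  by rewrite ltnNge; apply/negP => h; move: x0; rewrite -tj /knot h ltxx.
move: tj tjp x1; rewrite /knot leqNgt jp /= leqNgt (ltn_addr _ jp) /= => <- E.
have NR : (N%:R : R) != 0 by rewrite pnatr_eq0 -lt0n.
have /eqP := mulIf (invr_neq0 NR) E; rewrite eqr_nat => /eqP {}E.
rewrite ltr_pdivrMr ?ltr0n// mul1r ltr_nat => hN.
have d0 : (0 < p - ell)%N by rewrite subn_gt0.
have : ((j - p.+1) %/ (p - ell) < (j + p - p.+1) %/ (p - ell))%N.
  have -> : (j + p - p.+1 = (j - p.+1) + ell + (p - ell))%N by lia.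
  by rewrite divnDr ?dvdnn// divnn d0 addn1 ltnS leq_div2r// leq_addr.
move: ((j - p.+1) %/ (p - ell))%N ((j + p - p.+1) %/ (p - ell))%N E hN.
by move=> a b E hN ab; lia.
Qed.

Lemma knot_bspline1_continuous i :
  {within `[0, 1], continuous (bspline1 t p i)}.
Proof.
apply: bspline1_continuous; [exact: knot_le|exact: knot_le1|].
by move=> x j; exact: knot_coalesced.
Qed.

End Knots.

(** * Passage to the closed square *)

Section ClosedSquare.
Context {R : realType}.
Implicit Types (f g : R * R -> R) (F : R -> R) (x y : R * R).

(** The nearest-point retraction onto the closed interval.  Composing with it turns
    continuity within the closed square into continuity on the plane. *)
Definition clamp01 (s : R) : R := Num.max 0 (Num.min 1 s).

Definition clamp x := (clamp01 x.1, clamp01 x.2).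

Lemma clamp01_id s : 0 <= s <= 1 -> clamp01 s = s.
Proof. by move=> /andP[s0 s1]; rewrite /clamp01 min_r// max_r. Qed.

Lemma clamp01_in s : 0 <= clamp01 s <= 1.
Proof. by rewrite /clamp01 le_max lexx ge_max ler01 ge_min lexx. Qed.

Lemma clamp_in x : @cOmega R (clamp x).
Proof. by split; exact: clamp01_in. Qed.

Lemma clamp_id x : @cOmega R x -> clamp x = x.
Proof. by case: x => a b [/= ha hb]; rewrite /clamp !clamp01_id. Qed.

Lemma continuous_clamp01 : continuous clamp01.
Proof.
move=> s.
have cm : {for s, continuous ((cst 1 : R -> R^o) \min (id : R -> R^o))}.
  by apply: continuous_min => //; exact: cst_continuous.
have c0 : {for s, continuous (cst 0 : R -> R^o)} by exact: cst_continuous.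
exact: (continuous_max c0 cm).
Qed.

Lemma continuous_clamp : continuous clamp.
Proof.
move=> x.
have c1 : clamp01 y.1 @[y --> x] --> clamp01 x.1.
  by apply: (@continuous_comp _ _ _ fst clamp01); [exact: cvg_fst|exact: continuous_clamp01].
have c2 : clamp01 y.2 @[y --> x] --> clamp01 x.2.
  by apply: (@continuous_comp _ _ _ snd clamp01); [exact: cvg_snd|exact: continuous_clamp01].
exact: (cvg_pair c1 c2).
Qed.

Lemma cOmega_extension f : {within @cOmega R, continuous f} ->
  continuous (f \o clamp).
Proof.
move=> /subspace_continuousP cf x; have := cf _ (clamp_in x).
move=> h A /h {}h.
have hx : nbhs (clamp x) (fun y => @cOmega R y -> A (f y)) := h.
have hc : nbhs x (fun y => @cOmega R (clamp y) -> A (f (clamp y))) := continuous_clamp hx.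
change (nbhs x (fun y => A (f (clamp y)))).
by apply: filterS hc => y; apply; exact: clamp_in.
Qed.

(** The limiting argument used for every estimate on the closed square, in the form
    [F <= 0] for a continuous [F] of the contraction parameter. *)
Lemma near0_limit_le F : continuous F -> (\forall u \near 0^'+, F u <= 0) -> F 0 <= 0.
Proof.
move=> cF; have : F u @[u --> 0^'+] --> F 0 by apply: cvg_at_right_filter; exact: cF.
exact: cvgr_to_le.
Qed.

Lemma ge0_limit_le F : continuous F -> (forall u, 0 < u <= 1 -> F u <= 0) -> F 0 <= 0.
Proof.
move=> cF h; apply: near0_limit_le => //; near=> u; apply: h.
by apply/andP; split; near: u; [exact: nbhs_right_gt|exact: nbhs_right_le].
Unshelve. all: by end_near. Qed.

(** The homothety towards the centre of the square moves closed points inside, and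
    lets inequalities on the open square pass to the closed one. *)
Definition contract (u : R) x : R * R :=
  (x.1 + u * (2^-1 - x.1), x.2 + u * (2^-1 - x.2)).

Lemma contract0 x : contract 0 x = x.
Proof. by case: x => a b; rewrite /contract !mul0r !addr0. Qed.

Lemma contract_in u x : @cOmega R x -> 0 < u <= 1 -> @Omega R (contract u x).
Proof.
move=> [/andP[a0 a1] /andP[b0 b1]] /andP[u0 u1]; split; rewrite /=; apply/andP; split; nra.
Qed.

Lemma continuous_contract x : continuous (fun u => contract u x).
Proof.
move=> u.
have c (a : R) : (a + w * (2^-1 - a)) @[w --> u] --> a + u * (2^-1 - a).
  by apply: cvgD; [exact: cvg_cst|apply: cvgMl; exact: cvg_id].
exact: (cvg_pair (c x.1) (c x.2)).
Qed.

Lemma continuous_along_contract f x : {within @cOmega R, continuous f} ->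
  continuous (fun u => f (clamp (contract u x))).
Proof.
move=> cf u; have cc := @continuous_contract x u.
by apply: (@continuous_comp _ _ _ (fun u => contract u x) (f \o clamp)); [|exact: cOmega_extension].
Qed.

Lemma flip_cOmega s x : @cOmega R (flip s x) <-> @cOmega R x.
Proof. by case: s => //=; split => -[]. Qed.

Lemma sob_norm_lip_cOmega k f (B : R) x y : (0 < k)%N ->
  {within @cOmega R, continuous f} -> (sob_norm k +oo f <= B%:E)%E ->
  @cOmega R x -> @cOmega R y ->
  `|f x - f y| <= B * (`|x.1 - y.1| + `|x.2 - y.2|).
Proof.
move=> k0 cf sB Ox Oy.
have lipO a b : @Omega R a -> @Omega R b ->
    `|f a - f b| <= B * (`|a.1 - b.1| + `|a.2 - b.2|).
  move=> Oa Ob; have cfO := cOmega_continuous_in cf.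
  have Oc : @Omega R (b.1, a.2) by case: Oa Ob => [_ ?] [].
  have h1 := @sob_norm_lipschitz _ k f B false b.1 a.1 a.2 k0 cfO sB.
  have h2 := @sob_norm_lipschitz _ k f B true b.2 a.2 b.1 k0 cfO sB.
  rewrite (_ : f a - f b = (f a - f (b.1, a.2)) + (f (b.1, a.2) - f b)); last by rewrite addrA subrK.
  rewrite mulrDr (le_trans (ler_normD _ _))// lerD//.
    by move: h1; rewrite /flip -surjective_pairing; exact.
  by move: h2; rewrite /flip -surjective_pairing; exact.
pose F u := `|f (clamp (contract u x)) - f (clamp (contract u y))|
  - B * ((1 - u) * (`|x.1 - y.1| + `|x.2 - y.2|)).
have : F 0 <= 0.
  apply: ge0_limit_le.
    move=> u; apply: cvgB.
      by apply: cvg_norm; apply: cvgB; exact: continuous_along_contract.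
    apply: cvgMr; apply: cvgMl; apply: cvgB; [exact: cvg_cst|exact: cvg_id].
  move=> u u01; rewrite /F subr_le0.
  have Cx := contract_in Ox u01; have Cy := contract_in Oy u01.
  rewrite !clamp_id; try exact: sub_Omega.
  apply: (le_trans (lipO _ _ Cx Cy)); rewrite /contract/=.
  have E (a b : R) : a + u * (2^-1 - a) - (b + u * (2^-1 - b)) = (1 - u) * (a - b) by ring.
  rewrite !E !normrM -mulrDr ger0_norm// subr_ge0.
  by case/andP: u01.
by rewrite /F !contract0 !clamp_id// subr0 mul1r subr_le0.
Qed.

Lemma sob_norm_value_cOmega k f (B : R) x :
  {within @cOmega R, continuous f} -> (sob_norm k +oo f <= B%:E)%E ->
  @cOmega R x -> `|f x| <= B.
Proof.
move=> cf sB Ox.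
pose F u := `|f (clamp (contract u x))| - B.
have : F 0 <= 0.
  apply: ge0_limit_le.
    move=> u; apply: cvgB; last exact: cvg_cst.
    by apply: cvg_norm; exact: continuous_along_contract.
  move=> u u01; rewrite /F subr_le0.
  have Cx := contract_in Ox u01.
  rewrite clamp_id; last exact: sub_Omega.
  exact: (sob_norm_value (cOmega_continuous_in cf) sB Cx).
by rewrite /F contract0 clamp_id// subr_le0.
Qed.

Lemma is_derive_eps F (s l : R) :
  (forall e, 0 < e -> \forall h \near 0, `|F (h + s) - F s - h * l| <= e * `|h|) ->
  is_derive s 1 F l.
Proof.
move=> H.
have C : (fun h => h^-1 *: (F (h *: 1 + s) - F s)) @ 0^' --> l.
  apply/cvgrPdist_le => e e0; near=> h.
  have hn0 : h != 0 by near: h; exact: nbhs_dnbhs_neq.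
  rewrite /GRing.scale/= mulr1 distrC.
  have -> : h^-1 * (F (h + s) - F s) - l = h^-1 * (F (h + s) - F s - h * l).
    by rewrite [RHS]mulrBr mulKf.
  rewrite normrM normfV ler_pdivrMl ?normr_gt0// mulrC.
  rewrite [X in _ <= X]mulrC [X in _ - X]mulrC.
  by near: h; apply: nbhs_dnbhs; exact: H.
apply: DeriveDef; first by apply/cvg_ex; exists l.
by rewrite /derive; apply/cvg_lim.
Unshelve. all: by end_near. Qed.

Lemma derive1_le F (s B : R) : derivable F s 1 ->
  (\forall h \near 0, `|F (h + s) - F s| <= B * `|h|) -> `|derive1 F s| <= B.
Proof.
move=> dF H; rewrite derive1E.
have /cvg_norm := dF; rewrite -/('D_1 F s) => C.
apply: (cvgr_to_le C); near=> h.
have hn0 : h != 0 by near: h; exact: nbhs_dnbhs_neq.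
rewrite /GRing.scale/= mulr1 normrM normfV ler_pdivrMl ?normr_gt0// mulrC.
by near: h; exact: nbhs_dnbhs.
Unshelve. all: by end_near. Qed.

End ClosedSquare.

(** * Functions that are differentiable off a mesh *)

Section MeshDerivable.
Context {R : realType}.
Implicit Types (f g : R * R -> R) (F : R -> R) (x y : R * R) (G : set R).

Definition mesh G : set (R * R) := [set x | G x.1 \/ G x.2].

Lemma mesh_flip G s x : mesh G (flip s x) <-> mesh G x.
Proof. by case: s => //=; rewrite /mesh/=; tauto. Qed.

(** The common regularity of smooth surfaces and spline surfaces.  Derivability
    along an axis is asked at all points whose coordinate in that direction is
    not in [G]; the edges of the square are included, for the boundary
    integrals. *)
Record mesh_derivable G f : Prop := MeshDerivable {
  md_continuous : {within @cOmega R, continuous f} ;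
  md_derivable : forall s a c, 0 < a < 1 -> 0 <= c <= 1 -> ~ G a ->
    derivable (fun r => f (flip s (r, c))) a 1 ;
  md_measurable : forall i, measurable_fun (@Omega R `\` mesh G) (pd i f) ;
  md_measurable_edge : forall s c, c = 0 \/ c = 1 ->
    measurable_fun (`]0, 1[%classic `\` G) (derive1 (fun r => f (flip s (r, c))))
}.

(** The mean value inequality, with no order assumed between the end points. *)
Lemma segment_lip (phi dphi : R -> R) (a b e : R) :
  (forall r, Num.min a b <= r <= Num.max a b -> is_derive r 1 phi (dphi r)) ->
  (forall r, Num.min a b <= r <= Num.max a b -> `|dphi r| <= e) ->
  `|phi b - phi a| <= e * `|b - a|.
Proof.
wlog ab : a b / a < b.
  move=> H dp de; have [ab|] := ltP a b; first exact: H.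
  rewrite le_eqVlt => /predU1P[->|ab]; first by rewrite !subrr normr0 mulr0.
  rewrite distrC [`|b - a|]distrC.
  by apply: H => // r; rewrite minC maxC; [exact: dp|exact: de].
rewrite (min_l (ltW ab)) (max_r (ltW ab)) => dp de.
have cp : {within `[a, b], continuous phi}.
  apply: derivable_within_continuous => r; rewrite in_itv/= => /dp h.
  exact: (@ex_derive _ _ _ _ _ _ _ h).
have dp' r : r \in `]a, b[%R -> is_derive r 1 phi (dphi r).
  by rewrite in_itv/= => /andP[/ltW h1 /ltW h2]; apply: dp; rewrite h1 h2.
have [c + ->] := MVT ab dp' cp.
rewrite in_itv/= => /andP[/ltW h1 /ltW h2]; rewrite normrM ler_wpM2r//.
by apply: de; rewrite h1 h2.
Qed.

Lemma contract_near (d a : R) : 0 < d -> 0 <= a <= 1 ->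
  \forall u \near 0^'+, `|a + u * (2^-1 - a) - a| < d.
Proof.
move=> d0 /andP[a0 a1]; near=> u.
have u0 : 0 < u by near: u; exact: nbhs_right_gt.
have ud : u < d by near: u; exact: nbhs_right_lt.
rewrite addrC addrA addNr add0r normrM gtr0_norm//.
have h : `|2^-1 - a| <= 1 by rewrite ler_norml; apply/andP; split; lra.
by apply: le_lt_trans ud; rewrite ler_piMr// ltW.
Unshelve. all: by end_near. Qed.

Lemma contract01 (a u : R) : 0 <= a <= 1 -> 0 < u <= 1 ->
  0 < a + u * (2^-1 - a) < 1.
Proof. by move=> /andP[a0 a1] /andP[u0 u1]; apply/andP; split; nra. Qed.

Lemma between01 (a b r : R) : 0 < a < 1 -> 0 < b < 1 ->
  Num.min a b <= r <= Num.max a b -> 0 < r < 1.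
Proof.
rewrite ge_min le_max => /andP[a0 a1] /andP[b0 b1] /andP[h1 h2].
by apply/andP; split; [case/orP: h1|case/orP: h2]; lra.
Qed.

Lemma between_dist (a b r z d : R) : `|a - z| < d / 2 -> `|b - a| < d / 2 ->
  Num.min a b <= r <= Num.max a b -> `|r - z| < d.
Proof.
rewrite !ltr_norml ge_min le_max => /andP[? ?] /andP[? ?] /andP[h1 h2].
by apply/andP; split; [case/orP: h1|case/orP: h2]; lra.
Qed.

Lemma near0_norm_lt (e : R) : 0 < e -> \forall h \near (0 : R), `|h| < e.
Proof.
by move=> e0; apply/nbhs_ballP; exists e => // h; rewrite /ball/= sub0r normrN.
Qed.

(** A C1 function whose derivative extends continuously to the closed square
    is differentiable along the edges as well: the mean value inequality on
    nearby parallel segments inside the square passes to the limit. *)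
Lemma line_is_derive s f g (a c : R) : {within @cOmega R, continuous f} ->
  {within @cOmega R, continuous g} ->
  (forall x, @Omega R x -> derivable f x (dir R (axis s)) /\
     pd (axis s) f x = g x) ->
  0 < a < 1 -> 0 <= c <= 1 ->
  is_derive a 1 (fun r => f (flip s (r, c))) (g (flip s (a, c))).
Proof.
move=> cf cg fg a01 c01; have /andP[a0 a1] := a01.
have fgl b d : @Omega R (flip s (b, d)) ->
    is_derive b 1 (fun r => f (flip s (r, d))) (g (flip s (b, d))).
  move=> Ob; have [h1 h2] := fg _ Ob.
  rewrite derivable_line flipK /= in h1.
  by apply: DeriveDef => //; rewrite -h2 pd_line flipK derive1E.
set p := flip s (a, c).
have Op : @cOmega R p by apply/flip_cOmega; split; rewrite //= !ltW.
apply: is_derive_eps => e e0.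
have : \forall x \near within (@cOmega R) (nbhs p), `|g p - g x| <= e.
  have /subspace_continuousP/(_ _ Op)/cvgrPdist_le/(_ _ e0) := cg.
  by [].
rewrite near_withinE => /nbhs_ballP[d /= d0 dP].
have d2 : 0 < d / 2 by rewrite divr_gt0.
near=> h.
have hd : `|h| < d / 2.
  by near: h; exact: near0_norm_lt.
have ah0 : 0 < h + a.
  have : `|h| < a by near: h; exact: near0_norm_lt.
  by rewrite ltr_norml => /andP[]; lra.
have ah1 : h + a < 1.
  have : `|h| < 1 - a by near: h; apply: near0_norm_lt; rewrite subr_gt0.
  by rewrite ltr_norml => /andP[]; lra.
pose q := flip s (h + a, c).
have Oq : @cOmega R q by apply/flip_cOmega; split; rewrite //= !ltW.
pose D u := `|f (clamp (contract u q)) - f (clamp (contract u p))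
  - (1 - u) * (h * g p)| - e * ((1 - u) * `|h|).
have : D 0 <= 0.
  apply: near0_limit_le.
    move=> u; apply: cvgB.
      apply: cvg_norm; apply: cvgB.
        by apply: cvgB; exact: continuous_along_contract.
      by apply: cvgMl; apply: cvgB; [exact: cvg_cst|exact: cvg_id].
    by apply: cvgMr; apply: cvgMl; apply: cvgB; [exact: cvg_cst|exact: cvg_id].
  near=> u.
  have u0 : 0 < u by near: u; exact: nbhs_right_gt.
  have u1 : u < 1 by near: u; exact: nbhs_right_lt.
  have cu : `|c + u * (2^-1 - c) - c| < d / 2 by near: u; exact: contract_near.
  have au : `|a + u * (2^-1 - a) - a| < d / 2.
    by near: u; apply: contract_near => //; rewrite !ltW.
  rewrite subr_le0 !clamp_id; last 2 first.
  - by apply/sub_Omega/contract_in => //; rewrite u0 ltW.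
  - by apply/sub_Omega/contract_in => //; rewrite u0 ltW.
  have Cq : contract u q = flip s (h + a + u * (2^-1 - (h + a)), c + u * (2^-1 - c)).
    by rewrite /q /contract; case: (s).
  have Cp : contract u p = flip s (a + u * (2^-1 - a), c + u * (2^-1 - c)).
    by rewrite /p /contract; case: (s).
  rewrite Cq Cp; set A := a + _; set B := h + a + _; set c' := c + _.
  have BA : B - A = (1 - u) * h by rewrite /A /B; ring.
  have Oc' r : 0 < r < 1 -> @Omega R (flip s (r, c')).
    move=> r01; apply/Omega_flip; split => //=.
    by rewrite /c' contract01// u0 ltW.
  have A01 : 0 < A < 1 by rewrite /A contract01 ?u0 ?ltW.
  have B01 : 0 < B < 1 by rewrite /B contract01 ?u0 ?ltW.
  have r01 r : Num.min A B <= r <= Num.max A B -> 0 < r < 1.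
    exact: between01 A01 B01.
  have rA r : Num.min A B <= r <= Num.max A B -> `|r - a| < d.
    have hB : `|B - A| <= `|h|.
      rewrite BA normrM ger0_norm ?subr_ge0 ?(ltW u1)// ler_piMl//.
      by rewrite gerBl ltW.
    have BAd : `|B - A| < d / 2 by exact: le_lt_trans hB hd.
    exact: between_dist au BAd.
  pose phi r := f (flip s (r, c')) - r * g p.
  have := @segment_lip phi (fun r => g (flip s (r, c')) - g p) A B e.
  rewrite /phi BA normrM [`|1 - u|]ger0_norm ?subr_ge0 ?(ltW u1)//.
  rewrite (_ : _ - B * g p - _ = f (flip s (B, c')) - f (flip s (A, c')) - (1 - u) * (h * g p)); last first.
    by rewrite mulrA -BA; ring.
  apply.
    move=> r rAB; have dfr := fgl _ _ (Oc' _ (r01 _ rAB)).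
    have dr : is_derive r 1 (fun r => r * g p) (g p).
      have := is_deriveM (is_derive_id r 1) (is_derive_cst (g p) r 1).
      by rewrite /GRing.scale/= mulr0 add0r mulr1.
    exact: is_deriveB dfr dr.
  move=> r rAB; rewrite distrC; apply: dP; last first.
    by apply: sub_Omega; apply: Oc'; exact: r01.
  have r1 := rA _ rAB.
  have c1 : `|c' - c| < d by apply: lt_trans cu _; rewrite ltr_pdivrMr// ltr_pMr ?ltr1n.
  rewrite /p; case: (s); split => /=; rewrite /ball/= distrC//.
by rewrite /D !contract0 !clamp_id// subr0 !mul1r subr_le0.
Unshelve. all: by end_near. Qed.

Lemma C1_mesh_derivable G f (g : 'I_2 -> R * R -> R) : measurable G ->
  {within @cOmega R, continuous f} ->
  (forall i, {within @cOmega R, continuous (g i)}) ->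
  (forall i x, @Omega R x -> derivable f x (dir R i) /\ pd i f x = g i x) ->
  mesh_derivable G f.
Proof.
move=> mG cf cg fg; split => //.
- move=> s a c a01 c01 _.
  have h := line_is_derive cf (cg (axis s)) (fg (axis s)) a01 c01.
  exact: (@ex_derive _ _ _ _ _ _ _ h).
- move=> i; apply: (@eq_measurable_fun _ _ _ _ _ (g i)).
    by move=> x /[!inE] -[Ox _]; have [_] := fg i x Ox.
  apply: measurable_funS (cOmega_measurable (cg i)); last exact: subDsetl.
  exact: measurable_Omega.
- move=> s c c01.
  have c01' : 0 <= c <= 1 by case: c01 => ->; rewrite ?lexx ler01.
  apply: (@eq_measurable_fun _ _ _ _ _ (fun r => g (axis s) (clamp (flip s (r, c))))).
    move=> r /[!inE] -[]; rewrite /= in_itv/= => r01 _.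
    have h := line_is_derive cf (cg (axis s)) (fg (axis s)) r01 c01'.
    rewrite derive1E (@derive_val _ _ _ _ _ _ _ h) clamp_id//.
    by apply/flip_cOmega; split => //=; case/andP: r01 => /ltW -> /ltW ->.
  apply: measurable_funTS; apply: continuous_measurable_fun => r.
  have ci : z @[z --> r] --> r by exact: cvg_id.
  have cc : c @[z --> r] --> c by exact: cvg_cst.
  have cl : flip s (z, c) @[z --> r] --> flip s (r, c).
    case: (s); rewrite /flip/=.
      exact: (cvg_pair cc ci).
    exact: (cvg_pair ci cc).
  apply: (@continuous_comp _ _ _ (fun z => flip s (z, c)) (g (axis s) \o clamp)).
    exact: cl.
  exact: cOmega_extension.
Qed.

End MeshDerivable.

(** * Tensor-product splines *)

Section MeshNull.
Context {R : realType}.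
Implicit Types (G : set R).

Lemma meshE G : mesh G = (G `*` setT) `|` (setT `*` G).
Proof.
apply/seteqP; split => x; first by case=> h; [left|right].
by case=> [[h _]|[_ h]]; [left|right].
Qed.

Lemma measurable_mesh G : measurable G -> measurable (mesh G).
Proof. by move=> mG; rewrite meshE; apply: measurableU; apply: measurableX. Qed.

Lemma leb2_mesh G : measurable G -> leb1 G = 0%E -> leb2 (mesh G) = 0%E.
Proof.
move=> mG G0; rewrite meshE.
have G0' : lebesgue_measure G = 0%E by [].
have E1 : leb2 (G `*` [set: R]) = 0%E.
  by rewrite /leb2 product_measure1E//= [X in (X * _)%E]G0' mul0e.
have E2 : leb2 ([set: R] `*` G) = 0%E.
  by rewrite /leb2 product_measure1E//= [X in (_ * X)%E]G0' mule0.
by apply: (null_set_setU (mu := @leb2 R)) => //; exact: measurableX.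
Qed.

End MeshNull.

Section TensorSplines.
Context {R : realType}.
Variables (p ell N : nat).
Hypotheses (ellp : (ell < p)%N) (N0 : (0 < N)%N).
Notation B := (bspline1 (@knot R p ell N) p).
Notation dB := (dbspline1 (@knot R p ell N) p).

Definition grid : set R := [set s | exists k : nat, s = k%:R / N%:R].

Lemma gridE : grid = \bigcup_k [set k%:R / N%:R].
Proof.
by apply/seteqP; split => s [k]; [move=> ->; exists k|move=> _ ->; exists k].
Qed.

Lemma measurable_grid : measurable grid.
Proof. by rewrite gridE; apply: bigcupT_measurable => k. Qed.

Lemma leb1_grid : leb1 grid = 0%E.
Proof.
apply: countable_lebesgue_measure0; rewrite gridE.
by apply: bigcup_countable => // k _; exact: countable1.
Qed.

(** All knots lie on the grid, and so does 1, where the last knot interval is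
    closed. *)
Lemma is_derive_B i (s : R) : ~ grid s -> is_derive s 1 (B i) (dB i s).
Proof.
move=> gs; apply: is_derive_bspline1.
  by apply/eqP => s1; apply: gs; exists N; rewrite divff// pnatr_eq0 -lt0n.
move=> j; apply/eqP => js; apply: gs; have [k kE] := @knot_grid R p ell N j.
by exists k; rewrite -js.
Qed.

(** One-dimensional analogue of [cOmega_extension]. *)
Lemma itv_extension (F : R -> R) : {within `[0, 1], continuous F} ->
  continuous (F \o clamp01).
Proof.
move=> /subspace_continuousP cF x.
have cx : `[0, 1]%classic (clamp01 x) by rewrite /= in_itv/= clamp01_in.
move=> A /(cF _ cx) h.
have hx : nbhs (clamp01 x) (fun y => `[0, 1]%classic y -> A (F y)) := h.
have hc : nbhs x (fun y => `[0, 1]%classic (clamp01 y) -> A (F (clamp01 y))) :=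
  continuous_clamp01 hx.
change (nbhs x (fun y => A (F (clamp01 y)))).
by apply: filterS hc => y; apply; rewrite /= in_itv/= clamp01_in.
Qed.

Variables (n : nat) (c : 'I_n -> 'I_n -> R).

Definition spline (x : R * R) : R :=
  \sum_(i < n) \sum_(j < n) c i j * bspline p ell N i j x.

Definition dspline (s : bool) (x : R * R) : R :=
  \sum_(i < n) \sum_(j < n) c i j *
    (if s then B i x.1 * dB j x.2 else dB i x.1 * B j x.2).

Lemma spline_continuous : {within @cOmega R, continuous spline}.
Proof.
apply: (@subspace_eq_continuous _ _ _ (spline \o clamp)).
  by move=> x /[!inE] Ox; rewrite /= clamp_id.
apply: continuous_subspaceT => x.
have cB i : continuous (B i \o clamp01).
  by apply: itv_extension; apply: knot_bspline1_continuous.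
have c1 i : B i (clamp01 y.1) @[y --> x] --> B i (clamp01 x.1).
  by apply: (@continuous_comp _ _ _ fst (B i \o clamp01)); [exact: cvg_fst|exact: cB].
have c2 i : B i (clamp01 y.2) @[y --> x] --> B i (clamp01 x.2).
  by apply: (@continuous_comp _ _ _ snd (B i \o clamp01)); [exact: cvg_snd|exact: cB].
have E : spline \o clamp = (fun y : R * R => \sum_(i < n) \sum_(j < n) c i j *
    (B i (clamp01 y.1) * B j (clamp01 y.2))) by [].
rewrite /continuous_at E.
apply: cvg_big => [|i _]; first exact: add_continuous.
apply: cvg_big => [|j _]; first exact: add_continuous.
by apply: cvgMr; apply: cvgM; [exact: c1|exact: c2].
Qed.

Lemma spline_line_is_derive s (a b : R) : ~ grid a ->
  is_derive a 1 (fun r => spline (flip s (r, b))) (dspline s (flip s (a, b))).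
Proof.
move=> ga.
have E : (fun r => spline (flip s (r, b))) = \sum_(i < n) \sum_(j < n)
  (fun r => c i j * bspline p ell N i j (flip s (r, b))).
  apply/funext => r; rewrite fct_sumE; apply: eq_bigr => i _.
  by rewrite fct_sumE.
rewrite E /dspline; apply: is_derive_sum => i; apply: is_derive_sum => j.
case: (s); rewrite /bspline /flip/=.
  have := is_deriveZ (c i j * B i b) (is_derive_B j ga).
  rewrite /GRing.scale/= -mulrA => h.
  by rewrite (_ : (fun r => _) = (c i j * B i b) \*: B j)//; apply/funext => r; rewrite /= /GRing.scale/= mulrA.
have := is_deriveZ (c i j * B j b) (is_derive_B i ga).
rewrite /GRing.scale/= -mulrA [B j b * _]mulrC => h.
rewrite (_ : (fun r => _) = (c i j * B j b) \*: B i)//.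
by apply/funext => r; rewrite /= /GRing.scale/= -mulrA [B j b * _]mulrC.
Qed.

Lemma measurable_dspline s : measurable_fun setT (dspline s).
Proof.
have m1 (F : R -> R) : measurable_fun setT F -> measurable_fun setT (fun x : R * R => F x.1).
  by move=> mF; apply: measurableT_comp mF _; exact: fst_measurable.
have m2 (F : R -> R) : measurable_fun setT F -> measurable_fun setT (fun x : R * R => F x.2).
  by move=> mF; apply: measurableT_comp mF _; exact: snd_measurable.
have mB i := @measurable_bspline1 R (@knot R p ell N) p i.
have mdB i := @measurable_dbspline1 R (@knot R p ell N) p i.
apply: measurable_sum => i; apply: measurable_sum => j.
apply: measurable_funM => //; case: s; apply: measurable_funM;
  by [apply: m1|apply: m2].
Qed.

Lemma measurable_dspline_line s (b : R) :
  measurable_fun setT (fun r => dspline s (flip s (r, b))).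
Proof.
have mB i := @measurable_bspline1 R (@knot R p ell N) p i.
have mdB i := @measurable_dbspline1 R (@knot R p ell N) p i.
apply: measurable_sum => i; apply: measurable_sum => j.
apply: measurable_funM => //; case: s => /=; by apply: measurable_funM.
Qed.

Lemma spline_mesh_derivable : mesh_derivable grid spline.
Proof.
split.
- exact: spline_continuous.
- move=> s a b _ _ ga; have h := spline_line_is_derive s b ga.
  exact: (@ex_derive _ _ _ _ _ _ _ h).
- move=> i; have [s ->] := axis_cases i.
  apply: (@eq_measurable_fun _ _ _ _ _ (dspline s)).
    move=> x /[!inE] -[_ gx]; rewrite pd_line derive1E.
    have gs : ~ grid (flip s x).1.
      by move=> h; apply: gx; apply/(mesh_flip _ s); left.
    have h := spline_line_is_derive s (flip s x).2 gs.
    by rewrite (@derive_val _ _ _ _ _ _ _ h) -surjective_pairing flipK.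
  by apply: measurable_funTS; exact: measurable_dspline.
- move=> s b _.
  apply: (@eq_measurable_fun _ _ _ _ _ (fun r => dspline s (flip s (r, b)))).
    move=> r /[!inE] -[_ gr]; have h := spline_line_is_derive s b gr.
    by rewrite derive1E (@derive_val _ _ _ _ _ _ _ h).
  by apply: measurable_funTS; exact: measurable_dspline_line.
Qed.

End TensorSplines.

(** * Stability of the geometric integrands *)

Section Closeness.
Context {R : realType} {I : Type}.
Variable d : I -> R.
Hypothesis d0 : forall i, 0 <= d i.
Implicit Types (F G : I -> R).

(** Closeness with a constant that is uniform over the configurations in [I]; a
    congruence for all the operations from which the integrands are built. *)
Definition close F F' : Prop := exists K : R, 0 <= K /\ forall i,
  [/\ `|F i| <= K, `|F' i| <= K & `|F i - F' i| <= K * d i].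

Lemma close_cst (c : R) : close (fun=> c) (fun=> c).
Proof. by exists `|c|; split=> // i; rewrite subrr normr0 mulr_ge0. Qed.

Lemma closeD F F' G G' : close F F' -> close G G' ->
  close (fun i => F i + G i) (fun i => F' i + G' i).
Proof.
move=> [K [K0 hF]] [L [L0 hG]]; exists (K + L); split; first exact: addr_ge0.
move=> i; have [a b c] := hF i; have [a' b' c'] := hG i; split.
- by rewrite (le_trans (ler_normD _ _))// lerD.
- by rewrite (le_trans (ler_normD _ _))// lerD.
- rewrite opprD addrACA mulrDl (le_trans (ler_normD _ _))// lerD//.
Qed.

Lemma closeN F F' : close F F' -> close (fun i => - F i) (fun i => - F' i).
Proof.
move=> [K [K0 hF]]; exists K; split=> // i; have [a b c] := hF i.
by rewrite !normrN -opprD normrN.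
Qed.

Lemma closeM F F' G G' : close F F' -> close G G' ->
  close (fun i => F i * G i) (fun i => F' i * G' i).
Proof.
move=> [K [K0 hF]] [L [L0 hG]]; exists (K * L + K * L); split.
  by rewrite addr_ge0// mulr_ge0.
have KL : K * L <= K * L + K * L by rewrite lerDl mulr_ge0.
move=> i; have [a b c] := hF i; have [a' b' c'] := hG i; split.
- by rewrite normrM (le_trans _ KL)// ler_pM.
- by rewrite normrM (le_trans _ KL)// ler_pM.
- have -> : F i * G i - F' i * G' i = (F i - F' i) * G i + F' i * (G i - G' i) by ring.
  rewrite (le_trans (ler_normD _ _))// !normrM mulrDl lerD//.
    by rewrite mulrAC ler_pM.
  by rewrite -mulrA ler_pM.
Qed.

Lemma closeV F F' (c : R) : 0 < c -> (forall i, c <= F i /\ c <= F' i) ->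
  close F F' -> close (fun i => (F i)^-1) (fun i => (F' i)^-1).
Proof.
move=> c0 cF [K [K0 hF]]; exists (c^-1 + c^-1 * c^-1 * K).
have ci : 0 <= c^-1 by rewrite invr_ge0 ltW.
have t0 : 0 <= c^-1 * c^-1 * K by rewrite !mulr_ge0.
split; first by rewrite addr_ge0.
move=> i; have [a b h] := hF i; have [cF1 cF2] := cF i.
have p1 : 0 < F i by exact: lt_le_trans cF1.
have p2 : 0 < F' i by exact: lt_le_trans cF2.
have v1 : `|(F i)^-1| <= c^-1 by rewrite gtr0_norm ?invr_gt0// lef_pV2.
have v2 : `|(F' i)^-1| <= c^-1 by rewrite gtr0_norm ?invr_gt0// lef_pV2.
split.
- by rewrite (le_trans v1)// lerDl.
- by rewrite (le_trans v2)// lerDl.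
- have -> : (F i)^-1 - (F' i)^-1 = (F i)^-1 * (F' i)^-1 * - (F i - F' i).
    by field; rewrite !gt_eqF.
  rewrite !normrM normrN mulrDl ler_wpDl ?mulr_ge0//.
  rewrite -[X in _ <= X]mulrA.
  by apply: ler_pM; [exact: mulr_ge0|exact: normr_ge0|exact: ler_pM|exact: h].
Qed.

Lemma close_sqrt F F' (c : R) : 0 < c -> (forall i, c <= F i /\ c <= F' i) ->
  close F F' -> close (fun i => Num.sqrt (F i)) (fun i => Num.sqrt (F' i)).
Proof.
move=> c0 cF [K [K0 hF]].
have sc : 0 < Num.sqrt c by rewrite sqrtr_gt0.
have ci : 0 <= (Num.sqrt c)^-1 by rewrite invr_ge0 ltW.
exists (Num.sqrt K + (Num.sqrt c)^-1 * K); split; first by rewrite addr_ge0 ?mulr_ge0// sqrtr_ge0.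
move=> i; have [a b h] := hF i; have [cF1 cF2] := cF i.
have p1 : 0 < F i by exact: lt_le_trans cF1.
have p2 : 0 < F' i by exact: lt_le_trans cF2.
have le1 : 0 <= (Num.sqrt c)^-1 * K by rewrite mulr_ge0.
split.
- rewrite ger0_norm ?sqrtr_ge0// ler_wpDr// ler_sqrt//.
  by rewrite (le_trans _ a)// ler_norm.
- rewrite ger0_norm ?sqrtr_ge0// ler_wpDr// ler_sqrt//.
  by rewrite (le_trans _ b)// ler_norm.
- rewrite mulrDl ler_wpDl ?mulr_ge0 ?sqrtr_ge0//.
  rewrite -mulrA ler_pdivlMl// (le_trans _ h)//.
  have E : F i - F' i = (Num.sqrt (F i) + Num.sqrt (F' i)) * (Num.sqrt (F i) - Num.sqrt (F' i)).
    by rewrite mulrC -subr_sqr !sqr_sqrtr ?ltW.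
  rewrite E normrM ler_wpM2r// ger0_norm ?addr_ge0 ?sqrtr_ge0//.
  apply: (@le_trans _ _ (Num.sqrt (F i))); first by rewrite ler_wsqrtr.
  by rewrite lerDl sqrtr_ge0.
Qed.

Lemma close_sum (J : Type) (r : seq J) (P : pred J) (F F' : J -> I -> R) :
  (forall j, close (F j) (F' j)) ->
  close (fun i => \sum_(j <- r | P j) F j i) (fun i => \sum_(j <- r | P j) F' j i).
Proof.
move=> h; elim: r => [|j r IH].
  have E (H : J -> I -> R) : (fun i => \sum_(j <- [::] | P j) H j i) = fun=> 0.
    by apply/funext => i; rewrite big_nil.
  by rewrite !E; exact: close_cst.
have E (H : J -> I -> R) : (fun i => \sum_(j <- j :: r | P j) H j i) =
    if P j then (fun i => H j i + \sum_(j <- r | P j) H j i)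
    else (fun i => \sum_(j <- r | P j) H j i).
  by apply/funext => i; rewrite big_cons; case: (P j).
by rewrite !E; case: (P j) => //; exact: closeD.
Qed.

Lemma close_prod (J : Type) (r : seq J) (P : pred J) (F F' : J -> I -> R) :
  (forall j, close (F j) (F' j)) ->
  close (fun i => \prod_(j <- r | P j) F j i) (fun i => \prod_(j <- r | P j) F' j i).
Proof.
move=> h; elim: r => [|j r IH].
  have E (H : J -> I -> R) : (fun i => \prod_(j <- [::] | P j) H j i) = fun=> 1.
    by apply/funext => i; rewrite big_nil.
  by rewrite !E; exact: close_cst.
have E (H : J -> I -> R) : (fun i => \prod_(j <- j :: r | P j) H j i) =
    if P j then (fun i => H j i * \prod_(j <- r | P j) H j i)
    else (fun i => \prod_(j <- r | P j) H j i).
  by apply/funext => i; rewrite big_cons; case: (P j).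
by rewrite !E; case: (P j) => //; exact: closeM.
Qed.

Definition mclose m n (A A' : I -> 'M[R]_(m, n)) : Prop :=
  forall a b, close (fun i => A i a b) (fun i => A' i a b).

Lemma mclose_tr m n (A A' : I -> 'M[R]_(m, n)) : mclose A A' ->
  mclose (fun i => (A i)^T) (fun i => (A' i)^T).
Proof.
move=> h a b; have := h b a.
by congr close; apply/funext => i; rewrite mxE.
Qed.

Lemma mclose_add m n (A A' B B' : I -> 'M[R]_(m, n)) : mclose A A' -> mclose B B' ->
  mclose (fun i => A i + B i) (fun i => A' i + B' i).
Proof.
move=> hA hB a b; have := closeD (hA a b) (hB a b).
by congr close; apply/funext => i; rewrite mxE.
Qed.

Lemma mclose_opp m n (A A' : I -> 'M[R]_(m, n)) : mclose A A' ->
  mclose (fun i => - A i) (fun i => - A' i).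
Proof.
move=> hA a b; have := closeN (hA a b).
by congr close; apply/funext => i; rewrite mxE.
Qed.

Lemma mclose_scale m n (F F' : I -> R) (A A' : I -> 'M[R]_(m, n)) :
  close F F' -> mclose A A' ->
  mclose (fun i => F i *: A i) (fun i => F' i *: A' i).
Proof.
move=> hF hA a b; have := closeM hF (hA a b).
by congr close; apply/funext => i; rewrite mxE.
Qed.

Lemma mclose_scalar n (F F' : I -> R) : close F F' ->
  mclose (fun i => (F i)%:M : 'M[R]_n) (fun i => (F' i)%:M : 'M[R]_n).
Proof.
move=> hF a b; have := closeM hF (close_cst (a == b)%:R).
by congr close; apply/funext => i; rewrite mxE mulr_natr.
Qed.

Lemma mclose_mul m n q (A A' : I -> 'M[R]_(m, n)) (B B' : I -> 'M[R]_(n, q)) :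
  mclose A A' -> mclose B B' ->
  mclose (fun i => A i *m B i) (fun i => A' i *m B' i).
Proof.
move=> hA hB a b.
have := @close_sum _ (index_enum 'I_n) xpredT
  (fun j i => A i a j * B i j b) (fun j i => A' i a j * B' i j b)
  (fun j => closeM (hA a j) (hB j b)).
by congr close; apply/funext => i; rewrite mxE.
Qed.

Lemma close_trace n (A A' : I -> 'M[R]_n) : mclose A A' ->
  close (fun i => \tr (A i)) (fun i => \tr (A' i)).
Proof. by move=> h; apply: close_sum => j; exact: h. Qed.

Lemma close_det n (A A' : I -> 'M[R]_n) : mclose A A' ->
  close (fun i => \det (A i)) (fun i => \det (A' i)).
Proof.
move=> h; apply: close_sum => s; apply: closeM; first exact: close_cst.
by apply: close_prod => j; exact: h.
Qed.

Lemma mclose_adj n (A A' : I -> 'M[R]_n) : mclose A A' ->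
  mclose (fun i => \adj (A i)) (fun i => \adj (A' i)).
Proof.
move=> h a b.
have hm : mclose (fun i => row' b (col' a (A i))) (fun i => row' b (col' a (A' i))).
  move=> u v; have := h (lift b u) (lift a v).
  by congr close; apply/funext => i; rewrite !mxE.
have := closeM (close_cst ((-1) ^+ (b + a))) (close_det hm).
by congr close; apply/funext => i; rewrite mxE.
Qed.

Lemma mclose_inv n (A A' : I -> 'M[R]_n) (c : R) : 0 < c ->
  (forall i, c <= \det (A i) /\ c <= \det (A' i)) -> mclose A A' ->
  mclose (fun i => invmx (A i)) (fun i => invmx (A' i)).
Proof.
move=> c0 cA h a b.
have E (B : I -> 'M[R]_n) : (forall i, c <= \det (B i)) ->
    (fun i => invmx (B i) a b) = fun i => ((\det (B i))^-1 *: \adj (B i)) a b.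
  move=> cB; apply/funext => i; rewrite /invmx ifT// unitmxE unitfE gt_eqF//.
  exact: lt_le_trans (cB i).
rewrite !E; [|by move=> i; have [] := cA i|by move=> i; have [] := cA i].
by apply: mclose_scale; [exact: closeV c0 cA (close_det h)|exact: mclose_adj].
Qed.

Lemma mclose_uniform m n (A A' : I -> 'M[R]_(m, n)) : mclose A A' ->
  exists K : R, 0 <= K /\ forall a b i,
  [/\ `|A i a b| <= K, `|A' i a b| <= K & `|A i a b - A' i a b| <= K * d i].
Proof.
move=> h; pose k a b := sval (cid (h a b)).
have k0 a b : 0 <= k a b by rewrite /k; case: cid => K [].
exists (\sum_a \sum_b k a b); split; first by apply: sumr_ge0 => a _; exact: sumr_ge0.
have kle a b : k a b <= \sum_a \sum_b k a b.
  rewrite (bigD1 a)//= (bigD1 b)//= -addrA lerDl addr_ge0//.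
    exact: sumr_ge0.
  by apply: sumr_ge0 => u _; exact: sumr_ge0.
move=> a b i; have : [/\ `|A i a b| <= k a b, `|A' i a b| <= k a b &
    `|A i a b - A' i a b| <= k a b * d i].
  by rewrite /k; case: cid => K [].
move=> [x y z]; split; [exact: le_trans (kle a b)|exact: le_trans (kle a b)|].
by apply: (le_trans z); rewrite ler_wpM2r.
Qed.

End Closeness.

Section Kernels.
Context {R : realType}.
Implicit Types (J W : 'M[R]_(2, 3)).

(** In a parametrisation with Jacobian [J] (one row per parameter), the rows of
    [liftJ J] are the dual tangent basis: a parameter gradient [a] lifts to the
    tangential gradient [a *m liftJ J].  The other kernels are the area element,
    the tangential Jacobian, divergence and operator of a velocity with parameter
    Jacobian [W], and the weighted matrices of the two Dirichlet forms. *)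
Definition gramJ J : 'M[R]_2 := J *m J^T.
Definition areaJ J : R := Num.sqrt (\det (gramJ J)).
Definition liftJ J : 'M[R]_(2, 3) := invmx (gramJ J) *m J.
Definition gradJ J W : 'M[R]_3 := W^T *m liftJ J.
Definition divJ J W : R := \tr (gradJ J W).
Definition BJ J W : 'M[R]_3 := (divJ J W)%:M - (gradJ J W + (gradJ J W)^T).
Definition dirichletJ J : 'M[R]_2 := areaJ J *: (liftJ J *m (liftJ J)^T).
Definition BdirichletJ J W : 'M[R]_2 :=
  areaJ J *: (liftJ J *m BJ J W *m (liftJ J)^T).

(** Two pairs of Jacobians with common bounds, close to each other, with Gram
    determinants bounded below: the parameters over which closeness is uniform.
    Taking them as an index type makes each use of a congruence lemma produce a
    constant that depends only on [M] and [c]. *)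
Record config (M c : R) := Config {
  cfJ : 'M[R]_(2, 3) ; cfJs : 'M[R]_(2, 3) ;
  cfW : 'M[R]_(2, 3) ; cfWs : 'M[R]_(2, 3) ; cfd : R ;
  cfJ_le : forall i k, `|cfJ i k| <= M ;
  cfJs_le : forall i k, `|cfJs i k| <= M ;
  cfW_le : forall i k, `|cfW i k| <= M ;
  cfWs_le : forall i k, `|cfWs i k| <= M ;
  cfJ_close : forall i k, `|cfJ i k - cfJs i k| <= cfd ;
  cfW_close : forall i k, `|cfW i k - cfWs i k| <= cfd ;
  cf_det : c <= \det (gramJ cfJ) /\ c <= \det (gramJ cfJs)
}.

Lemma cfd_ge0 M c (i : config M c) : 0 <= cfd i.
Proof. exact: le_trans (cfJ_close i ord0 ord0). Qed.

Section ConfigClose.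
Variables (M c : R).
Hypotheses (M0 : 0 <= M).
Notation close := (close (@cfd M c)).
Notation mclose := (mclose (@cfd M c)).
Let d0 := @cfd_ge0 M c.

Lemma mclose_cfJ : mclose (@cfJ M c) (@cfJs M c).
Proof.
move=> a b; exists (M + 1); split; first exact: addr_ge0.
have M1 : M <= M + 1 by rewrite lerDl.
move=> i; split.
- exact: le_trans (cfJ_le i a b) M1.
- exact: le_trans (cfJs_le i a b) M1.
- apply: (le_trans (cfJ_close i a b)); rewrite mulrDl mul1r lerDr mulr_ge0//.
Qed.

Lemma mclose_cfW : mclose (@cfW M c) (@cfWs M c).
Proof.
move=> a b; exists (M + 1); split; first exact: addr_ge0.
have M1 : M <= M + 1 by rewrite lerDl.
move=> i; split.
- exact: le_trans (cfW_le i a b) M1.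
- exact: le_trans (cfWs_le i a b) M1.
- apply: (le_trans (cfW_close i a b)); rewrite mulrDl mul1r lerDr mulr_ge0//.
Qed.

Lemma mclose_gram : mclose (fun i => gramJ (cfJ i)) (fun i => gramJ (cfJs i)).
Proof.
apply: mclose_mul => //; first exact: mclose_cfJ.
by apply: mclose_tr; exact: mclose_cfJ.
Qed.

Hypothesis c0 : 0 < c.

Lemma close_area : close (fun i => areaJ (cfJ i)) (fun i => areaJ (cfJs i)).
Proof.
apply: (close_sqrt d0 c0); first by move=> i; exact: cf_det.
exact: close_det d0 _ _ _ mclose_gram.
Qed.

Lemma mclose_lift : mclose (fun i => liftJ (cfJ i)) (fun i => liftJ (cfJs i)).
Proof.
apply: mclose_mul => //; last exact: mclose_cfJ.
apply: (mclose_inv d0 c0); first by move=> i; exact: cf_det.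
exact: mclose_gram.
Qed.

Lemma mclose_grad :
  mclose (fun i => gradJ (cfJ i) (cfW i)) (fun i => gradJ (cfJs i) (cfWs i)).
Proof.
apply: mclose_mul => //; last exact: mclose_lift.
by apply: mclose_tr; exact: mclose_cfW.
Qed.

Lemma close_div :
  close (fun i => divJ (cfJ i) (cfW i)) (fun i => divJ (cfJs i) (cfWs i)).
Proof. exact: close_trace d0 _ _ _ mclose_grad. Qed.

Lemma close_div_area :
  close (fun i => divJ (cfJ i) (cfW i) * areaJ (cfJ i))
    (fun i => divJ (cfJs i) (cfWs i) * areaJ (cfJs i)).
Proof. by apply: closeM => //; [exact: close_div|exact: close_area]. Qed.

Lemma mclose_B :
  mclose (fun i => BJ (cfJ i) (cfW i)) (fun i => BJ (cfJs i) (cfWs i)).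
Proof.
apply: mclose_add => //; first by apply: mclose_scalar => //; exact: close_div.
apply: mclose_opp => //; apply: mclose_add => //; first exact: mclose_grad.
by apply: mclose_tr; exact: mclose_grad.
Qed.

Lemma mclose_dirichlet :
  mclose (fun i => dirichletJ (cfJ i)) (fun i => dirichletJ (cfJs i)).
Proof.
apply: mclose_scale => //; first exact: close_area.
apply: mclose_mul => //; first exact: mclose_lift.
by apply: mclose_tr; exact: mclose_lift.
Qed.

Lemma mclose_Bdirichlet :
  mclose (fun i => BdirichletJ (cfJ i) (cfW i)) (fun i => BdirichletJ (cfJs i) (cfWs i)).
Proof.
apply: mclose_scale => //; first exact: close_area.
apply: mclose_mul => //; last by apply: mclose_tr; exact: mclose_lift.
by apply: mclose_mul => //; [exact: mclose_lift|exact: mclose_B].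
Qed.

End ConfigClose.

End Kernels.

Section KernelBounds.
Context {R : realType}.
Implicit Types (J W : 'M[R]_(2, 3)).

Definition l1 (a : 'rV[R]_2) : R := \sum_(i < 2) `|a ord0 i|.

Lemma l1_ge0 a : 0 <= l1 a.
Proof. by rewrite /l1 sumr_ge0. Qed.

(** Bilinear forms are compared entrywise; [l1] is the norm that makes this free of
    dimensional constants. *)
Lemma bilinear_le (a b : 'rV[R]_2) (K : 'M[R]_2) (e : R) :
  (forall i j, `|K i j| <= e) -> `|(a *m K *m b^T) ord0 ord0| <= e * (l1 a * l1 b).
Proof.
move=> Ke; rewrite mxE (le_trans (ler_norm_sum _ _ _))//.
rewrite /l1 mulr_sumr mulr_sumr ler_sum// => j _.
rewrite normrM [b^T _ _]mxE mulrA ler_wpM2r//.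
rewrite mxE (le_trans (ler_norm_sum _ _ _))// mulr_sumr ler_sum// => i _.
by rewrite normrM mulrC ler_wpM2r.
Qed.

Lemma dot_sum n (u v : 'rV[R]_n) : dot u v = \sum_(k < n) u ord0 k * v ord0 k.
Proof. by rewrite /dot mxE; apply: eq_bigr => k _; rewrite mxE. Qed.

Lemma dot_ge0 n (u : 'rV[R]_n) : 0 <= dot u u.
Proof. by rewrite dot_sum sumr_ge0// => k _; rewrite -expr2 sqr_ge0. Qed.

Lemma enorm_sqr n (u : 'rV[R]_n) : enorm u ^+ 2 = dot u u.
Proof. by rewrite /enorm sqr_sqrtr// dot_ge0. Qed.

Lemma coord_le_enorm n (u : 'rV[R]_n) k : `|u ord0 k| <= enorm u.
Proof.
rewrite -sqrtr_sqr ler_wsqrtr// dot_sum (bigD1 k)//= expr2 lerDl.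
by rewrite sumr_ge0// => j _; rewrite -expr2 sqr_ge0.
Qed.

Lemma liftJ_trK J : \det (gramJ J) != 0 -> liftJ J *m J^T = 1%:M.
Proof.
by move=> h; rewrite /liftJ -mulmxA mulVmx// unitmxE unitfE.
Qed.

(** The lifted vector [u = a *m liftJ J] determines [a = u *m J^T]. *)
Lemma l1_le_enorm (M : R) J (a : 'rV[R]_2) : 0 <= M ->
  (forall i k, `|J i k| <= M) -> \det (gramJ J) != 0 ->
  l1 a <= 6%:R * M * enorm (a *m liftJ J).
Proof.
move=> M0 JM dJ; set u := a *m liftJ J.
have aE : a = u *m J^T by rewrite /u -mulmxA liftJ_trK// mulmx1.
have ai i : `|a ord0 i| <= 3%:R * M * enorm u.
  rewrite {1}aE mxE (le_trans (ler_norm_sum _ _ _))//.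
  apply: (@le_trans _ _ (\sum_(k < 3) M * enorm u)).
    apply: ler_sum => k _; rewrite normrM mulrC [J^T _ _]mxE.
    apply: ler_pM => //; exact: coord_le_enorm.
  by rewrite !big_ord_recl big_ord0; lra.
rewrite /l1 big_ord_recl big_ord1.
by apply: (le_trans (lerD (ai _) (ai _))); rewrite -!mulrDl -natrD.
Qed.

Lemma dirichletE J (a b : 'rV[R]_2) :
  dot (a *m liftJ J) (b *m liftJ J) * areaJ J = (a *m dirichletJ J *m b^T) ord0 ord0.
Proof.
rewrite /dirichletJ /dot -scalemxAr -scalemxAl [RHS]mxE mulrC.
by congr (_ * _); rewrite trmx_mul !mulmxA.
Qed.

Lemma BdirichletE J W (a b : 'rV[R]_2) :
  mdot (a *m liftJ J) (BJ J W) (b *m liftJ J) * areaJ J =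
  (a *m BdirichletJ J W *m b^T) ord0 ord0.
Proof.
rewrite /BdirichletJ /mdot -scalemxAr -scalemxAl [RHS]mxE mulrC.
by congr (_ * _); rewrite trmx_mul !mulmxA.
Qed.

Lemma mx_subE m n (A B : 'M[R]_(m, n)) i j : (A - B) i j = A i j - B i j.
Proof. by rewrite !mxE. Qed.

(** What the integral estimates need to know about the integrands.  In the last
    part, the measure and the Dirichlet density of the second surface dominate
    those of the parameter square. *)
Definition close_kernels (K d : R) (J Js W Ws : 'M[R]_(2, 3)) : Prop :=
  [/\ [/\ `|areaJ J| <= K, `|areaJ Js| <= K & `|areaJ Js - areaJ J| <= K * d],
    [/\ `|divJ J W * areaJ J| <= K, `|divJ Js Ws * areaJ Js| <= K &
        `|divJ Js Ws * areaJ Js - divJ J W * areaJ J| <= K * d],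
    (forall i j, [/\ `|dirichletJ J i j| <= K, `|dirichletJ Js i j| <= K &
       `|(dirichletJ Js - dirichletJ J) i j| <= K * d]),
    (forall i j, [/\ `|BdirichletJ J W i j| <= K, `|BdirichletJ Js Ws i j| <= K &
       `|(BdirichletJ Js Ws - BdirichletJ J W) i j| <= K * d]) &
    1 <= K * areaJ Js /\ forall a, l1 a ^+ 2 <= K * (enorm (a *m liftJ Js) ^+ 2 * areaJ Js)].

(** The kernels are built from the Jacobians by operations that preserve closeness;
    inversion and square root do so because the Gram determinants stay away from
    zero. *)
Lemma kernel_bounds (M c : R) : 0 <= M -> 0 < c -> exists K : R, 1 <= K /\
  forall (J Js W Ws : 'M[R]_(2, 3)) (d : R),
  (forall i k, `|J i k| <= M) -> (forall i k, `|Js i k| <= M) ->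
  (forall i k, `|W i k| <= M) -> (forall i k, `|Ws i k| <= M) ->
  (forall i k, `|J i k - Js i k| <= d) -> (forall i k, `|W i k - Ws i k| <= d) ->
  c <= \det (gramJ J) -> c <= \det (gramJ Js) ->
  close_kernels K d J Js W Ws.
Proof.
move=> M0 c0.
have [K1 [K10 H1]] := close_area M0 c0.
have [K2 [K20 H2]] := close_div_area M0 c0.
have [K3 [K30 H3]] := mclose_uniform (@cfd_ge0 R M c) (mclose_dirichlet M0 c0).
have [K4 [K40 H4]] := mclose_uniform (@cfd_ge0 R M c) (mclose_Bdirichlet M0 c0).
have sc : 0 < Num.sqrt c by rewrite sqrtr_gt0.
have sci : 0 <= (Num.sqrt c)^-1 by rewrite invr_ge0 ltW.
have M6 : 0 <= (6%:R * M) ^+ 2 / Num.sqrt c by rewrite mulr_ge0// sqr_ge0.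
pose K := 1 + K1 + K2 + K3 + K4 + (Num.sqrt c)^-1 + (6%:R * M) ^+ 2 / Num.sqrt c.
have [le1 le2 le3 le4 [le5 le6 le0]] : [/\ K1 <= K, K2 <= K, K3 <= K, K4 <= K &
    [/\ (Num.sqrt c)^-1 <= K, (6%:R * M) ^+ 2 / Num.sqrt c <= K & 1 <= K]].
  by move: M6 sci; rewrite /K; set x := _ / _; set y := _^-1 => *; split; [lra..|split; lra].
exists K; split => // J Js W Ws d hJ hJs hW hWs hJd hWd dJ dJs.
pose i := Config hJ hJs hW hWs hJd hWd (conj dJ dJs).
have d0 : 0 <= d := cfd_ge0 i.
have up (x k : R) : x <= k -> k <= K -> x <= K by exact: le_trans.
have upd (x k : R) : x <= k * d -> k <= K -> x <= K * d.
  by move=> h1 h2; apply: (le_trans h1); rewrite ler_wpM2r.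
have areac : Num.sqrt c <= areaJ Js by rewrite ler_wsqrtr.
split.
- have [a b e] := H1 i; split; [exact: up a le1|exact: up b le1|].
  by rewrite distrC; exact: upd e le1.
- have [a b e] := H2 i; split; [exact: up a le2|exact: up b le2|].
  by rewrite distrC; exact: upd e le2.
- move=> u v; have [a b e] := H3 u v i; split; [exact: up a le3|exact: up b le3|].
  by rewrite mx_subE distrC; exact: upd e le3.
- move=> u v; have [a b e] := H4 u v i; split; [exact: up a le4|exact: up b le4|].
  by rewrite mx_subE distrC; exact: upd e le4.
split.
  rewrite -(mulVf (lt0r_neq0 sc)); apply: ler_pM => //; exact: ltW.
move=> a.
have dJs0 : \det (gramJ Js) != 0 by rewrite gt_eqF// (lt_le_trans c0).
have := l1_le_enorm a M0 hJs dJs0; set u := enorm _ => h.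
have u0 : 0 <= u by exact: sqrtr_ge0.
apply: (@le_trans _ _ ((6%:R * M * u) ^+ 2)).
  by rewrite lerXn2r ?nnegrE ?l1_ge0 ?mulr_ge0.
apply: (@le_trans _ _ ((6%:R * M) ^+ 2 / Num.sqrt c * (u ^+ 2 * areaJ Js))).
  have -> : (6%:R * M) ^+ 2 / Num.sqrt c * (u ^+ 2 * areaJ Js) =
    (6%:R * M * u) ^+ 2 * (areaJ Js / Num.sqrt c) by field; rewrite gt_eqF.
  by rewrite ler_peMr ?sqr_ge0// ler_pdivlMr// mul1r.
apply: ler_wpM2r => //.
by rewrite mulr_ge0 ?sqr_ge0// (le_trans _ areac)// ltW.
Qed.

End KernelBounds.

(** * Time derivatives and quasi-interpolation *)

Section RowVectors.
Context {R : realType} {n : nat}.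
Implicit Types u : 'rV[R]_n.

Lemma coord_le_norm u k : `|u ord0 k| <= `|u|.
Proof.
rewrite [leRHS]/Num.Def.normr/= mx_normrE.
exact: (le_bigmax _ (fun ij => `|u ij.1 ij.2|) (ord0, k)).
Qed.

Lemma norm_le_coord u (e : R) : 0 <= e -> (forall k, `|u ord0 k| <= e) -> `|u| <= e.
Proof.
move=> e0 h; rewrite /Num.Def.normr/= mx_normrE (bigmax_le _ e0)//= => -[i k] _ /=.
by rewrite (ord1 i).
Qed.

Lemma rV_cvg (T : Type) (F : set_system T) (FF : Filter F) (f : T -> 'rV[R]_n)
    (l : 'rV[R]_n) :
  (forall k, f s ord0 k @[s --> F] --> l ord0 k) -> f @ F --> l.
Proof.
move=> h; apply/cvgrPdist_le => e e0; near=> s.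
apply: norm_le_coord; first exact: ltW.
move=> k; rewrite !mxE; move: k; near: s; apply: filter_forall => k.
exact: ((cvgrPdist_le _ _).1 (h k)).
Unshelve. all: by end_near. Qed.

Lemma rV_cvg_coord (T : Type) (F : set_system T) {FF : Filter F} (f : T -> 'rV[R]_n)
    (l : 'rV[R]_n) k :
  f @ F --> l -> f s ord0 k @[s --> F] --> l ord0 k.
Proof.
move=> h; apply: (cvg_comp f (fun u : 'rV[R]_n => u ord0 k) h).
exact: coord_continuous.
Qed.

End RowVectors.

Section OneSidedTime.
Context {R : realType}.
Variable T : R.
Hypothesis T0 : 0 < T.
Notation FT t := (within `[0, T]%classic (t^')).

(** Also at the end points of the time interval, where the derivative is
    one-sided. *)
Lemma within_time_proper (t : R) : 0 <= t <= T -> ProperFilter (FT t).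
Proof.
move=> /andP[t0 tT]; apply: Build_ProperFilter_ex => A [e /= e0 eA].
have [tT'|tT'] := ltP t T.
  exists (t + Num.min (e / 2) (T - t)).
  have m0 : 0 < Num.min (e / 2) (T - t) by rewrite lt_min divr_gt0// subr_gt0.
  apply: eA.
  - rewrite /ball_/= opprD addrA subrr sub0r normrN gtr0_norm// gt_min.
    by rewrite ltr_pdivrMr// ltr_pMr ?ltr1n.
  - by rewrite gt_eqF// ltrDl.
  - rewrite /= in_itv/= addr_ge0// ?(ltW m0)//=.
    by rewrite -lerBrDl ge_min lexx orbT.
have tE : t = T by apply/eqP; rewrite eq_le tT.
exists (t - Num.min (e / 2) t).
have m0 : 0 < Num.min (e / 2) t by rewrite lt_min divr_gt0// tE.
apply: eA.
- rewrite /ball_/= opprB addrC subrK gtr0_norm// gt_min.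
  by rewrite ltr_pdivrMr// ltr_pMr ?ltr1n.
- by rewrite lt_eqF// ltrBlDr ltrDl.
- rewrite /= in_itv/= subr_ge0 ge_min lexx orbT/=.
  by rewrite (le_trans _ tT)// gerBl ltW.
Qed.

(** Dominated convergence is a statement on sequences; it gives limits along the
    time filter through this criterion. *)
Lemma cvg_time_seq (g : R -> R) (t l : R) :
  (forall u : nat -> R, (forall n, 0 <= u n <= T /\ u n != t) ->
     u n @[n --> \oo] --> t -> g (u n) @[n --> \oo] --> l) ->
  g @ FT t --> l.
Proof.
move=> H; apply/cvgrPdist_le => e e0; apply: contrapT => nH.
have ex n : exists s, [/\ 0 <= s <= T, s != t, `|t - s| < n.+1%:R^-1 & e < `|l - g s|].
  apply: contrapT => ns; apply: nH; rewrite near_withinE.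
  exists n.+1%:R^-1 => /=; first by rewrite invr_gt0.
  move=> s /= ts st; rewrite in_itv/= => sT; rewrite leNgt; apply/negP => es.
  by apply: ns; exists s.
have [u uP] := choice ex.
have ut : u n @[n --> \oo] --> t.
  apply/cvgrPdist_lt => d d0; near=> n; have [_ _ h _] := uP n.
  apply: (lt_trans h); near: n.
  exact: near_infty_natSinv_lt (PosNum d0).
have u1 n : 0 <= u n <= T /\ u n != t by have [] := uP n.
have := H u u1 ut => /cvgrPdist_le/(_ _ e0)[n _ /(_ n (leqnn n))].
by have [_ _ _] := uP n; rewrite ltNge => /negP.
Unshelve. all: by end_near. Qed.

Lemma quotient_local (F : R -> R) (s l : R) :
  (r - s)^-1 * (F r - F s) @[r --> FT s] --> l ->
  forall e, 0 < e -> exists2 d, 0 < d & forall r, 0 <= r <= T -> `|r - s| < d ->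
    `|F r - F s - (r - s) * l| <= e * `|r - s|.
Proof.
move=> /cvgrPdist_le C e e0; have := C _ e0; rewrite near_withinE => -[d /= d0 dP].
exists d => // r rT rs; have [->|rns] := eqVneq r s.
  by rewrite !subrr mul0r subr0 normr0 mulr0.
have := dP r; rewrite /ball_/= distrC in_itv/= => /(_ rs rns rT).
have rs0 : r - s != 0 by rewrite subr_eq0.
have -> : F r - F s - (r - s) * l = - ((r - s) * (l - (r - s)^-1 * (F r - F s))) by field.
by move=> h; rewrite normrN normrM mulrC; exact: ler_wpM2r.
Qed.

(** The mean value theorem for a function that has a derivative relative to the
    interval, one-sided at its end points. *)
Lemma time_lipschitz (F td : R -> R) (M : R) :
  (forall s, 0 <= s <= T -> (r - s)^-1 * (F r - F s) @[r --> FT s] --> td s) ->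
  (forall s, 0 <= s <= T -> `|td s| <= M) ->
  forall a b, 0 <= a <= T -> 0 <= b <= T -> `|F b - F a| <= M * `|b - a|.
Proof.
move=> C tM a b.
wlog ab : a b / a < b.
  move=> H aT bT; have [ab|] := ltP a b; first exact: H.
  rewrite le_eqVlt => /predU1P[->|ab]; first by rewrite !subrr normr0 mulr0.
  by rewrite distrC [`|b - a|]distrC; exact: H.
move=> /andP[a0 aT] /andP[b0 bT].
have inT s : a <= s <= b -> 0 <= s <= T.
  by move=> /andP[h1 h2]; rewrite (le_trans a0)// (le_trans h2).
have cF : {within `[a, b], continuous F}.
  apply/subspace_continuousP => s; rewrite /= in_itv/= => sab.
  apply/cvgrPdist_le => e e0; rewrite near_withinE.
  have [d d0 dP] := quotient_local (C s (inT s sab)) ltr01.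
  pose K := 1 + `|td s|; have K0 : 0 < K by rewrite ltr_wpDr.
  have dm0 : 0 < Num.min d (e / K) by rewrite lt_min d0 divr_gt0.
  apply/nbhs_ballP; exists (Num.min d (e / K)) => //= r.
  rewrite /ball/= lt_min => /andP[rd re].
  rewrite in_itv/= => rab; rewrite distrC.
  have rd' : `|r - s| < d by rewrite distrC.
  have := dP r (inT r rab) rd'; rewrite mul1r => h.
  have -> : F r - F s = (F r - F s - (r - s) * td s) + (r - s) * td s by rewrite subrK.
  apply: (le_trans (ler_normD _ _)); apply: (le_trans (lerD h (lexx _))).
  rewrite normrM -[X in X + _]mulr1 -mulrDr -/K.
  by rewrite -ler_pdivlMr// distrC ltW.
have dF s : s \in `]a, b[%R -> is_derive s 1 F (td s).
  rewrite in_itv/= => /andP[as_ sb]; apply: is_derive_eps => e e0.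
  have sT : 0 <= s <= T by apply: inT; rewrite !ltW.
  have [d d0 dP] := quotient_local (C s sT) e0.
  near=> h.
  have hd : `|h| < d by near: h; exact: near0_norm_lt.
  have h1 : `|h| < s - a by near: h; apply: near0_norm_lt; rewrite subr_gt0.
  have h2 : `|h| < b - s by near: h; apply: near0_norm_lt; rewrite subr_gt0.
  have hT : 0 <= h + s <= T.
    apply: inT; move: h1 h2; rewrite !ltr_norml => /andP[h1 _] /andP[_ h2].
    by apply/andP; split; lra.
  by have := dP (h + s) hT; rewrite addrK; exact.
have [c cab ->] := MVT ab dF cF.
rewrite normrM ler_wpM2r// tM// inT//.
by move: cab; rewrite in_itv/= => /andP[/ltW -> /ltW ->].
Unshelve. all: by end_near. Qed.

End OneSidedTime.

Section TimeDerivative.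
Context {R : realType}.
Variables (p : nat) (M kappa T : R) (X : R -> R * R -> 'rV[R]_3).
Hypotheses (T0 : 0 < T) (es : evolving_surface p M kappa T X).
Notation FT t := (within `[0, T]%classic (t^')).
Notation tdX := (time_deriv T X).

Lemma coord_within_continuous (f : R * R -> 'rV[R]_3) k :
  {within @cOmega R, continuous f} ->
  {within @cOmega R, continuous (fun x => f x ord0 k)}.
Proof.
move=> cf x; have := cf x => h.
exact: (@continuous_comp _ _ _ (f : subspace (@cOmega R) -> _)
  (fun u : 'rV[R]_3 => u ord0 k) x h (@coord_continuous _ _ _ ord0 k _)).
Qed.

Lemma sob_norm_coord k (f : R * R -> 'rV[R]_3) (i : 'I_3) :
  (vsob_norm k +oo f <= M%:E)%E -> (sob_norm k +oo (fun x => f x ord0 i) <= M%:E)%E.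
Proof.
apply: le_trans; rewrite /vsob_norm (bigD1 i)//= leeDl// sume_ge0// => j _.
apply: le_ereal_inf_tmp => _ [D [_ _ ->]].
by apply: sume_ge0 => a _; apply: sume_ge0 => b _; exact: Lnorm_ge0.
Qed.

Lemma time_quot_cvg t x k : 0 <= t <= T -> @cOmega R x ->
  (s - t)^-1 * (X s x ord0 k - X t x ord0 k) @[s --> FT t] --> tdX t x ord0 k.
Proof.
move=> tT Ox; have PF := within_time_proper T0 tT.
have C : time_quot X t x @ FT t --> tdX t x := es_derivable es tT Ox.
have Ck := rV_cvg_coord (k:=k) C.
rewrite (_ : (fun s => _) = (fun s => time_quot X t x s ord0 k)); first exact: Ck.
by apply/funext => s; rewrite /time_quot !mxE.
Qed.

(** The difference quotients in time are dominated by [M]: the velocity is bounded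
    by its Sobolev norm, and the quotients by the velocity. *)
Lemma time_deriv_le t x k : 0 <= t <= T -> @cOmega R x -> `|tdX t x ord0 k| <= M.
Proof.
move=> tT Ox; have [cX _ _] := es_dt_smooth es tT.
have cXk := coord_within_continuous (k:=k) cX.
have sXk := sob_norm_coord k (es_dt_sob es tT).
exact: (sob_norm_value_cOmega cXk sXk Ox).
Qed.

Lemma time_quot_le s t x k : 0 <= s <= T -> 0 <= t <= T -> @cOmega R x ->
  `|(s - t)^-1 * (X s x ord0 k - X t x ord0 k)| <= M.
Proof.
move=> sT tT Ox.
have h := @time_lipschitz R T (fun s => X s x ord0 k) (fun s => tdX s x ord0 k) M
  (fun s sT => time_quot_cvg (k:=k) sT Ox) (fun s sT => time_deriv_le k sT Ox) t s tT sT.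
have M0 : 0 <= M by apply: le_trans (time_deriv_le k tT Ox).
have [->|st] := eqVneq s t; first by rewrite !subrr mulr0 normr0.
by rewrite normrM normfV ler_pdivrMl ?normr_gt0 ?subr_eq0// mulrC.
Qed.

Variables (ell : nat) (Q : quasi_interpolant R p ell).
Variable N : nat.
Notation qf i j := (qi_functional (qi_dom Q N i j) (qi_weight Q N i j)).

Lemma qi_integrable i j (f : R * R -> R) : {within @cOmega R, continuous f} ->
  (@leb2 R).-integrable (qi_dom Q N i j) (EFin \o (fun x => f x * qi_weight Q N i j x)).
Proof.
move=> cf; have [mI IO] := qi_dom_measurable Q N i j.
have [mw [B wB]] := qi_weight_bounded Q N i j.
have [C [C0 fC]] := cOmega_bounded cf.
apply: (@bounded_Omega_integrable _ _ _ (C * B)) => //.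
  by apply: measurable_funM => //; apply: measurable_funS (cOmega_measurable cf) => //; exact: measurable_Omega.
move=> x Ix; rewrite normrM ler_pM// ?wB// fC//.
by apply/sub_Omega/IO.
Qed.

(** Dominated convergence in the dual functionals. *)
Lemma qi_functional_time_cvg i j k t : 0 <= t <= T ->
  qf i j (fun y => (s - t)^-1 * (X s y ord0 k - X t y ord0 k)) @[s --> FT t] -->
  qf i j (fun y => tdX t y ord0 k).
Proof.
move=> tT; apply: cvg_time_seq => u uP ut.
have [mI IO] := qi_dom_measurable Q N i j.
have [mw [B wB]] := qi_weight_bounded Q N i j.
have cX s : 0 <= s <= T -> {within @cOmega R, continuous (fun x => X s x ord0 k)}.
  by move=> sT; have [cX _ _] := es_smooth es sT; exact: coord_within_continuous.
have ctd : {within @cOmega R, continuous (fun x => tdX t x ord0 k)}.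
  by have [ctd _ _] := es_dt_smooth es tT; exact: coord_within_continuous.
have mX s : 0 <= s <= T -> measurable_fun (qi_dom Q N i j) (fun x => X s x ord0 k).
  by move=> sT; apply: measurable_funS (cOmega_measurable (cX s sT)) => //; exact: measurable_Omega.
have mtd : measurable_fun (qi_dom Q N i j) (fun x => tdX t x ord0 k).
  by apply: measurable_funS (cOmega_measurable ctd) => //; exact: measurable_Omega.
pose f n x := ((u n - t)^-1 * (X (u n) x ord0 k - X t x ord0 k)) * qi_weight Q N i j x.
pose f0 x := tdX t x ord0 k * qi_weight Q N i j x.
have mf n : measurable_fun (qi_dom Q N i j) (f n).
  apply: measurable_funM => //; apply: measurable_funM => //.
  apply: measurable_funB; apply: mX => //; exact: (uP n).1.
have mf0 : measurable_fun (qi_dom Q N i j) f0 by exact: measurable_funM.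
have ig : (@leb2 R).-integrable (qi_dom Q N i j) (EFin \o (fun=> `|M| * `|B|)).
  apply: (@bounded_Omega_integrable _ _ _ (`| (`|M| * `|B|) |)) => //.

have Ex : forall x, qi_dom Q N i j x -> f n x @[n --> \oo] --> f0 x.
  move=> x Ix; apply: cvgMl.
  have Ox := sub_Omega (IO _ Ix).
  have C := time_quot_cvg (k:=k) tT Ox.
  apply: (cvg_comp u (fun s => (s - t)^-1 * (X s x ord0 k - X t x ord0 k)) _ C).
  move=> A [e /= e0 eA].
  have [m _ mP] := (cvgrPdist_lt _ _).1 ut _ e0.
  exists m => // n /= mn; have [/= uT unt] := uP n.
  by apply: eA => //=; rewrite ?in_itv//; exact: mP.
have fB n x : qi_dom Q N i j x -> `|f n x| <= `|M| * `|B|.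
  move=> Ix; rewrite /f normrM ler_pM//.
    apply: (le_trans (time_quot_le k (uP n).1 tT (sub_Omega (IO _ Ix)))).
    exact: ler_norm.
  by apply: (le_trans (wB _ Ix)); exact: ler_norm.
have f_cvg : {ae @leb2 R, forall x, qi_dom Q N i j x ->
    (EFin \o f n) x @[n --> \oo] --> (EFin \o f0) x}.
  by apply: aeW => x Ix; apply: cvg_EFin; [exact: nearW|exact: Ex].
have f_dom : {ae @leb2 R, forall x n, qi_dom Q N i j x ->
    (`|(EFin \o f n) x| <= (EFin \o (fun=> `|M| * `|B|)%R) x)%E}.
  by apply: aeW => x n Ix; rewrite /= lee_fin fB.
have mEf n : measurable_fun (qi_dom Q N i j) (EFin \o f n) by exact/measurable_EFinP.
have mEf0 : measurable_fun (qi_dom Q N i j) (EFin \o f0) by exact/measurable_EFinP.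
have [if0 _ D] := @dominated_convergence _ _ R (@leb2 R) (qi_dom Q N i j) mI
  (fun n => EFin \o f n) (EFin \o f0) _ mEf mEf0 f_cvg ig f_dom.
apply: (@fine_cvg _ _ _ _ (fun n => (\int[@leb2 R]_(x in qi_dom Q N i j) (f n x)%:E)%E)).
rewrite /qi_functional /Rintegral fineK; first exact: D.
by have := @integrable_fin_num _ _ _ (@leb2 R) _ mI (EFin \o f0) if0.
Qed.

Lemma qi_functionalZB i j (c : R) (f g : R * R -> R) :
  {within @cOmega R, continuous f} -> {within @cOmega R, continuous g} ->
  qf i j (fun y => c * (f y - g y)) = c * (qf i j f - qf i j g).
Proof.
move=> cf cg; have [mI _] := qi_dom_measurable Q N i j.
have i1 := qi_integrable i j cf; have i2 := qi_integrable i j cg.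
rewrite /qi_functional -RintegralB// -RintegralZl//; last exact: RintegrableB.
by apply: eq_Rintegral => x _; rewrite -mulrBl mulrA.
Qed.

(** The interpolant depends on its argument through the dual functionals only, so
    the velocity of the interpolated surface is the interpolated velocity. *)
Lemma time_deriv_qinterp t x : 0 <= t <= T ->
  time_deriv T (fun s => qinterp Q N (X s)) t x = qinterp Q N (tdX t) x.
Proof.
move=> tT; have PF := within_time_proper T0 tT.
apply/cvg_lim => //; apply: rV_cvg => k.
rewrite /qinterp mxE.
have E : (fun s => (qi_sum p ell (qi_dom Q) (qi_weight Q) N
      (fun y => (time_quot X t y s) ord0 k) x)) @ FT t -->
    qi_sum p ell (qi_dom Q) (qi_weight Q) N (fun y => tdX t y ord0 k) x.
  rewrite /qi_sum; apply: cvg_big => [|i _]; first exact: add_continuous.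
  apply: cvg_big => [|j _]; first exact: add_continuous.
  apply: cvgMl; have := @qi_functional_time_cvg i j k t tT.
  apply: cvg_trans; apply: near_eq_cvg; apply: nearW => s.
  by congr qi_functional; apply/funext => y; rewrite /time_quot !mxE.
apply: cvg_trans E; apply: near_eq_cvg; rewrite near_withinE.
apply: nearW => s /= sT; rewrite in_itv/= in sT.
rewrite /time_quot !mxE /qi_sum -sumrB mulr_sumr; apply: eq_bigr => i _.
rewrite -sumrB mulr_sumr; apply: eq_bigr => j _.
rewrite -mulrBl [RHS]mulrA -qi_functionalZB//.
- by congr (qi_functional _ _ _ * _); apply/funext => y; rewrite !mxE.
- by have [cX _ _] := es_smooth es sT; exact: coord_within_continuous.
- by have [cX _ _] := es_smooth es tT; exact: coord_within_continuous.
Unshelve. all: by end_near. Qed.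

End TimeDerivative.

(** * Immersions and bi-Lipschitz maps *)

Section Immersions.
Context {R : realType}.
Implicit Types (J : 'M[R]_(2, 3)).

Lemma sqr_norm_le_dot n (u : 'rV[R]_n) : `|u| ^+ 2 <= dot u u.
Proof.
rewrite -enorm_sqr lerXn2r ?nnegrE ?sqrtr_ge0//.
by apply: norm_le_coord; [exact: sqrtr_ge0|exact: coord_le_enorm].
Qed.

Lemma norm_le_enorm n (u : 'rV[R]_n) : `|u| <= enorm u.
Proof. by apply: norm_le_coord; [exact: sqrtr_ge0|exact: coord_le_enorm]. Qed.

Lemma sum2 (F : 'I_2 -> R) : \sum_(i < 2) F i = F ord0 + F ord_max.
Proof.
rewrite big_ord_recl big_ord1; congr (_ + F _); exact: val_inj.
Qed.

Lemma det2E (A : 'M[R]_2) :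
  \det A = A ord0 ord0 * A ord_max ord_max - A ord0 ord_max * A ord_max ord0.
Proof.
have l0 : lift ord0 ord0 = ord_max :> 'I_2 by exact: val_inj.
have l1 : lift ord_max ord0 = ord0 :> 'I_2 by exact: val_inj.
rewrite (expand_det_row _ ord0) sum2 /cofactor !det_mx11 !mxE l0 l1 /=.
by rewrite addn0 expr0 add0n expr1 mul1r mulN1r mulrN.
Qed.

Lemma gram_sym J i j : gramJ J i j = gramJ J j i.
Proof. by rewrite !mxE; apply: eq_bigr => k _; rewrite !mxE mulrC. Qed.

(** A quantitative form of [J] having full rank, for the norms in which the
    diffeomorphism bound on the surface is stated. *)
Definition immersed (k : R) J := forall a : 'rV[R]_2, `|a| <= k * `|a *m J|.

Lemma immersed_coord k J (a : 'rV[R]_2) i : 0 < k -> immersed k J ->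
  k^-1 ^+ 2 * a ord0 i ^+ 2 <=
  gramJ J ord0 ord0 * a ord0 ord0 ^+ 2
  + (gramJ J ord0 ord_max * a ord0 ord0 * a ord0 ord_max) *+ 2
  + gramJ J ord_max ord_max * a ord0 ord_max ^+ 2.
Proof.
move=> k0 iJ.
have gs := gram_sym J ord_max ord0.
have -> : gramJ J ord0 ord0 * a ord0 ord0 ^+ 2
  + (gramJ J ord0 ord_max * a ord0 ord0 * a ord0 ord_max) *+ 2
  + gramJ J ord_max ord_max * a ord0 ord_max ^+ 2 = dot (a *m J) (a *m J).
  rewrite /dot trmx_mul mulmxA -(mulmxA a) -/(gramJ J).
  by move: (gramJ J) gs => g gs; rewrite [RHS]mxE sum2 !mxE !sum2 gs; ring.
apply: le_trans (sqr_norm_le_dot _).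
rewrite -exprMn; apply: le_trans (ler_norm _) _; rewrite normrX.
rewrite lerXn2r ?nnegrE//.
rewrite normrM gtr0_norm ?invr_gt0// ler_pdivrMl//.
by apply: le_trans (iJ a); exact: coord_le_norm.
Qed.

(** An immersion that shrinks lengths at most by the factor [k] shrinks areas
    at most by [k ^ 2]: the quadratic form of the Gram matrix is tested with a
    coordinate vector and with a vector conjugate to it. *)
Lemma det_gram_ge k J : 0 < k -> immersed k J -> k^-1 ^+ 4 <= \det (gramJ J).
Proof.
move=> k0 iJ; have gs := gram_sym J ord_max ord0.
rewrite det2E gs.
set A := gramJ J ord0 ord0; set B := gramJ J ord0 ord_max; set C := gramJ J _ _.
pose v (x y : R) : 'rV[R]_2 := \row_i if i == ord0 then x else y.
have v0 x y : v x y ord0 ord0 = x by rewrite mxE.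
have v1 x y : v x y ord0 ord_max = y by rewrite mxE.
have := @immersed_coord k J (v 1 0) ord0 k0 iJ; rewrite !v0 !v1 -/A -/B -/C.
(* [(- B, A)] is conjugate to the first coordinate vector. *)
have := @immersed_coord k J (v (- B) A) ord_max k0 iJ; rewrite !v0 !v1 -/A -/B -/C.
set m := k^-1 ^+ 2.
have m0 : 0 < m by rewrite exprn_gt0// invr_gt0.
rewrite (_ : k^-1 ^+ 4 = m ^+ 2); last by rewrite -exprM.
move=> h1 h2.
have Am : m <= A by lra.
have A0 : 0 < A by exact: lt_le_trans Am.
have h : m * A <= A * C - B * B.
  by rewrite -(ler_pM2l A0); move: h1; rewrite -subr_ge0 => h1; rewrite -subr_ge0; lra.
by apply: le_trans h; rewrite expr2 ler_pM2l.
Qed.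

(** Because [4 * k * e <= 1], the perturbation costs at most half of the norm of
    [a], which the left-hand side absorbs. *)
Lemma immersed_perturb (k e : R) J (Js : 'M[R]_(2, 3)) : 0 < k -> immersed k J ->
  (forall i j, `|J i j - Js i j| <= e) -> 4%:R * k * e <= 1 ->
  immersed (2%:R * k) Js.
Proof.
move=> k0 iJ JJs ke a.
have e0 : 0 <= e := le_trans (normr_ge0 _) (JJs ord0 ord0).
have h : `|a *m J - a *m Js| <= 2%:R * e * `|a|.
  rewrite -mulmxBr; apply: norm_le_coord; first by rewrite !mulr_ge0.
  move=> j; rewrite mxE sum2 (le_trans (ler_normD _ _))// !normrM.
  have hi i : `|a ord0 i| * `|(J - Js) i j| <= `|a| * e.
    by apply: ler_pM => //; [exact: coord_le_norm|rewrite !mxE].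
  by apply: (le_trans (lerD (hi _) (hi _))); rewrite le_eqVlt; apply/orP; left; apply/eqP; ring.
have h2 : `|a *m J| <= `|a *m Js| + 2%:R * e * `|a|.
  by rewrite -[a *m J](subrK (a *m Js)) addrC (le_trans (ler_normD _ _))// lerD2l.
have := iJ a => h3.
have h4 : `|a| <= k * `|a *m Js| + 2%:R * k * e * `|a|.
  apply: (le_trans h3); rewrite (le_trans (ler_wpM2l (ltW k0) h2))//.
  by rewrite le_eqVlt; apply/orP; left; apply/eqP; ring.
have h5 : 4%:R * k * e * `|a| <= `|a| by rewrite ler_piMl.
have a0 := normr_ge0 a.
lra.
Qed.

(** The difference of the squared lengths, divided by the sum of the lengths. *)
Lemma enorm_close n (u v : 'rV[R]_n) (M c d : R) : 0 <= M -> 0 < c ->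
  (forall k, `|u ord0 k| <= M) -> (forall k, `|v ord0 k| <= M) ->
  (forall k, `|u ord0 k - v ord0 k| <= d) -> c <= enorm v ->
  `|enorm u - enorm v| <= n%:R * 2%:R * M / c * d.
Proof.
move=> M0 c0 uM vM uv cv.
have u0 : 0 <= enorm u by exact: sqrtr_ge0.
have s0 : 0 < enorm u + enorm v by rewrite (lt_le_trans c0)// ler_wpDl.
have E : (enorm u - enorm v) * (enorm u + enorm v) =
    \sum_(k < n) (u ord0 k - v ord0 k) * (u ord0 k + v ord0 k).
  rewrite -subr_sqr !enorm_sqr !dot_sum -sumrB; apply: eq_bigr => k _; ring.
have h : `|enorm u - enorm v| * (enorm u + enorm v) <= n%:R * (d * (M + M)).
  rewrite -[X in _ * X]gtr0_norm// -normrM E (le_trans (ler_norm_sum _ _ _))//.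
  rewrite mulr_natl -[X in _ *+ X]card_ord -sumr_const ler_sum// => k _.
  rewrite normrM ler_pM// (le_trans (ler_normD _ _))// lerD//.
have h2 : `|enorm u - enorm v| * c <= n%:R * (d * (M + M)).
  by apply: le_trans h; rewrite ler_wpM2l// (le_trans cv)// lerDr.
have -> : n%:R * 2%:R * M / c * d = n%:R * (d * (M + M)) / c by field; rewrite gt_eqF.
by rewrite ler_pdivlMr.
Qed.

End Immersions.

Section LowerBounds.
Context {R : realType}.

(** Passing to the limit in difference quotients. *)
Lemma derive_norm_ge (V W : normedModType R) (f : V -> W) (x v : V) (b : R) :
  derivable f x v ->
  (\forall h \near (0 : R), b * `|h| <= `|f (h *: v + x) - f x|) ->
  b <= `|'D_v f x|.
Proof.
move=> /cvg_norm C H; apply: (cvgr_to_ge C); near=> h.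
have hn0 : h != 0 by near: h; exact: nbhs_dnbhs_neq.
rewrite normrZ normfV ler_pdivlMl ?normr_gt0// mulrC.
by near: h; exact: nbhs_dnbhs.
Unshelve. all: by end_near. Qed.

Lemma inv_paramK (Y : R * R -> 'rV[R]_3) x :
  (forall x y, @cOmega R x -> @cOmega R y -> Y x = Y y -> x = y) ->
  @cOmega R x -> inv_param Y (Y x) = x.
Proof.
move=> iY Ox; apply: pinvKV; last by rewrite inE.
by move=> u v /[!inE] Ou Ov; exact: iY.
Qed.

Lemma near_line_Omega (x v : R * R) : @Omega R x ->
  \forall h \near (0 : R), @Omega R (h *: v + x).
Proof.
move=> Ox.
have C : (fun h : R => h *: v + x) @ (0 : R) --> (0 : R) *: v + x.
  by apply: cvgD; [apply: cvgZ; [exact: cvg_id|exact: cvg_cst]|exact: cvg_cst].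
by apply: C; rewrite scale0r add0r; exact: open_nbhs_nbhs (conj open_Omega Ox).
Qed.

(** The Lipschitz bound of the inverse passes to the derivative. *)
Lemma immersed_jac (k : R) (Y : R * R -> 'rV[R]_3) x : 0 < k ->
  (forall y z, @cOmega R y -> @cOmega R z -> `|y - z| <= k * `|Y y - Y z|) ->
  @Omega R x -> differentiable Y x -> immersed k (jac Y x).
Proof.
move=> k0 kY Ox dY a.
pose v : R * R := a ord0 ord0 *: dir R ord0 + a ord0 ord_max *: dir R ord_max.
have vE : v = (a ord0 ord0, a ord0 ord_max).
  rewrite /v /dir/= [LHS]surjective_pairing/=.
  by rewrite /GRing.scale/= !mulr1 !mulr0 addr0 add0r.
have aJ : a *m jac Y x = 'D_v Y x.
  rewrite deriveE// /v linearD !linearZ /= -!deriveE//.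
  have jE i j : jac Y x i j = pd i Y x ord0 j by rewrite mxE.
  apply/rowP => j; rewrite [LHS]mxE sum2 !jE [RHS]mxE.
  by congr (_ + _); rewrite [RHS]mxE.
rewrite aJ -ler_pdivrMl//.
apply: (@le_trans _ _ (k^-1 * `|v|)).
  rewrite ler_wpM2l ?invr_ge0 ?(ltW k0)//; apply: norm_le_coord => // i.
  rewrite prod_normE vE /= le_max; have [s ->] := axis_cases i.
  by case: s; rewrite lexx ?orbT.
apply: derive_norm_ge; first exact: diff_derivable.
near=> h.
have Oh : @Omega R (h *: v + x) by near: h; exact: near_line_Omega.
have := kY _ _ (sub_Omega Oh) (sub_Omega Ox); rewrite addrK normrZ => hh.
by rewrite -mulrA ler_pdivrMl// mulrC.
Unshelve. all: by end_near. Qed.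

(** The edges of the square are the lines with [c = 0] and [c = 1]. *)
Definition line (s : bool) (c r : R) : R * R := flip s (r, c).

Lemma line_cOmega s c r : 0 <= r <= 1 -> 0 <= c <= 1 -> @cOmega R (line s c r).
Proof. by case: s. Qed.

Lemma near_line_cOmega s c a : 0 < a < 1 -> 0 <= c <= 1 ->
  \forall h \near (0 : R), @cOmega R (line s c (h + a)).
Proof.
move=> /andP[a0 a1] c01; near=> h.
have h1 : `|h| < a by near: h; exact: near0_norm_lt.
have h2 : `|h| < 1 - a by near: h; apply: near0_norm_lt; rewrite subr_gt0.
apply: line_cOmega => //; move: h1 h2; rewrite !ltr_norml => /andP[? ?] /andP[? ?].
by apply/andP; split; lra.
Unshelve. all: by end_near. Qed.

Lemma line_norm s c (r r' : R) : `|line s c r - line s c r'| = `|r - r'|.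
Proof.
rewrite prod_normE /line; case: s => /=; rewrite subrr normr0.
  by rewrite max_r.
by rewrite max_l.
Qed.

Lemma line_speed_ge (k : R) (Y : R * R -> 'rV[R]_3) s c a : 0 < k ->
  (forall y z, @cOmega R y -> @cOmega R z -> `|y - z| <= k * `|Y y - Y z|) ->
  0 < a < 1 -> 0 <= c <= 1 -> derivable (Y \o line s c) a 1 ->
  k^-1 <= `|derive1 (Y \o line s c) a|.
Proof.
move=> k0 kY a01 c01 dY; rewrite derive1E; apply: derive_norm_ge => //.
have Oa : @cOmega R (line s c a).
  by have /andP[a0 a1] := a01; apply: line_cOmega => //; rewrite !ltW.
near=> h.
have Oh : @cOmega R (line s c (h + a)) by near: h; exact: near_line_cOmega.
have := kY _ _ Oh Oa; rewrite line_norm addrK /GRing.scale/= mulr1 => hh.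
by rewrite ler_pdivrMl.
Unshelve. all: by end_near. Qed.

Definition lip (B : R) (f : R * R -> R) : Prop :=
  forall x y, @cOmega R x -> @cOmega R y ->
  `|f x - f y| <= B * (`|x.1 - y.1| + `|x.2 - y.2|).

Lemma line_derive_le (B : R) (f : R * R -> R) s c a : lip B f ->
  0 < a < 1 -> 0 <= c <= 1 -> derivable (f \o line s c) a 1 ->
  `|derive1 (f \o line s c) a| <= B.
Proof.
move=> fB a01 c01 df; apply: derive1_le => //.
have Oa : @cOmega R (line s c a).
  by have /andP[a0 a1] := a01; apply: line_cOmega => //; rewrite !ltW.
near=> h.
have Oh : @cOmega R (line s c (h + a)) by near: h; exact: near_line_cOmega.
apply: (le_trans (fB _ _ Oh Oa)).
by case: (s) => /=; rewrite subrr normr0 ?add0r ?addr0 addrK.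
Unshelve. all: by end_near. Qed.

End LowerBounds.

Section MeshDerivableMaps.
Context {R : realType}.
Variable G : set R.
Implicit Types (F : R * R -> 'rV[R]_3).

Definition mesh_derivable_map F := forall k, mesh_derivable G (fun x => F x ord0 k).

Lemma mesh_derivable_map_line F s c a : mesh_derivable_map F -> 0 < a < 1 -> 0 <= c <= 1 -> ~ G a ->
  derivable (F \o line s c) a 1 /\
  forall k, derive1 (F \o line s c) a ord0 k
            = derive1 ((fun x => F x ord0 k) \o line s c) a.
Proof.
move=> hF a01 c01 Ga.
have dF : derivable (F \o line s c) a 1.
  by apply/derivable_mxP => i k; rewrite (ord1 i); exact: md_derivable (hF k) _ _ _ a01 c01 Ga.
by split => // k; rewrite !derive1E derive_mx// mxE.
Qed.

Lemma off_mesh s x : @Omega R x -> ~ mesh G x ->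
  [/\ 0 < (flip s x).1 < 1, 0 <= (flip s x).2 <= 1 & ~ G (flip s x).1].
Proof.
move=> Ox; have := (Omega_flip s x).2 Ox => -[h1 /andP[h2 h3]] nG.
by split => //; [rewrite !ltW|move=> g; apply: nG; apply/(mesh_flip G s); left].
Qed.

Lemma jac_line F s x : mesh_derivable_map F -> @Omega R x -> ~ mesh G x -> forall k,
  jac F x (axis s) k =
  derive1 ((fun y => F y ord0 k) \o line s (flip s x).2) (flip s x).1.
Proof.
move=> hF Ox nG k; have [a01 c01 Ga] := off_mesh s Ox nG.
by rewrite mxE pd_line; have [_ ->] := mesh_derivable_map_line s hF a01 c01 Ga.
Qed.

Lemma jac_pd F i x k : mesh_derivable_map F -> @Omega R x -> ~ mesh G x ->
  jac F x i k = pd i (fun y => F y ord0 k) x.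
Proof.
have [s ->] := axis_cases i => hF Ox nG.
by rewrite (jac_line s hF Ox nG) pd_line.
Qed.

Lemma measurable_jac F i k : mesh_derivable_map F ->
  measurable_fun (@Omega R `\` mesh G) (fun x => jac F x i k).
Proof.
move=> hF; apply: eq_measurable_fun (md_measurable (hF k) i) => x.
by rewrite inE => -[Ox nG]; rewrite jac_pd.
Qed.

Lemma line_derive_sub (f g : R * R -> R) s c a : mesh_derivable G f -> mesh_derivable G g ->
  0 < a < 1 -> 0 <= c <= 1 -> ~ G a ->
  derivable ((fun x => f x - g x) \o line s c) a 1 /\
  derive1 ((fun x => f x - g x) \o line s c) a =
  derive1 (f \o line s c) a - derive1 (g \o line s c) a.
Proof.
move=> hf hg a01 c01 Ga.
have df := md_derivable hf (s:=s) a01 c01 Ga.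
have dg := md_derivable hg (s:=s) a01 c01 Ga.
split; first exact: (derivableB df dg).
by rewrite !derive1E; exact: (deriveB df dg).
Qed.

End MeshDerivableMaps.

(** * Measurability of the geometric integrands *)

Section MatrixMeasurability.
Context {R : realType}.
Variable D : set (R * R).

Lemma measurable_fun_compose (f : R * R -> R) (g : R -> R) :
  continuous g -> measurable_fun D f -> measurable_fun D (g \o f).
Proof.
by move=> cg mf; apply: measurableT_comp mf; exact: continuous_measurable_fun.
Qed.

(** Off the set the function is unconstrained, but on it the inverse agrees with the
    continuous function [r |-> 1 / max c r]. *)
Lemma measurable_funV_ge (f : R * R -> R) (c : R) : 0 < c ->
  (forall x, D x -> c <= f x) -> measurable_fun D f ->
  measurable_fun D (fun x => (f x)^-1).
Proof.
move=> c0 cf mf.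
have cg : continuous (fun r : R => (Num.max c r)^-1).
  move=> r; apply: cvgV; first by rewrite gt_eqF// lt_max c0.
  have c1 : {for r, continuous (cst c : R -> R^o)} by exact: cst_continuous.
  have c2 : {for r, continuous (id : R -> R^o)} by [].
  exact: (continuous_max c1 c2).
apply: eq_measurable_fun (measurable_fun_compose cg mf) => x.
by rewrite inE => Dx; rewrite /= max_r// cf.
Qed.

Let mcst (r : R) : measurable_fun D (fun=> r).
Proof. exact: measurable_cst. Qed.

Definition mx_measurable m n (A : R * R -> 'M[R]_(m, n)) : Prop :=
  forall i j, measurable_fun D (fun x => A x i j).

Lemma mx_measurable_tr m n (A : R * R -> 'M[R]_(m, n)) :
  mx_measurable A -> mx_measurable (fun x => (A x)^T).
Proof.
move=> mA i j; apply: eq_measurable_fun (mA j i) => x _; by rewrite mxE.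
Qed.

Lemma mx_measurable_add m n (A B : R * R -> 'M[R]_(m, n)) :
  mx_measurable A -> mx_measurable B -> mx_measurable (fun x => A x + B x).
Proof.
move=> mA mB i j; apply: eq_measurable_fun (measurable_funD (mA i j) (mB i j)) => x _.
by rewrite [RHS]mxE.
Qed.

Lemma mx_measurable_scale m n (f : R * R -> R) (A : R * R -> 'M[R]_(m, n)) :
  measurable_fun D f -> mx_measurable A -> mx_measurable (fun x => f x *: A x).
Proof.
move=> mf mA i j; apply: eq_measurable_fun (measurable_funM mf (mA i j)) => x _.
by rewrite [RHS]mxE.
Qed.

Lemma mx_measurable_opp m n (A : R * R -> 'M[R]_(m, n)) :
  mx_measurable A -> mx_measurable (fun x => - A x).
Proof.
move=> mA i j; apply: eq_measurable_fun (measurable_funM (mcst (-1)) (mA i j)) => x _.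
by rewrite [RHS]mxE /= mulN1r.
Qed.

Lemma mx_measurable_scalar n (f : R * R -> R) : measurable_fun D f ->
  mx_measurable (fun x => (f x)%:M : 'M[R]_n).
Proof.
move=> mf i j; have := measurable_funM mf (mcst (i == j)%:R).
by apply: eq_measurable_fun => x _; rewrite [RHS]mxE /= mulr_natr.
Qed.

Lemma mx_measurable_mul m n q (A : R * R -> 'M[R]_(m, n)) (B : R * R -> 'M[R]_(n, q)) :
  mx_measurable A -> mx_measurable B -> mx_measurable (fun x => A x *m B x).
Proof.
move=> mA mB i j.
have := @measurable_sum _ _ R D _ (index_enum 'I_n) (fun k x => A x i k * B x k j)
  (fun k => measurable_funM (mA i k) (mB k j)).
by apply: eq_measurable_fun => x _; rewrite [RHS]mxE.
Qed.

Lemma measurable_trace n (A : R * R -> 'M[R]_n) : mx_measurable A ->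
  measurable_fun D (fun x => \tr (A x)).
Proof. by move=> mA; apply: measurable_sum => i; exact: mA. Qed.

Lemma measurable_det n (A : R * R -> 'M[R]_n) : mx_measurable A ->
  measurable_fun D (fun x => \det (A x)).
Proof.
move=> mA; apply: measurable_sum => s; apply: measurable_funM => //.
by apply: measurable_prod => i _; exact: mA.
Qed.

Lemma mx_measurable_adj n (A : R * R -> 'M[R]_n) : mx_measurable A -> mx_measurable (fun x => \adj (A x)).
Proof.
move=> mA i j.
have hm : mx_measurable (fun x => row' j (col' i (A x))).
  move=> u v; apply: eq_measurable_fun (mA (lift j u) (lift i v)) => x _.
  by rewrite !mxE.
have := measurable_funM (mcst ((-1) ^+ (j + i))) (measurable_det hm).
by apply: eq_measurable_fun => x _; rewrite [RHS]mxE.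
Qed.

Lemma mx_measurable_inv n (A : R * R -> 'M[R]_n) (c : R) : 0 < c ->
  (forall x, D x -> c <= \det (A x)) -> mx_measurable A -> mx_measurable (fun x => invmx (A x)).
Proof.
move=> c0 cA mA i j.
have := mx_measurable_scale (measurable_funV_ge c0 cA (measurable_det mA)) (mx_measurable_adj mA) i j.
apply: eq_measurable_fun => x; rewrite inE => Dx.
by rewrite /invmx ifT// unitmxE unitfE gt_eqF// (lt_le_trans c0)// cA.
Qed.

Variables (J W : R * R -> 'M[R]_(2, 3)) (c : R).
Hypotheses (mJ : mx_measurable J) (mW : mx_measurable W) (c0 : 0 < c).
Hypothesis cJ : forall x, D x -> c <= \det (gramJ (J x)).

Lemma mx_measurable_gram : mx_measurable (fun x => gramJ (J x)).
Proof. by apply: mx_measurable_mul => //; exact: mx_measurable_tr. Qed.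

Lemma measurable_area : measurable_fun D (fun x => areaJ (J x)).
Proof.
apply: (@measurable_fun_compose _ Num.sqrt); first exact: sqrt_continuous.
exact: (measurable_det mx_measurable_gram).
Qed.

Lemma mx_measurable_lift : mx_measurable (fun x => liftJ (J x)).
Proof.
apply: mx_measurable_mul => //; exact: mx_measurable_inv c0 cJ mx_measurable_gram.
Qed.

Lemma mx_measurable_grad : mx_measurable (fun x => gradJ (J x) (W x)).
Proof. by apply: mx_measurable_mul; [exact: mx_measurable_tr|exact: mx_measurable_lift]. Qed.

Lemma measurable_div_area :
  measurable_fun D (fun x => divJ (J x) (W x) * areaJ (J x)).
Proof.
by apply: measurable_funM; [exact: (measurable_trace mx_measurable_grad)|exact: measurable_area].
Qed.

Lemma mx_measurable_dirichlet : mx_measurable (fun x => dirichletJ (J x)).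
Proof.
apply: mx_measurable_scale; first exact: measurable_area.
by apply: mx_measurable_mul; [exact: mx_measurable_lift|apply: mx_measurable_tr; exact: mx_measurable_lift].
Qed.

Lemma mx_measurable_Bdirichlet : mx_measurable (fun x => BdirichletJ (J x) (W x)).
Proof.
have mB : mx_measurable (fun x => BJ (J x) (W x)).
  apply: mx_measurable_add; first exact: mx_measurable_scalar (measurable_trace mx_measurable_grad).
  by apply: mx_measurable_opp; apply: mx_measurable_add; [|apply: mx_measurable_tr]; exact: mx_measurable_grad.
apply: mx_measurable_scale; first exact: measurable_area.
apply: mx_measurable_mul; last by apply: mx_measurable_tr; exact: mx_measurable_lift.
by apply: mx_measurable_mul => //; exact: mx_measurable_lift.
Qed.

End MatrixMeasurability.

(** * Surface integrals on a pair of close surfaces *)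

Section PulledBack.
Context {R : realType}.
Variable G : set R.
Hypotheses (mG : measurable G) (G0 : leb1 G = 0%E).
Implicit Types (Y Ys W : R * R -> 'rV[R]_3) (f : 'rV[R]_3 -> R).
Notation D := (@Omega R `\` mesh G).

Definition inj_cOmega Y := forall x y, @cOmega R x -> @cOmega R y -> Y x = Y y -> x = y.

Lemma measurable_off_mesh : measurable D.
Proof. by apply: measurableD; [exact: measurable_Omega|exact: measurable_mesh]. Qed.

(** Surface integrals see only the points off the mesh. *)
Lemma surf_intE Y f (g : R * R -> R) :
  (forall x, @Omega R x -> ~ mesh G x -> f (Y x) * areaJ (jac Y x) = g x) ->
  surf_int Y f = \int[@leb2 R]_(x in D) g x.
Proof.
move=> fg; rewrite /surf_int.
rewrite (@Rintegral_setD_null _ _ _ (@leb2 R) _ (mesh G)); last 2 first.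
- exact: measurable_mesh.
- exact: leb2_mesh.
by apply: eq_Rintegral => x; rewrite inE => -[Ox nG]; rewrite -fg.
Qed.

Lemma pd_eq_Omega (f g : R * R -> R) i x : (forall y, @cOmega R y -> f y = g y) ->
  @Omega R x -> pd i f x = pd i g x.
Proof.
move=> fg Ox; apply: near_eq_derive.
have : nbhs x (@Omega R) by exact: open_nbhs_nbhs (conj open_Omega Ox).
by apply: filterS => y /sub_Omega; exact: fg.
Qed.

Lemma surf_gradE Y f (g : R * R -> R) x : inj_cOmega Y ->
  (forall y, @cOmega R y -> f (Y y) = g y) -> @Omega R x ->
  surf_grad Y f (Y x) = (\row_i pd i g x) *m liftJ (jac Y x).
Proof.
move=> iY fg Ox.
have E : \row_i pd i (f \o Y) x = \row_i pd i g x.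
  by apply/rowP => i; rewrite [LHS]mxE [RHS]mxE; exact: pd_eq_Omega.
by rewrite /surf_grad (inv_paramK iY (sub_Omega Ox)) /liftJ mulmxA E.
Qed.

(** The velocity enters through its pullback [W] only: derivatives at an inner
    point see [w \o Y] on a neighbourhood, where it is [W]. *)
Lemma surf_jacE Y w W x : inj_cOmega Y -> mesh_derivable_map G W ->
  (forall y, @cOmega R y -> w (Y y) = W y) -> @Omega R x -> ~ mesh G x ->
  surf_jac Y w (Y x) = gradJ (jac Y x) (jac W x).
Proof.
move=> iY hW wW Ox nG; apply/matrixP => k j; rewrite [LHS]mxE.
rewrite (@surf_gradE Y _ (fun y => W y ord0 k))//; last by move=> y /wW ->.
rewrite /gradJ [LHS]mxE [RHS]mxE; apply: eq_bigr => i _; congr (_ * _).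
by rewrite [LHS]mxE [RHS]mxE (jac_pd _ _ hW).
Qed.

Lemma surf_liftE Ys Y f x : inj_cOmega Y -> @cOmega R x ->
  surf_lift Ys Y f (Y x) = f (Ys x).
Proof. by move=> iY Ox; rewrite /surf_lift /= inv_paramK. Qed.

End PulledBack.

Section SurfaceEstimates.
Context {R : realType}.
Variable G : set R.
Hypotheses (mG : measurable G) (G0 : leb1 G = 0%E).
Notation D := (@Omega R `\` mesh G).

(** The data from which the surface estimates follow: closeness in [W^(1,oo)] and
    uniform immersion, stated pointwise off the mesh. *)
Record close_surfaces (M c d : R) (Y Ys V Vs : R * R -> 'rV[R]_3) : Prop :=
CloseSurfaces {
  cs_Y : mesh_derivable_map G Y ; cs_Ys : mesh_derivable_map G Ys ; cs_V : mesh_derivable_map G V ; cs_Vs : mesh_derivable_map G Vs ;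
  cs_inj : inj_cOmega Y ; cs_injs : inj_cOmega Ys ;
  cs_d : 0 <= d ;
  cs_jac : forall x i k, @Omega R x -> ~ mesh G x ->
    [/\ `|jac Y x i k| <= M, `|jac Ys x i k| <= M,
        `|jac V x i k| <= M, `|jac Vs x i k| <= M &
        `|jac Y x i k - jac Ys x i k| <= d /\ `|jac V x i k - jac Vs x i k| <= d] ;
  cs_det : forall x, @Omega R x -> ~ mesh G x ->
    c <= \det (gramJ (jac Y x)) /\ c <= \det (gramJ (jac Ys x))
}.

Variables (M c d : R) (Y Ys V Vs : R * R -> 'rV[R]_3).
Hypotheses (c0 : 0 < c) (cs : close_surfaces M c d Y Ys V Vs).
Variables (v vs : 'rV[R]_3 -> 'rV[R]_3).
Hypotheses (vV : forall x, @cOmega R x -> v (Y x) = V x)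
           (vsVs : forall x, @cOmega R x -> vs (Ys x) = Vs x).
Variable K : R.
Hypothesis K1 : 1 <= K.
Hypothesis KB : forall x, D x ->
  close_kernels K d (jac Y x) (jac Ys x) (jac V x) (jac Vs x).
Let K0 : 0 < K. Proof. exact: lt_le_trans K1. Qed.
Let mD : measurable D. Proof. exact: measurable_off_mesh. Qed.
Let mmJ : mx_measurable D (jac Y). Proof. by move=> i k; exact: measurable_jac (cs_Y cs). Qed.
Let mmJs : mx_measurable D (jac Ys). Proof. by move=> i k; exact: measurable_jac (cs_Ys cs). Qed.
Let mmW : mx_measurable D (jac V). Proof. by move=> i k; exact: measurable_jac (cs_V cs). Qed.
Let mmWs : mx_measurable D (jac Vs). Proof. by move=> i k; exact: measurable_jac (cs_Vs cs). Qed.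
Let cJ x : D x -> c <= \det (gramJ (jac Y x)).
Proof. by move=> [Ox nG]; have [] := cs_det cs Ox nG. Qed.
Let cJs x : D x -> c <= \det (gramJ (jac Ys x)).
Proof. by move=> [Ox nG]; have [] := cs_det cs Ox nG. Qed.
Let subD : D `<=` @Omega R. Proof. by move=> x []. Qed.

Section Mass.
Variables (eta phi : 'rV[R]_3 -> R).
Hypotheses (ceta : {within @cOmega R, continuous (eta \o Ys)})
           (cphi : {within @cOmega R, continuous (phi \o Ys)}).

Let massP f x := f (Ys x) ^+ 2 * areaJ (jac Ys x).

Lemma mass_integrable f : {within @cOmega R, continuous (f \o Ys)} ->
  (@leb2 R).-integrable D (EFin \o massP f).
Proof.
move=> cf; have [B [B0 fB]] := cOmega_bounded cf.
have mf : measurable_fun D (f \o Ys).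
  by apply: measurable_funS (cOmega_measurable cf) => //; exact: measurable_Omega.
apply: (@bounded_Omega_integrable _ _ _ (B ^+ 2 * K)) => //.
  apply: measurable_funM; last exact: measurable_area.
  exact: (measurable_funM mf mf).
move=> x Dx; rewrite normrM ler_pM//.
  rewrite normrX lerXn2r ?nnegrE//; exact: (fB x (sub_Omega (subD Dx))).
by have [[_ h _] _ _ _ _] := KB Dx.
Qed.

Lemma mass_L2 f : surf_L2 Ys f = Num.sqrt (\int[@leb2 R]_(x in D) massP f x).
Proof. by congr Num.sqrt; exact: surf_intE. Qed.

(** The pulled-back functions are the same on both surfaces; only the weight
    changes. *)
Lemma mass_form (k ks : R * R -> R) :
  measurable_fun D k -> measurable_fun D ks ->
  (forall x, D x -> [/\ `|k x| <= K, `|ks x| <= K & `|ks x - k x| <= K * d]) ->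
  `| \int[@leb2 R]_(x in D) (eta (Ys x) * phi (Ys x) * ks x)
     - \int[@leb2 R]_(x in D) (eta (Ys x) * phi (Ys x) * k x) | <=
  K * K * d * surf_L2 Ys eta * surf_L2 Ys phi.
Proof.
move=> mk mks kB; rewrite !mass_L2.
have mf (f : 'rV[R]_3 -> R) : {within @cOmega R, continuous (f \o Ys)} ->
    measurable_fun D (f \o Ys).
  move=> cf.
  by apply: measurable_funS (cOmega_measurable cf) => //; exact: measurable_Omega.
have mef : measurable_fun D (fun x => eta (Ys x) * phi (Ys x)).
  exact: (measurable_funM (mf _ ceta) (mf _ cphi)).
apply: (@leb2_form_CS _ _ _ _ _ _ (fun x => `|eta (Ys x)|) (fun x => `|phi (Ys x)|)) => //.
- exact: measurable_funM.
- exact: measurable_funM.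
- exact: mass_integrable.
- exact: mass_integrable.
- exact: cs_d cs.
- move=> x Dx; have [_ _ _ _ [h _]] := KB Dx.
  have le f : `|f (Ys x)| ^+ 2 <= K * massP f x.
    by rewrite real_normK ?num_real// /massP mulrCA ler_peMr// sqr_ge0.
  by split.
move=> x Dx; have [h1 h2 h3] := kB x Dx; rewrite -normrM; split.
- by rewrite [leLHS]normrM [leLHS]mulrC ler_wpM2r.
- by rewrite [leLHS]normrM [leLHS]mulrC ler_wpM2r.
- by rewrite -mulrBr [leLHS]normrM [leLHS]mulrC ler_wpM2r.
Qed.

Lemma mass_estimate :
  `| surf_int Ys (fun y => eta y * phi y)
     - surf_int Y (surf_lift Ys Y (fun y => eta y * phi y)) | <=
  K * K * d * surf_L2 Ys eta * surf_L2 Ys phi.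
Proof.
rewrite (@surf_intE _ _ mG G0 Ys _ (fun x => eta (Ys x) * phi (Ys x) * areaJ (jac Ys x)))//.
rewrite (@surf_intE _ _ mG G0 Y _ (fun x => eta (Ys x) * phi (Ys x) * areaJ (jac Y x))).
  apply: mass_form; [exact: measurable_area..|].
  by move=> x Dx; have [] := KB Dx.
by move=> x Ox nG; rewrite (surf_liftE _ _ (cs_inj cs) (sub_Omega Ox)).
Qed.

Lemma div_mass_estimate :
  `| surf_int Ys (fun y => surf_div Ys vs y * (eta y * phi y))
     - surf_int Y (fun y => surf_div Y v y * surf_lift Ys Y (fun z => eta z * phi z) y) | <=
  K * K * d * surf_L2 Ys eta * surf_L2 Ys phi.
Proof.
rewrite (@surf_intE _ _ mG G0 Ys _ (fun x => eta (Ys x) * phi (Ys x) *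
  (divJ (jac Ys x) (jac Vs x) * areaJ (jac Ys x)))); last first.
  move=> x Ox nG; rewrite /surf_div (surf_jacE (cs_injs cs) (cs_Vs cs) vsVs Ox nG).
  by rewrite -/(divJ _ _); ring.
rewrite (@surf_intE _ _ mG G0 Y _ (fun x => eta (Ys x) * phi (Ys x) *
  (divJ (jac Y x) (jac V x) * areaJ (jac Y x)))); last first.
  move=> x Ox nG; rewrite /surf_div (surf_jacE (cs_inj cs) (cs_V cs) vV Ox nG).
  rewrite (surf_liftE _ _ (cs_inj cs) (sub_Omega Ox)).
  by rewrite -/(divJ _ _); ring.
apply: mass_form.
- exact: (@measurable_div_area _ D (jac Y) (jac V) c).
- exact: (@measurable_div_area _ D (jac Ys) (jac Vs) c).
by move=> x Dx; have [] := KB Dx.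
Qed.

End Mass.

Section Dirichlet.
Variables (eta phi : 'rV[R]_3 -> R).
Hypotheses (seta : smooth_on Ys eta) (sphi : smooth_on Ys phi).

Let pgrad f x : 'rV[R]_2 := \row_i pd i (f \o Ys) x.
Let gradP f x := enorm (pgrad f x *m liftJ (jac Ys x)) ^+ 2 * areaJ (jac Ys x).

Lemma gradPE f x :
  gradP f x = (pgrad f x *m dirichletJ (jac Ys x) *m (pgrad f x)^T) ord0 ord0.
Proof. by rewrite /gradP enorm_sqr dirichletE. Qed.

Lemma mx_measurable_pgrad f : smooth_on Ys f -> mx_measurable D (pgrad f).
Proof.
move=> [_ _ h] i j; have [mf _] := h j.
have mf' : measurable_fun D (pd j (f \o Ys)).
  by apply: measurable_funS mf => //; exact: measurable_Omega.
by apply: eq_measurable_fun mf' => x _; rewrite mxE.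
Qed.

Lemma measurable_bilinear f g (k : R * R -> 'M[R]_2) : smooth_on Ys f ->
  smooth_on Ys g -> mx_measurable D k ->
  measurable_fun D (fun x => (pgrad f x *m k x *m (pgrad g x)^T) ord0 ord0).
Proof.
move=> sf sg mk.
have h : mx_measurable D (fun x => pgrad f x *m k x *m (pgrad g x)^T).
  apply: mx_measurable_mul; last by apply: mx_measurable_tr; exact: mx_measurable_pgrad.
  by apply: mx_measurable_mul => //; exact: mx_measurable_pgrad.
exact: h.
Qed.

Lemma pgrad_sqr_integrable f i : smooth_on Ys f ->
  (@leb2 R).-integrable D (EFin \o (fun x => pd i (f \o Ys) x ^+ 2)).
Proof.
move=> [_ _ h]; have [mf hf] := h i.
have ig : (@leb2 R).-integrable (@Omega R) (EFin \o (fun x => pd i (f \o Ys) x ^+ 2)).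
  apply/integrableP; split.
    by apply/measurable_EFinP; exact: (measurable_funM mf mf).
  apply: le_lt_trans hf; rewrite le_eqVlt; apply/orP; left; apply/eqP.
  by apply: eq_integral => x _; rewrite /= ger0_norm// sqr_ge0.
exact: (@integrableS _ _ _ (@leb2 R) _ _ _ measurable_Omega mD subD ig).
Qed.

Lemma l1_sqr_le (a : 'rV[R]_2) : l1 a ^+ 2 <= 2%:R * (a ord0 ord0 ^+ 2 + a ord0 ord_max ^+ 2).
Proof.
rewrite /l1 sum2 -(real_normK (num_real (a ord0 ord0))).
rewrite -(real_normK (num_real (a ord0 ord_max))).
set x := `|_|; set y := `|_|; have := sqr_ge0 (x - y); lra.
Qed.

(** The Dirichlet density has bounded coefficients, and the parameter derivatives are
    square integrable by assumption. *)
Lemma gradP_integrable f : smooth_on Ys f -> (@leb2 R).-integrable D (EFin \o gradP f).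
Proof.
move=> sf.
have i0 := pgrad_sqr_integrable ord0 sf.
have i1 := pgrad_sqr_integrable ord_max sf.
have ig := @RintegrableZ _ _ _ (@leb2 R) _ _ (K * 2%:R) mD
  (@RintegrableD _ _ _ (@leb2 R) _ _ _ mD i0 i1).
apply: (le_leb2_integrable mD _ ig).
  have := measurable_bilinear sf sf (mx_measurable_dirichlet mmJs c0 cJs).
  by apply: eq_measurable_fun => x _; rewrite gradPE.
move=> x Dx; rewrite gradPE.
have [_ _ h _ _] := KB Dx.
have hK i j : `|dirichletJ (jac Ys x) i j| <= K by have [] := h i j.
apply: (le_trans (bilinear_le _ _ hK)); rewrite -mulrA ler_wpM2l ?(ltW K0)// -expr2.
by apply: (le_trans (l1_sqr_le _)); rewrite !mxE.
Qed.

Lemma grad_L2 f : surf_grad_L2 Ys f = Num.sqrt (\int[@leb2 R]_(x in D) gradP f x).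
Proof.
rewrite /surf_grad_L2 (@surf_intE _ _ mG G0 Ys _ (gradP f))// => x Ox nG.
by rewrite (@surf_gradE _ Ys f (f \o Ys))//; exact: cs_injs cs.
Qed.

(** Both Dirichlet forms are bilinear in the same parameter gradients; only the
    coefficient matrix changes. *)
Lemma grad_form (k ks : R * R -> 'M[R]_2) :
  mx_measurable D k -> mx_measurable D ks ->
  (forall x, D x -> forall i j,
    [/\ `|k x i j| <= K, `|ks x i j| <= K & `|(ks x - k x) i j| <= K * d]) ->
  `| \int[@leb2 R]_(x in D) (pgrad eta x *m ks x *m (pgrad phi x)^T) ord0 ord0
     - \int[@leb2 R]_(x in D) (pgrad eta x *m k x *m (pgrad phi x)^T) ord0 ord0 | <=
  K * K * d * surf_grad_L2 Ys eta * surf_grad_L2 Ys phi.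
Proof.
move=> mk mks kB; rewrite !grad_L2.
apply: (@leb2_form_CS _ _ _ _ _ _ (fun x => l1 (pgrad eta x)) (fun x => l1 (pgrad phi x))) => //.
- exact: measurable_bilinear.
- exact: measurable_bilinear.
- exact: gradP_integrable.
- exact: gradP_integrable.
- exact: cs_d cs.
- by move=> x _; split; exact: l1_ge0.
- by move=> x Dx; have [_ _ _ _ [_ h]] := KB Dx; split; exact: h.
move=> x Dx; split.
- by apply: bilinear_le => i j; have [] := kB x Dx i j.
- by apply: bilinear_le => i j; have [] := kB x Dx i j.
rewrite -mx_subE -mulmxBl -mulmxBr.
by apply: bilinear_le => i j; have [] := kB x Dx i j.
Qed.

Lemma surf_grad_liftE f x : @Omega R x ->
  surf_grad Y (surf_lift Ys Y f) (Y x) = pgrad f x *m liftJ (jac Y x).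
Proof.
move=> Ox; apply: surf_gradE => //; first exact: cs_inj cs.
by move=> y Oy; rewrite (surf_liftE _ _ (cs_inj cs) Oy).
Qed.

Lemma surf_grad_selfE f x : @Omega R x ->
  surf_grad Ys f (Ys x) = pgrad f x *m liftJ (jac Ys x).
Proof. by move=> Ox; apply: surf_gradE => //; exact: cs_injs cs. Qed.

Lemma dirichlet_estimate :
  `| surf_int Ys (fun y => dot (surf_grad Ys eta y) (surf_grad Ys phi y))
     - surf_int Y (fun y => dot (surf_grad Y (surf_lift Ys Y eta) y)
                                (surf_grad Y (surf_lift Ys Y phi) y)) | <=
  K * K * d * surf_grad_L2 Ys eta * surf_grad_L2 Ys phi.
Proof.
rewrite (@surf_intE _ _ mG G0 Ys _ (fun x => (pgrad eta x *m dirichletJ (jac Ys x)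
  *m (pgrad phi x)^T) ord0 ord0)); last first.
  by move=> x Ox nG; rewrite !surf_grad_selfE// dirichletE.
rewrite (@surf_intE _ _ mG G0 Y _ (fun x => (pgrad eta x *m dirichletJ (jac Y x)
  *m (pgrad phi x)^T) ord0 ord0)); last first.
  by move=> x Ox nG; rewrite !surf_grad_liftE// dirichletE.
apply: grad_form.
- exact: mx_measurable_dirichlet c0 cJ.
- exact: mx_measurable_dirichlet c0 cJs.
by move=> x Dx; have [] := KB Dx.
Qed.

Lemma B_estimate :
  `| surf_int Ys (fun y => mdot (surf_grad Ys eta y) (surf_B Ys vs y) (surf_grad Ys phi y))
     - surf_int Y (fun y => mdot (surf_grad Y (surf_lift Ys Y eta) y) (surf_B Y v y)
                                (surf_grad Y (surf_lift Ys Y phi) y)) | <=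
  K * K * d * surf_grad_L2 Ys eta * surf_grad_L2 Ys phi.
Proof.
rewrite (@surf_intE _ _ mG G0 Ys _ (fun x => (pgrad eta x *m
  BdirichletJ (jac Ys x) (jac Vs x) *m (pgrad phi x)^T) ord0 ord0)); last first.
  move=> x Ox nG; rewrite !surf_grad_selfE// /surf_B /surf_div.
  by rewrite (surf_jacE (cs_injs cs) (cs_Vs cs) vsVs Ox nG) -BdirichletE.
rewrite (@surf_intE _ _ mG G0 Y _ (fun x => (pgrad eta x *m
  BdirichletJ (jac Y x) (jac V x) *m (pgrad phi x)^T) ord0 ord0)); last first.
  move=> x Ox nG; rewrite !surf_grad_liftE// /surf_B /surf_div.
  by rewrite (surf_jacE (cs_inj cs) (cs_V cs) vV Ox nG) -BdirichletE.
apply: grad_form.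
- exact: mx_measurable_Bdirichlet mmW c0 cJ.
- exact: mx_measurable_Bdirichlet mmWs c0 cJs.
by move=> x Dx; have [] := KB Dx.
Qed.

End Dirichlet.

End SurfaceEstimates.

(** * Boundary integrals *)

Section BoundaryEstimate.
Context {R : realType}.
Variable G : set R.
Hypotheses (mG : measurable G) (Gnull : leb1 G = 0%E) (G0 : G 0) (G1 : G 1).
Implicit Types (Y : R * R -> 'rV[R]_3) (f : 'rV[R]_3 -> R).
Notation E := (`]0, 1[%classic `\` G : set R).

Lemma side_line (k : 'I_4) : exists s c, (c = 0 \/ c = 1) /\ side k = @line R s c.
Proof.
rewrite /side; case: k => -[|[|[|[|//]]]] h /=.
- by exists false, 0; split; [left|].
- by exists false, 1; split; [right|].
- by exists true, 0; split; [left|].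
- by exists true, 1; split; [right|].
Qed.

Lemma le_sum_term n (P : 'I_n -> R) k : (forall j, 0 <= P j) -> P k <= \sum_j P j.
Proof. by move=> P0; rewrite (bigD1 k)//= lerDl sumr_ge0. Qed.

Lemma edge_cOmega s c r : c = 0 \/ c = 1 -> 0 <= r <= 1 -> @cOmega R (line s c r).
Proof. by move=> c01 r01; apply: line_cOmega => //; case: c01 => ->; rewrite lexx ler01. Qed.

Lemma edge_dOmega s c r : c = 0 \/ c = 1 -> 0 <= r <= 1 -> @dOmega R (line s c r).
Proof.
move=> c01 r01; split; first exact: edge_cOmega.
by case: s => -[/=]; case: c01 => ->; rewrite ltxx ?andbF//= => _; rewrite ?ltxx ?andbF.
Qed.

Lemma measurable_edge : measurable E.
Proof. by apply: measurableD => //; exact: measurable_itv. Qed.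

(** The grid contains the end points, so removing it leaves a subset of the open
    edge. *)
Lemma edge_integralE (F H : R -> R) : (forall r, 0 < r < 1 -> ~ G r -> F r = H r) ->
  \int[@leb1 R]_(r in `[0, 1]) F r = \int[@leb1 R]_(r in E) H r.
Proof.
move=> FH; rewrite (@Rintegral_setD_null _ _ _ (@leb1 R) _ G)//.
have -> : `[0, 1]%classic `\` G = E.
  apply/seteqP; split => r /= [] /[!in_itv]/= /andP[r0 r1] nG; split => //.
    rewrite !lt_def r0 r1 !andbT; apply/andP; split; apply/eqP => h; apply: nG.
      by rewrite h.
    by rewrite -h.
  by rewrite !ltW.
by apply: eq_Rintegral => r; rewrite inE => -[] /=; rewrite in_itv/= => r01 nG; exact: FH.
Qed.

Lemma side_derive1_eq Y Y' s c r : c = 0 \/ c = 1 -> 0 < r < 1 ->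
  (forall x, @dOmega R x -> Y x = Y' x) ->
  derive1 (Y \o line s c) r = derive1 (Y' \o line s c) r.
Proof.
move=> c01 r01 YY'; rewrite !derive1E; apply: near_eq_derive.
have : nbhs r (`]0, 1[%classic : set R).
  by apply: open_nbhs_nbhs; split; [exact: interval_open|rewrite /= in_itv].
apply: filterS => u; rewrite /= in_itv/= => /andP[u0 u1].
by apply: YY'; apply: edge_dOmega => //; rewrite !ltW.
Qed.

Definition speed Y s c r := enorm (derive1 (Y \o line s c) r).

Lemma speed_ge0 Y s c r : 0 <= speed Y s c r.
Proof. exact: sqrtr_ge0. Qed.

Lemma side_integralE Y (F : R * R -> R) k s c : side k = line s c ->
  \int[@leb1 R]_(r in `[0, 1]) (F (side k r) * enorm (derive1 (Y \o side k) r)) =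
  \int[@leb1 R]_(r in E) (F (line s c r) * speed Y s c r).
Proof. by move=> ->; apply: edge_integralE. Qed.

(** Parametrisations that agree on the boundary have the same edge curves, hence
    the same tangents and the same boundary integrals. *)
Lemma bdry_int_eq Y Y' f (F : R * R -> R) :
  (forall x, @dOmega R x -> Y x = Y' x) -> (forall x, @dOmega R x -> f (Y x) = F x) ->
  bdry_int Y f = \sum_(k < 4) \int[@leb1 R]_(r in `[0, 1])
    (F (side k r) * enorm (derive1 (Y' \o side k) r)).
Proof.
move=> YY' ff'; apply: eq_bigr => k _.
have [s [c [c01 kE]]] := side_line k.
apply: (etrans (@side_integralE Y (fun x => f (Y x)) k s c kE)).
apply/esym; apply: (etrans (@side_integralE Y' F k s c kE)).
apply/esym; apply: eq_Rintegral => r; rewrite inE => -[] /=; rewrite in_itv/= => r01 _.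
rewrite /speed (side_derive1_eq s c01 r01 YY') ff'//.
by apply: edge_dOmega => //; case/andP: r01 => ? ?; rewrite !ltW.
Qed.

Variables (Y Ys : R * R -> 'rV[R]_3) (M k0 d : R).
Hypotheses (pY : mesh_derivable_map G Y) (pYs : mesh_derivable_map G Ys) (M0 : 0 <= M) (k0_gt0 : 0 < k0) (d0 : 0 <= d).
Hypothesis speedP : forall s c a, c = 0 \/ c = 1 -> 0 < a < 1 -> ~ G a ->
  [/\ forall k, `|derive1 (Y \o line s c) a ord0 k| <= M,
      forall k, `|derive1 (Ys \o line s c) a ord0 k| <= M,
      forall k, `|derive1 (Ys \o line s c) a ord0 k - derive1 (Y \o line s c) a ord0 k| <= d,
      k0 <= enorm (derive1 (Y \o line s c) a)
    & k0 <= enorm (derive1 (Ys \o line s c) a)].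

(** Bounds the lengths of the tangents, their inverses, and the quotient of their
    difference by [d]; see [enorm_close]. *)
Definition edge_const : R := 1 + k0^-1 + 6%:R * M / k0 + 6%:R * M.

Lemma edge_constP : [/\ 1 <= edge_const, k0^-1 <= edge_const,
  6%:R * M / k0 <= edge_const & 6%:R * M <= edge_const].
Proof.
have k1 : 0 <= k0^-1 by rewrite invr_ge0 ltW.
have h6 : 0 <= 6%:R * M by rewrite mulr_ge0.
have h7 : 0 <= 6%:R * M / k0 by rewrite mulr_ge0.
by rewrite /edge_const; clear speedP; split; lra.
Qed.

Lemma measurable_speed s c (Z : R * R -> 'rV[R]_3) : c = 0 \/ c = 1 -> mesh_derivable_map G Z ->
  measurable_fun E (speed Z s c).
Proof.
move=> c01 hZ.
have c01' : 0 <= c <= 1 by case: c01 => ->; rewrite lexx ler01.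
have md k : measurable_fun E (fun r => derive1 (Z \o line s c) r ord0 k).
  apply: eq_measurable_fun (md_measurable_edge (hZ k) s c01) => r.
  rewrite inE => -[] /=; rewrite in_itv/= => r01 nG.
  by have [_ ->] := mesh_derivable_map_line s hZ r01 c01' nG.
have mdot : measurable_fun E (fun r =>
    dot (derive1 (Z \o line s c) r) (derive1 (Z \o line s c) r)).
  apply: (@eq_measurable_fun _ _ _ _ _ (fun r =>
    \sum_(k < 3) derive1 (Z \o line s c) r ord0 k * derive1 (Z \o line s c) r ord0 k)).
    by move=> r _; rewrite dot_sum.
  by apply: measurable_sum => k; exact: measurable_funM.
apply: (measurableT_comp _ mdot).
by apply: continuous_measurable_fun; exact: sqrt_continuous.
Qed.

Lemma enorm_le3 (u : 'rV[R]_3) : (forall k, `|u ord0 k| <= M) -> enorm u <= 6%:R * M.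
Proof.
move=> uM; have h : 0 <= 6%:R * M by rewrite mulr_ge0.
rewrite -(ger0_norm h) -sqrtr_sqr ler_wsqrtr// dot_sum.
apply: (@le_trans _ _ (\sum_(k < 3) M * M)).
  apply: ler_sum => k _; apply: (le_trans (ler_norm _)).
  by rewrite normrM ler_pM.
have -> : (6%:R * M) ^+ 2 = 36%:R * (M * M) by ring.
have := mulr_ge0 M0 M0; rewrite !big_ord_recl big_ord0; lra.
Qed.

Variables (eta phi : 'rV[R]_3 -> R).
Hypotheses (ceta : {within @cOmega R, continuous (eta \o Ys)})
           (cphi : {within @cOmega R, continuous (phi \o Ys)}).
Let K := edge_const.

Let edgeP s c f r := f (Ys (line s c r)) ^+ 2 * speed Ys s c r.

Let mline s c f : c = 0 \/ c = 1 -> {within @cOmega R, continuous (f \o Ys)} ->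
  measurable_fun E (fun r => f (Ys (line s c r))).
Proof.
move=> c01 cf.
have cl : continuous (line s c : R -> R * R).
  move=> r; case: (s).
    have h1 : (fun=> c) u @[u --> r] --> c by exact: cvg_cst.
    have h2 : u @[u --> r] --> r by exact: cvg_id.
    exact: (cvg_pair h1 h2).
  have h1 : (fun=> c) u @[u --> r] --> c by exact: cvg_cst.
  have h2 : u @[u --> r] --> r by exact: cvg_id.
  exact: (cvg_pair h2 h1).
have cF : continuous (fun r => (f \o Ys) (clamp (line s c r))).
  move=> r; apply: (@continuous_comp _ _ _ (line s c) ((f \o Ys) \o clamp)); first exact: cl.
  exact: cOmega_extension.
apply: (@eq_measurable_fun _ _ _ _ _ (fun r => (f \o Ys) (clamp (line s c r)))).
  move=> r; rewrite inE => -[] /=; rewrite in_itv/= => /andP[r0 r1] _.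
  by rewrite clamp_id//; apply: edge_cOmega => //; rewrite !ltW.
by apply: measurable_funTS; exact: continuous_measurable_fun.
Qed.

Let edge_integrable s c f : c = 0 \/ c = 1 -> {within @cOmega R, continuous (f \o Ys)} ->
  (@leb1 R).-integrable E (EFin \o edgeP s c f).
Proof.
move=> c01 cf; have [B [B0 fB]] := cOmega_bounded cf.
apply: (@measurable_bounded_integrable _ _ _ (@leb1 R)).
- exact: measurable_edge.
- apply: (@le_lt_trans _ _ (leb1 (`[0, 1]%classic : set R))).
    apply: le_measure; rewrite ?inE; [exact: measurable_edge|exact: measurable_itv|].
    by move=> r [] /=; rewrite !in_itv/= => /andP[r0 r1] _; rewrite !ltW.
  by rewrite leb1_itvcc// ltry.
- apply: measurable_funM; last exact: measurable_speed.
  by have m := mline s c01 cf; exact: (measurable_funM m m).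
exists (B ^+ 2 * (6%:R * M)); split; first exact: num_real.
move=> x Bx r [] /=; rewrite in_itv/= => r01 nG; apply: le_trans (ltW Bx).
have [_ hM _ _ _] := speedP s c01 r01 nG.
rewrite normrM ler_pM//.
  rewrite normrX lerXn2r ?nnegrE//; apply: (fB (line s c r)).
  by case/andP: r01 => ? ?; apply: edge_cOmega => //; rewrite !ltW.
by rewrite ger0_norm ?speed_ge0// enorm_le3.
Qed.

Let edge_estimate s c : c = 0 \/ c = 1 ->
  `| \int[@leb1 R]_(r in E) (eta (Ys (line s c r)) * phi (Ys (line s c r)) *
       speed Ys s c r)
   - \int[@leb1 R]_(r in E) (eta (Ys (line s c r)) * phi (Ys (line s c r)) *
       speed Y s c r) | <=
  K * K * d * Num.sqrt (\int[@leb1 R]_(r in E) edgeP s c eta r)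
            * Num.sqrt (\int[@leb1 R]_(r in E) edgeP s c phi r).
Proof.
move=> c01.
have mE := measurable_edge.
have mep : measurable_fun E (fun r => eta (Ys (line s c r)) * phi (Ys (line s c r))).
  exact: (measurable_funM (mline s c01 ceta) (mline s c01 cphi)).
have [Kge1 Kinv Kdiv K6] := edge_constP.
have K0 : 0 < K by exact: lt_le_trans Kge1.
have leK x : x <= 6%:R * M -> x <= K.
  by move=> h; exact: (le_trans h).
apply: (@form_CS _ _ _ (@leb1 R) _ _ _ _ _ (fun r => `|eta (Ys (line s c r))|)
  (fun r => `|phi (Ys (line s c r))|)) => //.
- apply: measurable_funM => //; exact: measurable_speed.
- apply: measurable_funM => //; exact: measurable_speed.
- exact: edge_integrable.
- exact: edge_integrable.
- move=> r [] /=; rewrite in_itv/= => r01 nG.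
  have [_ _ _ _ h] := speedP s c01 r01 nG.
  have h1 : 1 <= K * speed Ys s c r.
    rewrite -(mulVf (lt0r_neq0 k0_gt0)); apply: ler_pM => //; last exact: ltW.
    by rewrite invr_ge0 ltW.
  have le f : `|f (Ys (line s c r))| ^+ 2 <= K * edgeP s c f r.
    by rewrite real_normK ?num_real// /edgeP mulrCA ler_peMr// sqr_ge0.
  by split.
move=> r [] /=; rewrite in_itv/= => r01 nG.
have [hY hYs hd hk _] := speedP s c01 r01 nG.
have sY : `|speed Y s c r| <= K by rewrite ger0_norm ?speed_ge0// leK// enorm_le3.
have sYs : `|speed Ys s c r| <= K by rewrite ger0_norm ?speed_ge0// leK// enorm_le3.
have aux (u z B : R) : `|z| <= B -> `|u * z| <= B * `|u|.
  by move=> zB; rewrite normrM mulrC; exact: ler_wpM2r.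
rewrite -normrM; split.
- exact: aux sYs.
- exact: aux sY.
- rewrite -mulrBr; apply: aux.
  apply: (le_trans (enorm_close M0 k0_gt0 hYs hY hd hk)); rewrite ler_wpM2r//.
  by rewrite -natrM; exact: Kdiv.
Qed.

(** On each side the integrands differ by the lengths of the tangents only;
    the four sides are then summed crudely, which costs the factor [4]. *)
Lemma bdry_estimate :
  `| bdry_int Ys (fun y => eta y * phi y) - \sum_(k < 4) \int[@leb1 R]_(s in `[0, 1])
      (eta (Ys (side k s)) * phi (Ys (side k s)) * enorm (derive1 (Y \o side k) s)) | <=
  4%:R * (K * K * d) * bdry_L2 Ys eta * bdry_L2 Ys phi.
Proof.
have L2 (f : 'rV[R]_3 -> R) : forall k s c, side k = line s c ->
    Num.sqrt (\int[@leb1 R]_(r in E) edgeP s c f r) <= bdry_L2 Ys f.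
  move=> k s c kE; apply: ler_wsqrtr.
  rewrite -(@side_integralE Ys (fun x => f (Ys x) ^+ 2) k s c kE).
  apply: (@le_sum_term _ (fun j => \int[@leb1 R]_(r in `[0, 1])
    (f (Ys (side j r)) ^+ 2 * enorm (derive1 (Ys \o side j) r))) k) => j.
  apply: Rintegral_ge0 => r _.
  by apply: mulr_ge0; [exact: sqr_ge0|exact: sqrtr_ge0].
have [Kge1 Kinv Kdiv K6] := edge_constP.
have K0 : 0 <= K := le_trans ler01 Kge1.
have KKd : 0 <= K * K * d := mulr_ge0 (mulr_ge0 K0 K0) d0.
rewrite /bdry_int -sumrB (le_trans (ler_norm_sum _ _ _))//.
have -> : 4%:R * (K * K * d) * bdry_L2 Ys eta * bdry_L2 Ys phi =
    \sum_(k < 4) (K * K * d * bdry_L2 Ys eta * bdry_L2 Ys phi).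
  have sum4 (x : R) : \sum_(k < 4) x = 4%:R * x.
    by clear; rewrite !big_ord_recl big_ord0; ring.
  by rewrite sum4 !mulrA.
apply: ler_sum => k _; have [s [c [c01 kE]]] := side_line k.
have E1 := @side_integralE Ys (fun x => eta (Ys x) * phi (Ys x)) k s c kE.
have E2 := @side_integralE Y (fun x => eta (Ys x) * phi (Ys x)) k s c kE.
apply: (le_trans (y := K * K * d * Num.sqrt (\int[@leb1 R]_(r in E) edgeP s c eta r)
            * Num.sqrt (\int[@leb1 R]_(r in E) edgeP s c phi r))).
  have transfer (u w u' w' e : R) : u = u' -> w = w' -> `|u' - w'| <= e -> `|u - w| <= e.
    by move=> -> ->.
  exact: (transfer _ _ _ _ _ E1 E2 (edge_estimate s c01)).
rewrite -[leLHS]mulrA -[leRHS]mulrA; apply: (ler_wpM2l KKd).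
by apply: ler_pM; [exact: sqrtr_ge0|exact: sqrtr_ge0|exact: L2 kE|exact: L2 kE].
Qed.

End BoundaryEstimate.

(** * The interpolated surface *)

Section FromRegularity.
Context {R : realType}.

Lemma sob_norm_ge0 k q (f : R * R -> R) : (0 <= sob_norm k q f)%E.
Proof.
apply: le_ereal_inf_tmp => _ [D [_ _ ->]].
by apply: sume_ge0 => a _; apply: sume_ge0 => b _; exact: Lnorm_ge0.
Qed.

(** A surface of class C1 up to the boundary is differentiable along the edges by
    [line_is_derive]. *)
Lemma C1_closed_mesh_derivable (G : set R) (f : R * R -> 'rV[R]_3) : measurable G ->
  C1_closed f -> mesh_derivable_map G f.
Proof.
move=> mG [cf df gf] k; have [g gP] := choice gf.
apply: (@C1_mesh_derivable _ G (fun x => f x ord0 k) (fun i x => g i x ord0 k) mG).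
- exact: (coord_within_continuous (k:=k) cf).
- move=> i; have [cg _] := gP i; exact: (coord_within_continuous (k:=k) cg).
move=> i x Ox; have [_ gE] := gP i.
have dfx : derivable f x (dir R i) by apply: diff_derivable; exact: df.
split; first by have /derivable_mxP := dfx; apply.
by rewrite gE// /pd derive_mx// mxE.
Qed.

Variables (p ell : nat) (Q : quasi_interpolant R p ell).
Hypothesis hell : (ell < p)%N.

Lemma qinterp_mesh_derivable N (U : R * R -> 'rV[R]_3) : (0 < N)%N ->
  mesh_derivable_map (@grid R N) (qinterp Q N U).
Proof.
move=> N0 k.
have -> : (fun x => qinterp Q N U x ord0 k) = @spline R p ell N (nb_splines p ell N)
    (fun i j => qi_functional (qi_dom Q N i j) (qi_weight Q N i j) (fun y => U y ord0 k)).
  by apply/funext => x; rewrite mxE.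
exact: spline_mesh_derivable.
Qed.

(** The approximation property of order [p] in [W^(1,oo)], as a Lipschitz bound
    for the interpolation error. *)
Lemma qinterp_lip : exists A : R, 0 <= A /\ forall (M : R) N (U : R * R -> 'rV[R]_3),
  (0 < N)%N -> {within @cOmega R, continuous U} ->
  (vsob_norm p.+1 +oo U <= M%:E)%E ->
  forall k, lip (A * `|M| * N%:R^-1 ^+ p) (fun x => U x ord0 k - qinterp Q N U x ord0 k).
Proof.
have [C CP] := qi_approx Q (q := +oo%E) (leey _).
exists `|C|; split => // M N U N0 cU sU k x y Ox Oy.
have sUk := sob_norm_coord k sU.
have E : (fun x => U x ord0 k - qinterp Q N U x ord0 k) = (fun x =>
    U x ord0 k - qi_sum p ell (qi_dom Q) (qi_weight Q) N (fun y => U y ord0 k) x).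
  by apply/funext => z; rewrite mxE.
apply: (@sob_norm_lip_cOmega R 1 (fun x => U x ord0 k - qinterp Q N U x ord0 k)) => //.
  have c1 := coord_within_continuous (k:=k) cU.
  have c2 := md_continuous (@qinterp_mesh_derivable N U N0 k).
  by move=> z; apply: (cvgB (c1 z) (c2 z)).
rewrite E; apply: (le_trans (CP N 1%N p.+1 (fun x => U x ord0 k) N0 _ _ _ _)) => //.
  by apply: le_lt_trans sUk _; rewrite ltry.
have sU0 := sob_norm_ge0 p.+1 +oo%E (fun x => U x ord0 k).
have h0 : 0 <= N%:R^-1 ^+ p :> R by rewrite exprn_ge0// invr_ge0.
rewrite subn1 /= mulrAC EFinM.
apply: (@le_trans _ _ ((`|C| * N%:R^-1 ^+ p)%:E * sob_norm p.+1 +oo (fun x => U x ord0 k))%E).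
  by apply: lee_wpmul2r => //; rewrite lee_fin ler_wpM2r// ler_norm.
rewrite [leRHS]EFinM; apply: lee_wpmul2l; first by rewrite lee_fin mulr_ge0.
by apply: (le_trans sUk); rewrite lee_fin ler_norm.
Qed.

End FromRegularity.

Section PairBounds.
Context {R : realType}.
Variable G : set R.

(** A difference quotient of a Lipschitz function is bounded by the constant, and so
    is its limit. *)
Lemma pair_line_bounds (U Us : R * R -> 'rV[R]_3) (M d : R) s c a :
  mesh_derivable_map G U -> mesh_derivable_map G Us -> (forall k, lip M (fun x => U x ord0 k)) ->
  (forall k, lip d (fun x => U x ord0 k - Us x ord0 k)) ->
  0 < a < 1 -> 0 <= c <= 1 -> ~ G a -> forall k,
  [/\ `|derive1 ((fun x => U x ord0 k) \o line s c) a| <= M,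
      `|derive1 ((fun x => Us x ord0 k) \o line s c) a| <= M + d
    & `|derive1 ((fun x => U x ord0 k) \o line s c) a
        - derive1 ((fun x => Us x ord0 k) \o line s c) a| <= d].
Proof.
move=> hU hUs lU ld a01 c01 Ga k.
have dU := md_derivable (hU k) (s := s) a01 c01 Ga.
have h1 := line_derive_le (lU k) a01 c01 dU.
have [dd de] := line_derive_sub s (hU k) (hUs k) a01 c01 Ga.
have h2 := line_derive_le (ld k) a01 c01 dd; rewrite de in h2.
move: h1 h2; set u := derive1 _ a; set w := derive1 _ a => h1 h2; split => //.
have -> : w = u - (u - w) by ring.
by apply: (le_trans (ler_normB _ _)); apply: lerD.
Qed.

Lemma pair_jac_bounds (U Us : R * R -> 'rV[R]_3) (M d : R) x :
  mesh_derivable_map G U -> mesh_derivable_map G Us -> (forall k, lip M (fun x => U x ord0 k)) ->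
  (forall k, lip d (fun x => U x ord0 k - Us x ord0 k)) ->
  @Omega R x -> ~ mesh G x -> forall i k,
  [/\ `|jac U x i k| <= M, `|jac Us x i k| <= M + d & `|jac U x i k - jac Us x i k| <= d].
Proof.
move=> hU hUs lU ld Ox nG i k; have [s ->] := axis_cases i.
have [a01 c01 Ga] := off_mesh s Ox nG.
rewrite (jac_line s hU Ox nG) (jac_line s hUs Ox nG).
exact: (pair_line_bounds s hU hUs lU ld a01 c01 Ga).
Qed.

(** The perturbation changes the difference of two image points by at most half of
    what the lower bound for the unperturbed map leaves. *)
Lemma perturbed_inj (U Us : R * R -> 'rV[R]_3) (k d : R) : 0 < k -> 4%:R * k * d <= 1 ->
  (forall y z, @cOmega R y -> @cOmega R z -> `|y - z| <= k * `|U y - U z|) ->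
  (forall j, lip d (fun x => U x ord0 j - Us x ord0 j)) ->
  inj_cOmega Us.
Proof.
move=> k0 kd kU ld x y Ox Oy E.
have d0 : 0 <= d.
  have := @ld ord0 (0, 0) (1, 0); rewrite /= subrr normr0 addr0 sub0r normrN normr1 mulr1.
  by move=> h; apply: (le_trans (normr_ge0 _)); apply: h; split; rewrite /= ?lexx ?ler01.
have c1 : `|x.1 - y.1| <= `|x - y| by rewrite prod_normE le_max lexx.
have c2 : `|x.2 - y.2| <= `|x - y| by rewrite prod_normE le_max lexx orbT.
have h : `|U x - U y| <= d * (`|x - y| + `|x - y|).
  apply: norm_le_coord; first by rewrite mulr_ge0// addr_ge0.
  move=> j; have := ld j x y Ox Oy; rewrite E.
  have -> : U x ord0 j - Us y ord0 j - (U y ord0 j - Us y ord0 j) = (U x - U y) ord0 j.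
    by rewrite !mxE; ring.
  by move=> h; apply: (le_trans h); rewrite ler_wpM2l// lerD.
have h2 := kU x y Ox Oy.
have h3 : `|x - y| <= k * (d * (`|x - y| + `|x - y|)).
  by apply: (le_trans h2); rewrite ler_wpM2l// ltW.
apply/eqP; rewrite -subr_eq0 -normr_eq0; apply/eqP/le_anti/andP; split => //.
have n0 := normr_ge0 (x - y).
move: h3 n0; set n := `|x - y| => h3 n0.
have h4 : 4%:R * k * d * n <= n by rewrite ler_piMl.
have h5 : k * (d * (n + n)) = 2%:R^-1 * (4%:R * k * d * n) by field.
rewrite h5 in h3; lra.
Qed.

End PairBounds.

Lemma lip_le (R : realType) (B B' : R) (f : R * R -> R) : B <= B' -> lip B f -> lip B' f.
Proof.
move=> BB hB x y Ox Oy; apply: (le_trans (hB x y Ox Oy)).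
by rewrite ler_wpM2r// addr_ge0.
Qed.

Section InterpolatedSurface.
Context {R : realType}.
Variables (p ell : nat) (Q : quasi_interpolant R p ell).
Hypothesis hell : (ell < p)%N.
Variables (M kappa T : R) (X : R -> R * R -> 'rV[R]_3).
Hypothesis es : evolving_surface p M kappa T X.
Variables (N : nat) (t : R).
Hypotheses (N0 : (0 < N)%N) (tT : 0 <= t <= T).
Variables (k d : R).
Hypotheses (k1 : 1 <= k) (kk : kappa <= k) (kd : 4%:R * k * d <= 1).
Notation Y := (X t).
Notation V := (time_deriv T X t).
Notation Ys := (qinterp Q N Y).
Notation Vs := (qinterp Q N V).
Hypotheses (lipY : forall j, lip d (fun x => Y x ord0 j - Ys x ord0 j))
           (lipV : forall j, lip d (fun x => V x ord0 j - Vs x ord0 j)).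
Notation G := (@grid R N).

Let k0 : 0 < k. Proof. exact: lt_le_trans k1. Qed.

Lemma bilip y z : @cOmega R y -> @cOmega R z -> `|y - z| <= k * `|Y y - Y z|.
Proof.
by move=> Oy Oz; apply: (le_trans (es_diffeo es tT Oy Oz)); rewrite ler_wpM2r.
Qed.

Lemma interpolation_error_ge0 : 0 <= d.
Proof.
have := @lipY ord0 (0, 0) (1, 0); rewrite /= subrr normr0 addr0 sub0r normrN normr1 mulr1.
by move=> h; apply: (le_trans (normr_ge0 _)); apply: h; split; rewrite /= ?lexx ?ler01.
Qed.

Let d_le : d <= 1.
Proof.
have := interpolation_error_ge0; have : 4%:R * k * d <= 1 := kd; have := k1.
by move=> h1 h2 h3; nra.
Qed.

Lemma surface_lip j : lip `|M| (fun x => Y x ord0 j).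
Proof.
move=> x y Ox Oy; have [cY _ _] := es_smooth es tT.
apply: (@sob_norm_lip_cOmega R p.+1 (fun x => Y x ord0 j)) => //.
  exact: (coord_within_continuous (k:=j) cY).
apply: (le_trans (sob_norm_coord j (es_sob es tT))).
by rewrite lee_fin ler_norm.
Qed.

Lemma velocity_lip j : lip `|M| (fun x => V x ord0 j).
Proof.
move=> x y Ox Oy; have [cV _ _] := es_dt_smooth es tT.
apply: (@sob_norm_lip_cOmega R p.+1 (fun x => V x ord0 j)) => //.
  exact: (coord_within_continuous (k:=j) cV).
apply: (le_trans (sob_norm_coord j (es_dt_sob es tT))).
by rewrite lee_fin ler_norm.
Qed.

Let pY : mesh_derivable_map G Y. Proof. exact: C1_closed_mesh_derivable (@measurable_grid R N) (es_smooth es tT). Qed.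
Let pV : mesh_derivable_map G V. Proof. exact: C1_closed_mesh_derivable (@measurable_grid R N) (es_dt_smooth es tT). Qed.
Let pYs : mesh_derivable_map G Ys. Proof. exact: qinterp_mesh_derivable. Qed.
Let pVs : mesh_derivable_map G Vs. Proof. exact: qinterp_mesh_derivable. Qed.

(** The Lipschitz bounds on the interpolation errors bound their derivatives off
    the mesh.  Injectivity and immersion of the exact surface survive the
    perturbation by [perturbed_inj] and [immersed_perturb]. *)
Lemma interpolated_close_surfaces :
  close_surfaces G (`|M| + 1) ((2%:R * k)^-1 ^+ 4) d Y Ys V Vs.
Proof.
have Mle x : x <= `|M| -> x <= `|M| + 1 by move=> h; rewrite (le_trans h)// lerDl.
have Mde x : x <= `|M| + d -> x <= `|M| + 1 by move=> h; rewrite (le_trans h)// lerD2l.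
split => //.
- move=> x y Ox Oy E; apply/eqP; rewrite -subr_eq0 -normr_eq0; apply/eqP/le_anti.
  by rewrite normr_ge0 andbT (le_trans (bilip Ox Oy))// E subrr normr0 mulr0.
- exact: perturbed_inj k0 kd bilip lipY.
- exact: interpolation_error_ge0.
- move=> x i j Ox nG.
  have [a1 a2 a3] := pair_jac_bounds pY pYs surface_lip lipY Ox nG i j.
  have [b1 b2 b3] := pair_jac_bounds pV pVs velocity_lip lipV Ox nG i j.
  split; [exact: (Mle _ a1)|exact: (Mde _ a2)|exact: (Mle _ b1)|exact: (Mde _ b2)|].
  exact: (conj a3 b3).
move=> x Ox nG; have [_ dY _] := es_smooth es tT.
have im := immersed_jac k0 bilip Ox (dY x Ox).
have k20 : 0 < 2%:R * k by rewrite mulr_gt0.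
split; apply: (det_gram_ge k20).
  move=> a; apply: (le_trans (im a)); rewrite ler_wpM2r// ler_peMl ?(ltW k0)//.
  by rewrite ler1n.
apply: immersed_perturb k0 im _ kd => i j.
by have [_ _] := pair_jac_bounds pY pYs surface_lip lipY Ox nG i j.
Qed.

(** The same on the edges; the lower bounds come from the bi-Lipschitz bound along
    one direction. *)
Lemma interpolated_speed s c a : c = 0 \/ c = 1 -> 0 < a < 1 -> ~ G a ->
  [/\ forall j, `|derive1 (Y \o line s c) a ord0 j| <= `|M| + 1,
      forall j, `|derive1 (Ys \o line s c) a ord0 j| <= `|M| + 1,
      forall j, `|derive1 (Ys \o line s c) a ord0 j - derive1 (Y \o line s c) a ord0 j| <= d,
      (2%:R * k)^-1 <= enorm (derive1 (Y \o line s c) a)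
    & (2%:R * k)^-1 <= enorm (derive1 (Ys \o line s c) a)].
Proof.
move=> c01 a01 nG.
have c01' : 0 <= c <= 1 by case: c01 => ->; rewrite lexx ler01.
have [dY eY] := mesh_derivable_map_line s pY a01 c01' nG.
have [_ eYs] := mesh_derivable_map_line s pYs a01 c01' nG.
have B j := pair_line_bounds s pY pYs surface_lip lipY a01 c01' nG j.
have ge := line_speed_ge k0 bilip a01 c01' dY.
have kh : (2%:R * k)^-1 = k^-1 / 2 by rewrite invfM mulrC.
have ki : 0 < k^-1 by rewrite invr_gt0.
have dk : d <= k^-1 / 2.
  have h : 2%:R * k * d <= 1.
    by apply: le_trans kd; rewrite ler_wpM2r ?interpolation_error_ge0// ler_wpM2r ?(ltW k0)// ler_nat.
  by rewrite -kh -[leRHS]mul1r ler_pdivlMr ?mulr_gt0// mulrC.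
have geD : k^-1 - d <= `|derive1 (Ys \o line s c) a|.
  have h : `|derive1 (Y \o line s c) a - derive1 (Ys \o line s c) a| <= d.
    apply: norm_le_coord; first exact: interpolation_error_ge0.
    by move=> j; rewrite mx_subE eY eYs; have [_ _] := B j.
  have := ler_normD (derive1 (Y \o line s c) a - derive1 (Ys \o line s c) a)
    (derive1 (Ys \o line s c) a).
  by rewrite subrK; move: h ge => h1 h2 h3; rewrite lerBlDr addrC (le_trans h2)// (le_trans h3)// lerD2r.
split.
- by move=> j; rewrite eY; have [h _ _] := B j; rewrite (le_trans h)// lerDl.
- by move=> j; rewrite eYs; have [_ h _] := B j; rewrite (le_trans h)// lerD2l.
- by move=> j; rewrite eY eYs distrC; have [_ _] := B j.
- apply: le_trans (norm_le_enorm _); apply: le_trans ge; rewrite kh.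
  by rewrite ler_pdivrMr// ler_peMr ?(ltW ki)// ler1n.
- apply: le_trans (norm_le_enorm _); apply: le_trans geD; rewrite kh.
  by move: dk; set x := k^-1; lra.
Qed.

End InterpolatedSurface.

Unset Implicit Arguments.

(** * The perturbation estimates *)

Theorem lemma3p4 (R : realType) (p ell : nat) (Q : quasi_interpolant R p ell)
    (M kappa : R) (hp : (2 <= p)%N) (hell : (ell < p)%N) :
  exists C h0 : R, 0 < C /\ 0 < h0 /\
  forall (T : R) (X : R -> R * R -> 'rV[R]_3),
    0 < T -> evolving_surface p M kappa T X ->
  forall N : nat, (0 < N)%N -> N%:R^-1 <= h0 ->
  forall t : R, 0 <= t <= T ->
    let h : R := N%:R^-1 in
    let Xs : R -> R * R -> 'rV[R]_3 := fun s => qinterp Q N (X s) in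
    let v := velocity T X t in
    let vs := velocity T Xs t in
    let L := surf_lift (Xs t) (X t) in
  forall eta phi : 'rV[R]_3 -> R,
    smooth_on (Xs t) eta -> smooth_on (Xs t) phi ->
    [/\ `| surf_int (Xs t) (fun y => eta y * phi y)
           - surf_int (X t) (L (fun y => eta y * phi y)) |
          <= C * h ^+ p * surf_L2 (Xs t) eta * surf_L2 (Xs t) phi,
        `| bdry_int (Xs t) (fun y => eta y * phi y)
           - bdry_int (X 0) (L (fun y => phi y * eta y)) |
          <= C * h ^+ p * bdry_L2 (Xs t) eta * bdry_L2 (Xs t) phi
        /\ ((forall x, @dOmega R x -> Xs t x = Xs 0 x) ->
            `| bdry_int (Xs 0) (fun y => eta y * phi y)
               - bdry_int (X 0) (L (fun y => phi y * eta y)) |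
              <= C * h ^+ p * bdry_L2 (Xs 0) eta * bdry_L2 (Xs 0) phi),
        `| surf_int (Xs t) (fun y =>
             dot (surf_grad (Xs t) eta y) (surf_grad (Xs t) phi y))
           - surf_int (X t) (fun y =>
             dot (surf_grad (X t) (L eta) y) (surf_grad (X t) (L phi) y)) |
          <= C * h ^+ p * surf_grad_L2 (Xs t) eta * surf_grad_L2 (Xs t) phi,
        `| surf_int (Xs t) (fun y => surf_div (Xs t) vs y * (eta y * phi y))
           - surf_int (X t) (fun y =>
             surf_div (X t) v y * L (fun z => eta z * phi z) y) |
          <= C * h ^+ p * surf_L2 (Xs t) eta * surf_L2 (Xs t) phi
      & `| surf_int (Xs t) (fun y =>
             mdot (surf_grad (Xs t) eta y) (surf_B (Xs t) vs y)
                  (surf_grad (Xs t) phi y))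
           - surf_int (X t) (fun y =>
             mdot (surf_grad (X t) (L eta) y) (surf_B (X t) v y)
                  (surf_grad (X t) (L phi) y)) |
          <= C * h ^+ p * surf_grad_L2 (Xs t) eta * surf_grad_L2 (Xs t) phi ].
Proof.
have [A0 [A00 HA]] := qinterp_lip Q hell.
(* [k >= 1] replaces [kappa], and [A >= 1] the constant of the interpolation
   error, so that both are positive whatever the data. *)
pose k := `|kappa| + 1; pose A := A0 * `|M| + 1.
have k1 : 1 <= k by rewrite /k lerDr.
have k0 : 0 < k by exact: lt_le_trans k1.
have A1 : 1 <= A by rewrite /A lerDr mulr_ge0.
have Apos : 0 < A by exact: lt_le_trans A1.
pose c := (2%:R * k)^-1 ^+ 4; pose M1 := `|M| + 1.
have c0 : 0 < c by rewrite exprn_gt0// invr_gt0 mulr_gt0.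
have M10 : 0 <= M1 by rewrite addr_ge0.
have ek0 : 0 < (2%:R * k)^-1 by rewrite invr_gt0 mulr_gt0.
have [K [K1 KB]] := kernel_bounds M10 c0.
pose E := edge_const M1 (2%:R * k)^-1.
pose C := K * K * A + 4%:R * (E * E * A).
have E20 : 0 <= E * E * A.
  by rewrite -expr2 mulr_ge0 ?sqr_ge0// ltW.
have K20 : 0 < K * K * A by rewrite !mulr_gt0// (lt_le_trans _ K1).
have KC : K * K * A <= C by rewrite /C lerDl mulr_ge0.
have EC : 4%:R * (E * E * A) <= C by rewrite /C lerDr ltW.
(* [h0] is chosen so that [4 * k * d <= 1] for the error bound [d = A * h ^+ p]. *)
exists C, (4%:R * k * A)^-1; split; first exact: lt_le_trans KC.
split; first by rewrite invr_gt0 !mulr_gt0.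
move=> T X T0 es N N0 Nh0 t tT h Xs v vs L eta phi seta sphi.
have h0 : 0 < h by rewrite invr_gt0 ltr0n.
have h1 : h <= 1 by rewrite invf_le1 ?ltr0n// ler1n.
pose d := A * h ^+ p.
have hp0 : 0 <= h ^+ p by rewrite exprn_ge0// ltW.
have kd : 4%:R * k * d <= 1.
  have hph : h ^+ p <= h.
    by rewrite -[leRHS]expr1 ler_wiXn2l// ?(ltW h0)// (leq_trans _ hp).
  rewrite /d mulrA; apply: (@le_trans _ _ (4%:R * k * A * h)).
    by rewrite ler_wpM2l// !mulr_ge0// ltW.
  by rewrite -ler_pdivlMl ?mulr_gt0// mulr1.
have kk : kappa <= k by rewrite (le_trans (ler_norm _))// lerDl.
have [cX _ _] := es_smooth es tT; have [cV _ _] := es_dt_smooth es tT.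
have Ad : A0 * `|M| * h ^+ p <= d by rewrite ler_wpM2r// lerDl.
have lipY j := lip_le Ad (HA M N (X t) N0 cX (es_sob es tT) j).
have lipV j := lip_le Ad (HA M N _ N0 cV (es_dt_sob es tT) j).
have cs := interpolated_close_surfaces hell es N0 tT k1 kk kd lipY lipV.
have sp := interpolated_speed hell es N0 tT k1 kk kd lipY.
have vV x : @cOmega R x -> v (X t x) = time_deriv T X t x.
  by move=> Ox; rewrite /v /velocity /= (inv_paramK (cs_inj cs) Ox).
have vsVs x : @cOmega R x -> vs (Xs t x) = qinterp Q N (time_deriv T X t) x.
  move=> Ox; rewrite /vs /velocity /= (inv_paramK (cs_injs cs) Ox).
  exact: (time_deriv_qinterp T0 es).
have mG := @measurable_grid R N; have Gnull := @leb1_grid R N.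
have G0 : @grid R N 0 by exists 0%N; rewrite mul0r.
have G1 : @grid R N 1 by exists N; rewrite divff// pnatr_eq0 -lt0n.
have KB' : forall x, (@Omega R `\` mesh (@grid R N)) x -> _ := fun x Dx =>
  KB (jac (X t) x) (jac (Xs t) x) (jac (time_deriv T X t) x)
    (jac (qinterp Q N (time_deriv T X t)) x) d
    (fun i j => let: And5 h _ _ _ _ := cs_jac cs i j Dx.1 Dx.2 in h)
    (fun i j => let: And5 _ h _ _ _ := cs_jac cs i j Dx.1 Dx.2 in h)
    (fun i j => let: And5 _ _ h _ _ := cs_jac cs i j Dx.1 Dx.2 in h)
    (fun i j => let: And5 _ _ _ h _ := cs_jac cs i j Dx.1 Dx.2 in h)
    (fun i j => let: And5 _ _ _ _ (conj h _) := cs_jac cs i j Dx.1 Dx.2 in h)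
    (fun i j => let: And5 _ _ _ _ (conj _ h) := cs_jac cs i j Dx.1 Dx.2 in h)
    (cs_det cs Dx.1 Dx.2).1 (cs_det cs Dx.1 Dx.2).2.
have [ceta _ _] := seta; have [cphi _ _] := sphi.
have up (K' a b x : R) : K' * A <= C -> 0 <= a -> 0 <= b -> x <= K' * d * a * b ->
    x <= C * h ^+ p * a * b.
  move=> KA a0 b0 hx; apply: (le_trans hx).
  by apply: ler_wpM2r => //; apply: ler_wpM2r => //; rewrite /d mulrA ler_wpM2r.
have s0 (x : R) : 0 <= Num.sqrt x := sqrtr_ge0 x.
have bdry : `| bdry_int (Xs t) (fun y => eta y * phi y)
           - bdry_int (X 0) (L (fun y => phi y * eta y)) |
          <= C * h ^+ p * bdry_L2 (Xs t) eta * bdry_L2 (Xs t) phi.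
  have EC' : 4%:R * (E * E) * A <= C by rewrite -mulrA.
  apply: (up _ _ _ _ EC' (s0 _) (s0 _)).
  have hX0 x : @dOmega R x -> X 0 x = X t x by move=> Ox; rewrite (es_boundary es tT Ox).
  have hL x : @dOmega R x -> L (fun y => phi y * eta y) (X 0 x)
      = eta (Xs t x) * phi (Xs t x).
    by move=> Ox; rewrite hX0// /L (surf_liftE _ _ (cs_inj cs) Ox.1) mulrC.
  rewrite (bdry_int_eq mG Gnull G0 G1 hX0 hL).
  have := bdry_estimate mG Gnull G0 G1 (cs_Y cs) (cs_Ys cs) M10 ek0 (cs_d cs) sp ceta cphi.
  by rewrite -/E !mulrA.
split.
- apply: (up _ _ _ _ KC (s0 _) (s0 _)).
  exact: (mass_estimate mG Gnull cs K1 KB' ceta cphi).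
- split; first exact: bdry.
  move=> bd.
  have bdE f : bdry_int (Xs 0) f = bdry_int (Xs t) f.
    have bd' x : @dOmega R x -> Xs 0 x = Xs t x by move=> Ox; rewrite bd.
    apply: (@bdry_int_eq _ _ mG Gnull G0 G1 _ _ _ (fun x => f (Xs t x)) bd') => x Ox.
    by rewrite bd'.
  by rewrite /bdry_L2 !bdE; exact: bdry.
- apply: (up _ _ _ _ KC (s0 _) (s0 _)).
  exact: (dirichlet_estimate mG Gnull c0 cs K1 KB' seta sphi).
- apply: (up _ _ _ _ KC (s0 _) (s0 _)).
  exact: (div_mass_estimate mG Gnull c0 cs vV vsVs K1 KB' ceta cphi).
- apply: (up _ _ _ _ KC (s0 _) (s0 _)).
  exact: (B_estimate mG Gnull c0 cs vV vsVs K1 KB' seta sphi).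
Qed.
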